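(* Let $X$ be a compact, locally simply connected length space with no conjugate points and finite Hausdorff dimension $d$. Then every Abelian subgroup of $\pi_1(X)$ is isomorphic to $\mathbb{Z}^k$ for some integer $0 \leq k \leq d$.
   Context: A locally simply connected length space $X$ with universal cover $\pi:\hat X\to X$ (equipped with the lifted length metric $\hat d$) is said to have no conjugate points if any two points of $\hat X$ are joined by a unique geodesic. *)

(* Defs.v *)
From HB Require Import structures.
From mathcomp Require Import all_boot all_order all_algebra.
From mathcomp Require Import all_classical all_reals all_analysis.
Set Implicit Arguments.
Unset Strict Implicit.
Unset Printing Implicit Defensive.
Import Order.TTheory GRing.Theory Num.Theory.
Import numFieldNormedType.Exports.
Local Open Scope classical_set_scope.
Local Open Scope ring_scope.

Section Defs.
Variable R : realType.

Definition I01 : set R := `[0%R, 1%R]%classic.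

Section Homotopy.
Variable T : topologicalType.

Definition path_in (V : set T) (g : R -> T) (x y : T) : Prop :=
  {within I01, continuous g} /\ g 0 = x /\ g 1 = y /\ g @` I01 `<=` V.

Definition is_path (g : R -> T) (x y : T) : Prop := path_in setT g x y.

Definition homotopic_in (V : set T) (g h : R -> T) : Prop :=
  exists H : R * R -> T,
    {within I01 `*` I01, continuous H} /\
    (forall t, I01 t -> H (t, 0) = g t /\ H (t, 1) = h t) /\
    (forall s, I01 s -> H (0, s) = g 0 /\ H (1, s) = g 1) /\
    H @` (I01 `*` I01) `<=` V.

Definition homotopic (g h : R -> T) : Prop := homotopic_in setT g h.

Definition path_connected_set (V : set T) : Prop :=
  forall x y, V x -> V y -> exists g, path_in V g x y.

Definition simply_connected (V : set T) : Prop :=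
  path_connected_set V /\
  forall x g, V x -> path_in V g x x -> homotopic_in V g (fun=> x).

Definition locally_simply_connected : Prop :=
  forall (x : T) (U : set T), nbhs x U ->
    exists V : set T, open V /\ V x /\ V `<=` U /\ simply_connected V.

Definition concat (g h : R -> T) : R -> T :=
  fun t => if t <= 2^-1 then g (2 * t) else h (2 * t - 1).
Definition rev_path (g : R -> T) : R -> T := fun t => g (1 - t).

End Homotopy.

Definition covering_map (Y X : topologicalType) (p : Y -> X) : Prop :=
  continuous p /\ (forall x, exists y, p y = x) /\
  forall x : X, exists U : set X, open U /\ U x /\
    exists (I : Type) (V : I -> set Y),
      p @^-1` U = \bigcup_(i in setT) V i /\
      (forall i, open (V i)) /\
      (forall i j, i <> j -> V i `&` V j = set0) /\
      (forall i, {in V i &, injective p} /\ p @` V i = U /\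
         exists s : X -> Y, (forall u, U u -> V i (s u) /\ p (s u) = u) /\
                           {within U, continuous s}).

Definition universal_cover (Y X : topologicalType) (p : Y -> X) : Prop :=
  covering_map p /\ simply_connected (@setT Y).

Section Metric.
Variable X : metricType R.

Definition curve_length (g : R -> X) : \bar R :=
  ereal_sup [set z | exists (n : nat) (t : nat -> R),
     t 0%N = 0 /\ t n = 1 /\ (forall i, (i < n)%N -> t i <= t i.+1) /\
     z = ((\sum_(i < n) mdist (g (t i)) (g (t i.+1)))%:E)].

Definition length_space : Prop :=
  forall x y : X, (mdist x y)%:E =
    ereal_inf [set curve_length g | g in [set g | is_path g x y]].

Definition lifted_dist (Y : topologicalType) (p : Y -> X) (a b : Y) : \bar R :=
  ereal_inf [set curve_length (p \o g) | g in [set g | is_path g a b]].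

Definition geodesic (Y : topologicalType) (dh : Y -> Y -> \bar R)
   (g : R -> Y) (a b : Y) : Prop :=
  is_path g a b /\
  exists c : R, 0 <= c /\ forall t, I01 t -> exists e : R, 0 < e /\
    forall s s', I01 s -> I01 s' -> `|s - t| < e -> `|s' - t| < e ->
      dh (g s) (g s') = (c * `|s - s'|)%:E.

Definition no_conjugate_points : Prop :=
  forall (Y : topologicalType) (p : Y -> X), universal_cover p ->
    forall a b : Y,
      (exists g, geodesic (lifted_dist p) g a b) /\
      (forall g h, geodesic (lifted_dist p) g a b ->
                   geodesic (lifted_dist p) h a b ->
                   forall t, I01 t -> g t = h t).

Definition diam_set (A : set X) : R :=
  sup [set z | exists x y, A x /\ A y /\ z = mdist x y].

Definition hterm (s : R) (A : set X) : R :=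
  if pselect (A = set0) is left _ then 0 else powR (diam_set A) s.

Definition hausdorff_delta (s delta : R) : \bar R :=
  ereal_inf [set z | exists U : nat -> set X,
     [set: X] `<=` \bigcup_n U n /\
     (forall n x y, U n x -> U n y -> mdist x y <= delta) /\
     z = (\sum_(0 <= n <oo) (hterm s (U n))%:E)%E].

Definition hausdorff_measure (s : R) : \bar R :=
  ereal_sup [set hausdorff_delta s delta | delta in [set delta | 0 < delta]].

Definition hausdorff_dim : \bar R :=
  ereal_inf [set s%:E | s in [set s | 0 <= s /\ hausdorff_measure s = 0%E]].

(* S is (the set of representatives of) a subgroup of pi_1(X, x0):
   loops at x0, closed under homotopy, concatenation, reversal,
   containing the constant loop *)
Definition loop_subgroup (x0 : X) (S : set (R -> X)) : Prop :=
  (forall g, S g -> is_path g x0 x0) /\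
  (forall g h, S g -> is_path h x0 x0 -> homotopic g h -> S h) /\
  S (fun=> x0) /\
  (forall g h, S g -> S h -> S (concat g h)) /\
  (forall g, S g -> S (rev_path g)).

Definition abelian_loop_subgroup (x0 : X) (S : set (R -> X)) : Prop :=
  loop_subgroup x0 S /\
  forall g h, S g -> S h -> homotopic (concat g h) (concat h g).

Definition isomorphic_to_Zk (S : set (R -> X)) (k : nat) : Prop :=
  exists phi : 'rV[int]_k -> (R -> X),
    (forall a, S (phi a)) /\
    (forall a b, homotopic (phi (a + b)) (concat (phi a) (phi b))) /\
    (forall a b, homotopic (phi a) (phi b) -> a = b) /\
    (forall g, S g -> exists a, homotopic g (phi a)).

End Metric.
End Defs.

(* Main.v *)
(* The universal cover of X, built as the set of homotopy classes of paths from x0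
   with the length metric, is a proper length space in which geodesics are unique;
   hence every local geodesic is minimizing and geodesics depend continuously on
   their endpoints.  A deck transformation g <> 1 attains its minimal displacement
   l(g), at a point whose orbit lies on a local geodesic, so l(g^n) = n l(g).  On an
   Abelian group l is therefore a homogeneous, subadditive function bounded away
   from 0 off the identity, and an Abelian group of finite rank carrying such a norm
   is free.  For the rank, k independent commuting deck transformations give a
   piecewise geodesic map of a large cube into the cover that stays near the orbit,
   so that the distance functions to the orbits of opposite faces are far apart; by a
   cubical Sperner lemma these k Lipschitz functions take approximately every value
   in a unit cube, which forces the Hausdorff dimension to be at least k. *)
Require Import Defs.
From HB Require Import structures.
From mathcomp Require Import all_boot all_order all_algebra.
From mathcomp Require Import all_classical all_reals all_analysis.
From mathcomp Require Import zify ring lra.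
Import Order.TTheory GRing.Theory Num.Theory.
Import numFieldNormedType.Exports.
Set Implicit Arguments.
Unset Strict Implicit.
Unset Printing Implicit Defensive.
Local Open Scope classical_set_scope.
Local Open Scope ring_scope.

(** * Paths and homotopies *)

(** The hypothesis on conjugate points speaks of universal covers with their lifted metric, so it
    says something only once a concrete cover is shown to be universal and its metric to be the
    lifted one. Geodesics are defined locally; a minimizing one is obtained by compactness, and
    uniqueness then forces every local geodesic to be that one. Subadditivity of l comes from large
    powers: for an axial isometry the displacement of the m-th power at any point is m l up to an
    error independent of m, which disappears after division by m. Homogeneity and the gap at 0 bound
    denominators: an element whose multiple comes too close to a lattice has that multiple in the
    lattice. In the dimension bound the cube map is merely continuous and says nothing about
    Hausdorff measure; the measure is compared with volume through 1-Lipschitz functions going back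
    to real coordinates, whose values are counted at scale 1/N. A cover of X pulls back to the
    universal cover with the multiplicity of finitely many small balls, and since the measure in
    question is 0 this constant can be absorbed. *)

Section Clamp.
Variable R : realType.
Implicit Types (t s : R).

Lemma I01P t : I01 t <-> 0 <= t /\ t <= 1.
Proof. by rewrite /I01 /= in_itv /=; split => [/andP|[-> ->]]. Qed.

(** Retraction of the line onto the unit interval. Paths are only continuous within [I01]; composing
    with [clamp] makes them continuous everywhere without changing their homotopy class or
    length. *)
Definition clamp t : R := Num.max 0 (Num.min t 1).

Lemma clampI t : I01 (clamp t).
Proof. by apply/I01P; rewrite /clamp; split; rewrite ?le_max ?lexx // ge_max ler01 ge_min lexx orbT. Qed.

Lemma clamp_id t : I01 t -> clamp t = t.
Proof.
by move/I01P => [t0 t1]; rewrite /clamp (min_idPl t1); apply/max_idPr.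
Qed.

Lemma clamp0 : clamp 0 = 0.
Proof. by apply: clamp_id; apply/I01P. Qed.

Lemma clamp1 : clamp 1 = 1.
Proof. by apply: clamp_id; apply/I01P. Qed.

Lemma continuous_clamp : continuous clamp.
Proof.
move=> t; rewrite /clamp.
apply: (@continuous_max R R (fun=> 0) (fun t => Num.min t 1)); first exact: cvg_cst.
by apply: (@continuous_min R R id (fun=> 1)); [exact: cvg_id|exact: cvg_cst].
Qed.

Lemma continuous_within_comp (U V T : topologicalType) (A : set V) (g : V -> T)
  (c : U -> V) : {within A, continuous g} -> continuous c -> (forall x, A (c x)) ->
  continuous (g \o c).
Proof.
move=> /subspace_continuousP gc cc cA x.
apply: (@cvg_comp _ _ _ c g _ (within A (nbhs (c x)))); last exact: gc.
move=> W; rewrite /within /= => AW.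
have : \forall y \near x, A (c y) -> W (c y) by exact: (cc x _ AW).
by apply: filterS => y; apply.
Qed.

Lemma continuous_if_le (U T : topologicalType) (c : U -> R) (a : R) (F G : U -> T) :
  continuous c -> continuous F -> continuous G ->
  (forall u, c u = a -> F u = G u) ->
  continuous (fun u => if c u <= a then F u else G u).
Proof.
move=> cc Fc Gc FG u W; rewrite /continuous_at /= => Wu.
suff: \forall v \near u, W (if c v <= a then F v else G v) by [].
move: Wu; have [lt|lt|e] := ltgtP (c u) a => Wu.
- have H1 : \forall v \near u, c v < a by exact: (cvgr_lt (c u) (cc u)).
  have H2 : \forall v \near u, W (F v) by exact: (Fc u _ Wu).
  by apply: filterS2 H1 H2 => v /ltW ->.
- have H1 : \forall v \near u, a < c v by exact: (cvgr_gt (c u) (cc u)).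
  have H2 : \forall v \near u, W (G v) by exact: (Gc u _ Wu).
  by apply: filterS2 H1 H2 => v; rewrite ltNge => /negbTE ->.
- have H1 : \forall v \near u, W (F v) by exact: (Fc u _ Wu).
  rewrite (FG u e) in Wu.
  have H2 : \forall v \near u, W (G v) by exact: (Gc u _ Wu).
  by apply: filterS2 H1 H2 => v; case: ifP.
Qed.

(** The set of [t] satisfying [P] is open and closed, and the line is connected. This is the
    continuation principle behind rectifiable approximation and uniqueness of lifts. *)
Lemma clopen_real_ind (P : R -> Prop) : P 0 ->
  (forall t, \forall t' \near t, P t' <-> P t) -> forall t, P t.
Proof.
move=> P0 Pn t.
have oP : open [set t | P t].
  rewrite openE => s /= Ps; rewrite /interior /=.
  by have := Pn s; apply: filterS => r [_]; exact.
have oNP : open [set t | ~ P t].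
  rewrite openE => s /= Ps; rewrite /interior /=.
  by have := Pn s; apply: filterS => r [H _] /H.
have cR : connected [set: R] by apply/connected_intervalP => x y _ _ z _.
have -> // : P t = [set t | P t] t by [].
suff -> : [set t | P t] = setT by [].
apply: cR; first by exists 0.
- by exists [set t | P t] => //; rewrite setTI.
- exists [set t | P t]; last by rewrite setTI.
  rewrite -[X in closed X]setCK; apply: open_closedC; exact: oNP.
Qed.

End Clamp.

Section Cont.
Variables (U V T : topologicalType) (R : realType).
Lemma continuous_pair (f : U -> V) (g : U -> T) : continuous f -> continuous g ->
  continuous (fun x => (f x, g x)).
Proof. by move=> fc gc x; apply: (@cvg_pair _ _ _ (nbhs x) (nbhs (f x)) (nbhs (g x))); [exact: fc|exact: gc]. Qed.
Lemma continuous_fst : continuous (fun p : U * V => p.1).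
Proof. by move=> x; exact: cvg_fst. Qed.
Lemma continuous_snd : continuous (fun p : U * V => p.2).
Proof. by move=> x; exact: cvg_snd. Qed.
Lemma continuousD2 (f g : U -> R) : continuous f -> continuous g -> continuous (fun x => f x + g x).
Proof. by move=> fc gc x; apply: cvgD; [exact: fc|exact: gc]. Qed.
Lemma continuousM2 (f g : U -> R) : continuous f -> continuous g -> continuous (fun x => f x * g x).
Proof. by move=> fc gc x; apply: cvgM; [exact: fc|exact: gc]. Qed.
Lemma continuousN1 (f : U -> R) : continuous f -> continuous (fun x => - f x).
Proof. by move=> fc x; apply: cvgN; exact: fc. Qed.
Lemma continuous_cst (a : V) : continuous (fun _ : U => a).
Proof. by move=> x; exact: cvg_cst. Qed.
Lemma continuous_idfun : continuous (fun x : U => x).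
Proof. by move=> x; exact: cvg_id. Qed.
Lemma continuous_app (g : V -> T) (f : U -> V) : continuous g -> continuous f -> continuous (fun x => g (f x)).
Proof. by move=> gc fc x; apply: continuous_comp; [exact: fc|exact: gc]. Qed.
End Cont.

Section Cont1.
Variables (R : realType) (a : R).
Lemma continuous_mul_cst : continuous (fun x : R => a * x).
Proof. by apply: continuousM2; [exact: continuous_cst|exact: continuous_idfun]. Qed.
Lemma continuous_add_cst : continuous (fun x : R => a + x).
Proof. by apply: continuousD2; [exact: continuous_cst|exact: continuous_idfun]. Qed.
Lemma continuous_opp : continuous (fun x : R => - x).
Proof. by apply: continuousN1; exact: continuous_idfun. Qed.
End Cont1.

Ltac cont1 := lazymatch goal with
  | |- continuous (fun x => x) => exact: continuous_idfun
  | |- continuous id => exact: continuous_idfun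
  | |- continuous (GRing.mul _) => exact: continuous_mul_cst
  | |- continuous (Algebra.add _) => exact: continuous_add_cst
  | |- continuous (Algebra.opp) => exact: continuous_opp
  | |- continuous fst => exact: continuous_fst
  | |- continuous snd => exact: continuous_snd
  | |- continuous (@clamp _) => exact: continuous_clamp
  | |- continuous (fun x => fst x) => exact: continuous_fst
  | |- continuous (fun x => snd x) => exact: continuous_snd
  | |- continuous (fun x => fst _) => apply: (continuous_app (g := fst)); first exact: continuous_fst
  | |- continuous (fun x => snd _) => apply: (continuous_app (g := snd)); first exact: continuous_snd
  | |- continuous (fun x => pair _ _) => apply: continuous_pair
  | |- continuous (fun x => GRing.add _ _) => apply: continuousD2
  | |- continuous (fun x => Algebra.add _ _) => apply: continuousD2
  | |- continuous (fun x => Algebra.opp _) => apply: continuousN1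
  | |- continuous (fun x => GRing.mul _ _) => apply: continuousM2
  | |- continuous (fun x => clamp _) => apply: (continuous_app (g := @clamp _)); first exact: continuous_clamp
  | H : continuous ?f |- continuous ?f => exact: H
  | H : continuous ?f |- continuous (fun x => ?f _) => apply: (continuous_app (g := f)); first exact: H
  | |- continuous (fun x => ?c) => exact: continuous_cst
   end.
Ltac cont := repeat cont1.

(* MathComp's path.rev_path shadows the one of Defs. *)
Notation revp := Defs.rev_path.

Section Homotopy.
Variables (R : realType) (T : topologicalType).
Implicit Types (f g h k : R -> T) (H : R * R -> T) (c d : R -> R).

Let I0 : I01 (0 : R). Proof. by apply/I01P. Qed.
Let I1 : I01 (1 : R). Proof. by apply/I01P. Qed.

Let E211 : 2 * 1 - 1 = 1 :> R. Proof. ring. Qed.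

Lemma homotopicI H g h : continuous H ->
  (forall t, I01 t -> H (t, 0) = g t) -> (forall t, I01 t -> H (t, 1) = h t) ->
  (forall s, I01 s -> H (0, s) = g 0) -> (forall s, I01 s -> H (1, s) = g 1) ->
  homotopic g h.
Proof.
move=> Hc H0 H1 Hl Hr; exists H; split; first exact: continuous_subspaceT.
by split=> [t It|]; [rewrite H0 ?H1|split=> // s Is; rewrite Hl ?Hr].
Qed.

Lemma homotopicE g h : homotopic g h -> exists H, [/\ continuous H,
  forall t, H (t, 0) = g (clamp t), forall t, H (t, 1) = h (clamp t),
  forall s, H (0, s) = g 0 & forall s, H (1, s) = g 1].
Proof.
move=> [H [Hc [H01 [Hlr _]]]].
exists (fun p => H (clamp p.1, clamp p.2)); split.
- apply: (@continuous_within_comp _ _ _ (@I01 R `*` @I01 R) H (fun p : R * R => (clamp p.1, clamp p.2)) Hc).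
  + by cont.
  + by move=> p; split => /=; exact: clampI.
- by move=> t /=; rewrite clamp0; have [] := H01 _ (clampI t).
- by move=> t /=; rewrite clamp1; have [] := H01 _ (clampI t).
- by move=> s /=; rewrite clamp0; have [] := Hlr _ (clampI s).
- by move=> s /=; rewrite clamp1; have [] := Hlr _ (clampI s).
Qed.

Lemma homotopic_ends g h : homotopic g h -> h 0 = g 0 /\ h 1 = g 1.
Proof.
move=> /homotopicE[H [_ _ H1 Hl Hr]]; split.
  by rewrite -(Hl 1) H1 clamp0.
by rewrite -(Hr 1) H1 clamp1.
Qed.

Lemma homotopic_ext g h : continuous g -> (forall t, I01 t -> g t = h t) ->
  homotopic g h.
Proof.
move=> gc gh; apply: (homotopicI (H := fun p => g p.1)) => //; first by cont.
Qed.

Lemma homotopic_refl g : continuous g -> homotopic g g.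
Proof. by move=> gc; apply: homotopic_ext. Qed.

Lemma homotopic_sym g h : homotopic g h -> homotopic h g.
Proof.
move=> gh; have [h0 h1] := homotopic_ends gh.
have [H [Hc H0 H1 Hl Hr]] := homotopicE gh.
apply: (homotopicI (H := fun p => H (p.1, 1 - p.2))) => [|t It|t It|s _|s _] /=; first by cont.
- by rewrite subr0 H1 clamp_id.
- by rewrite subrr H0 clamp_id.
- by rewrite Hl h0.
- by rewrite Hr h1.
Qed.

Lemma homotopic_trans g h k : homotopic g h -> homotopic h k -> homotopic g k.
Proof.
move=> gh hk; have [h0 h1] := homotopic_ends gh.
have [H [Hc H0 H1 Hl Hr]] := homotopicE gh.
have [K [Kc K0 K1 Kl Kr]] := homotopicE hk.
apply: (homotopicI (H := fun p => if p.2 <= 2^-1 then H (p.1, 2 * p.2) else K (p.1, 2 * p.2 - 1))) => [|t It|t It|s _|s _] /=.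
- apply: (@continuous_if_le _ _ _ snd 2^-1 (fun p => H (p.1, 2 * p.2)) (fun p => K (p.1, 2 * p.2 - 1))); [by cont|by cont|by cont|].
  by move=> u ->; rewrite divff// subrr H1 K0.
- by rewrite invr_ge0 ler0n mulr0 H0 clamp_id.
- by rewrite ifF; [rewrite E211 K1 clamp_id|lra].
- by rewrite Hl Kl h0; case: ifP.
- by rewrite Hr Kr h1; case: ifP.
Qed.

(* All groupoid laws below reduce to straight-line homotopies in a parameter space. *)
Lemma homotopic_line (F : R * R -> T) (c d : R -> R * R) :
  continuous F -> continuous c -> continuous d -> c 0 = d 0 -> c 1 = d 1 ->
  homotopic (F \o c) (F \o d).
Proof.
move=> Fc cc dc e0 e1.
pose m (p : R * R) : R * R := ((1 - p.2) * (c p.1).1 + p.2 * (d p.1).1,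
  (1 - p.2) * (c p.1).2 + p.2 * (d p.1).2).
apply: (homotopicI (H := fun p => F (m p))) => [|t It|t It|s _|s _] /=.
- by rewrite /m; cont.
- by rewrite /m /= !(subr0, mul1r, mul0r, addr0) -surjective_pairing.
- by rewrite /m /= !(subrr, mul1r, mul0r, add0r) -surjective_pairing.
- by rewrite /m /= -e0 -!mulrDl !subrK !mul1r -surjective_pairing.
- by rewrite /m /= -e1 -!mulrDl !subrK !mul1r -surjective_pairing.
Qed.

Lemma homotopic_reparam f c d :
  continuous f -> continuous c -> continuous d -> c 0 = d 0 -> c 1 = d 1 ->
  homotopic (f \o c) (f \o d).
Proof.
move=> fc cc dc e0 e1.
by apply: (homotopic_line (F := fun p => f p.1) (c := fun t => (c t, 0)) (d := fun t => (d t, 0)));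
 rewrite ?e0 ?e1 //; cont.
Qed.

Lemma continuous_concat g h : continuous g -> continuous h -> g 1 = h 0 ->
  continuous (concat g h).
Proof.
move=> gc hc e; apply: (@continuous_if_le _ _ _ id 2^-1 (fun t => g (2 * t)) (fun t => h (2 * t - 1))); [by cont|by cont|by cont|].
by move=> u ->; rewrite divff// subrr.
Qed.

Lemma concat0 g h : concat g h 0 = g 0.
Proof. by rewrite /concat invr_ge0 ler0n mulr0. Qed.

Lemma concat1 g h : concat g h 1 = h 1.
Proof. by rewrite /concat ifF; [rewrite E211|lra]. Qed.

Lemma rev_path0 g : revp g 0 = g 1.
Proof. by rewrite /Defs.rev_path subr0. Qed.

Lemma rev_path1 g : revp g 1 = g 0.
Proof. by rewrite /Defs.rev_path subrr. Qed.

Lemma rev_pathK g : revp (revp g) = g.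
Proof. by apply/funext => t; rewrite /Defs.rev_path subKr. Qed.

Lemma continuous_rev g : continuous g -> continuous (revp g).
Proof. by move=> gc; rewrite /Defs.rev_path; cont. Qed.

Lemma homotopic_concat g g' h h' : g 1 = h 0 ->
  homotopic g g' -> homotopic h h' -> homotopic (concat g h) (concat g' h').
Proof.
move=> e gg hh.
have [H [Hc H0 H1 Hl Hr]] := homotopicE gg.
have [K [Kc K0 K1 Kl Kr]] := homotopicE hh.
apply: (homotopicI (H := fun p => if p.1 <= 2^-1 then H (2 * p.1, p.2) else K (2 * p.1 - 1, p.2))) => [|t|t|s _|s _] /=.
- apply: (@continuous_if_le _ _ _ fst 2^-1 (fun p => H (2 * p.1, p.2)) (fun p => K (2 * p.1 - 1, p.2))); [by cont|by cont|by cont|].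
  by move=> u ->; rewrite divff// subrr Hr Kl.
- move=> /I01P[t0 t1]; rewrite H0 K0 /concat; case: ifP => t2; rewrite clamp_id//; apply/I01P; lra.
- move=> /I01P[t0 t1]; rewrite H1 K1 /concat; case: ifP => t2; rewrite clamp_id//; apply/I01P; lra.
- by rewrite invr_ge0 ler0n mulr0 Hl concat0.
- by rewrite ifF; [rewrite E211 Kr concat1|lra].
Qed.

Lemma comp_concat (U : topologicalType) (F : U -> T) (c d : R -> U) :
  F \o concat c d = concat (F \o c) (F \o d).
Proof. by apply/funext => t; rewrite /= /concat; case: ifP. Qed.

End Homotopy.

Section HomotopyGroupoid.
Variables (R : realType) (T : topologicalType).
Implicit Types (f g h k : R -> T) (H : R * R -> T) (c d : R -> R).

Lemma homotopic_concatA f g h :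
  continuous f -> continuous g -> continuous h -> f 1 = g 0 -> g 1 = h 0 ->
  homotopic (concat (concat f g) h) (concat f (concat g h)).
Proof.
move=> fc gc hc fg gh.
(* [F] runs through the three paths on [0, 3]; both bracketings are [F] composed with a parameter
   path from 0 to 3. *)
pose F t := if t <= 1 then f t else (if t <= 2 then g (t - 1) else h (t - 2)).
have Fc : continuous F.
  apply: (@continuous_if_le _ _ _ id 1 f); [by cont|by cont| |].
    apply: (@continuous_if_le _ _ _ id 2 (fun t => g (t - 1)) (fun t => h (t - 2))); [by cont|by cont|by cont|].
    by move=> u ->; rewrite subrr -gh; congr g; lra.
  by move=> u ->; rewrite ifT ?subrr //; lra.
pose a (n : R) := fun t : R => n + t.
have ac n : continuous (a n) by rewrite /a; cont.
have e1 : concat (concat f g) h = F \o concat (concat (a 0) (a 1)) (a 2).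
  apply/funext => t; rewrite /concat /F /a /=.
  have [t2|t2] := leP t 2^-1; [have [t4|t4] := leP (2 * t) 2^-1|].
  - by rewrite ifT ?add0r //; lra.
  - by rewrite ifF ?ifT; [congr g; ring|lra|lra].
  - by rewrite ifF ?ifF; [congr h; ring|lra|lra].
have e2 : concat f (concat g h) = F \o concat (a 0) (concat (a 1) (a 2)).
  apply/funext => t; rewrite /concat /F /a /=.
  have [t2|t2] := leP t 2^-1; [|have [t4|t4] := leP (2 * t - 1) 2^-1].
  - by rewrite ifT ?add0r //; lra.
  - by rewrite ifF ?ifT; [congr g; ring|lra|lra].
  - by rewrite ifF ?ifF; [congr h; ring|lra|lra].
rewrite e1 e2; apply: homotopic_reparam => //.
- by apply: continuous_concat; rewrite ?concat1; [apply: continuous_concat; rewrite // /a; ring|exact: ac|rewrite /a; ring].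
- by apply: continuous_concat; rewrite ?concat0; [exact: ac|apply: continuous_concat; rewrite // /a; ring|rewrite /a; ring].
- by rewrite !concat0.
- by rewrite !concat1.
Qed.

Lemma homotopic_concat_cst g : continuous g -> homotopic (concat g (fun=> g 1)) g.
Proof.
move=> gc; have := @homotopic_reparam R T g (concat id (fun=> 1)) id gc; rewrite comp_concat; apply.
- by apply: continuous_concat => //; cont.
- by cont.
- by rewrite concat0.
- by rewrite concat1.
Qed.

Lemma homotopic_cst_concat g : continuous g -> homotopic (concat (fun=> g 0) g) g.
Proof.
move=> gc; have := @homotopic_reparam R T g (concat (fun=> 0) id) id gc; rewrite comp_concat; apply.
- by apply: continuous_concat => //; cont.
- by cont.
- by rewrite concat0.
- by rewrite concat1.
Qed.

Lemma homotopic_concat_rev g : continuous g -> homotopic (concat g (revp g)) (fun=> g 0).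
Proof.
move=> gc; have := @homotopic_reparam R T g (concat id (fun t => 1 - t)) (fun=> 0) gc; rewrite comp_concat; apply.
- by apply: continuous_concat => //; [by cont|by cont|rewrite subr0].
- by cont.
- by rewrite concat0.
- by rewrite concat1 subrr.
Qed.

Lemma homotopic_rev_concat g : continuous g -> homotopic (concat (revp g) g) (fun=> g 1).
Proof.
move=> gc; have := homotopic_concat_rev (continuous_rev gc).
by rewrite rev_pathK rev_path0.
Qed.

Lemma homotopic_clamp g : {within @I01 R, continuous g} -> homotopic (g \o @clamp R) g.
Proof.
move=> gc; apply: homotopic_ext => [|t It /=]; last by rewrite clamp_id.
by apply: continuous_within_comp gc (@continuous_clamp R) (@clampI R).
Qed.

End HomotopyGroupoid.

(** * Lengths of curves *)

Section CurveLength.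
Variables (R : realType) (X : metricType R).
Implicit Types (g h : R -> X) (t : nat -> R).

Definition subdivision n t :=
  [/\ t 0%N = 0, t n = 1 & forall i, (i < n)%N -> t i <= t i.+1].

Definition polygon g n t : R := \sum_(i < n) mdist (g (t i)) (g (t i.+1)).

Lemma curve_lengthP g (l : R) : (curve_length g <= l%:E)%E <->
  forall n t, subdivision n t -> polygon g n t <= l.
Proof.
split=> [gl n t [t0 tn tm]|H].
  rewrite -lee_fin; apply: le_trans gl; apply: ereal_sup_ubound.
  by exists n, t; do !split.
apply: ge_ereal_sup => _ [n [t [t0 [tn [tm ->]]]]].
by rewrite lee_fin; apply: H.
Qed.

Lemma subdivision_I01 n t i : subdivision n t -> (i <= n)%N -> I01 (t i).
Proof.
move=> [t0 tn tm] ile.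
have mono j k : (j + k <= n)%N -> t j <= t (j + k)%N.
  elim: k => [|k IH] jk; first by rewrite addn0.
  rewrite addnS; apply: (le_trans (IH _)); first lia.
  by apply: tm; lia.
apply/I01P; split.
  by rewrite -t0; have := mono 0%N i; rewrite add0n; exact.
by rewrite -tn; have := mono i (n - i)%N; rewrite subnKC //; exact.
Qed.

Lemma polygon_ext g h n t : subdivision n t -> (forall s, I01 s -> g s = h s) ->
  polygon g n t = polygon h n t.
Proof.
move=> tp gh; apply: eq_bigr => i _.
by rewrite !gh //; apply: (subdivision_I01 tp); first [exact: ltn_ord|exact: ltnW].
Qed.

Lemma curve_length_ext g h : (forall s, I01 s -> g s = h s) ->
  curve_length g = curve_length h.
Proof.
move=> gh; congr ereal_sup; apply/seteqP; split=> _ [n [t [t0 [tn [tm ->]]]]];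
  exists n, t; do !split => //; congr (_%:E).
  by rewrite -/(polygon g n t) (@polygon_ext g h).
by rewrite -/(polygon h n t) (@polygon_ext h g) // => s Is; rewrite gh.
Qed.

Lemma curve_length_cst (x : X) : (curve_length (fun=> x) <= 0%:E)%E.
Proof.
by apply/curve_lengthP => n t _; rewrite /polygon big1 // => i _; rewrite mdistxx.
Qed.

Lemma curve_length_dist g (l s : R) : (curve_length g <= l%:E)%E -> I01 s ->
  mdist (g 0) (g s) <= l.
Proof.
move=> /curve_lengthP gl /I01P[s0 s1].
pose t (i : nat) : R := if i == 0%N then 0 else if i == 1%N then s else 1.
have tp : subdivision 2 t by split => // -[|[|i]] //=.
apply: le_trans (gl _ _ tp); rewrite /polygon !big_ord_recl big_ord0 /= addr0.
by rewrite /t /= lerDl mdist_ge0.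
Qed.

Lemma curve_length_concat g h (l m : R) : g 1 = h 0 ->
  (curve_length g <= l%:E)%E -> (curve_length h <= m%:E)%E ->
  (curve_length (concat g h) <= (l + m)%:E)%E.
Proof.
move=> gh /curve_lengthP gl /curve_lengthP hm; apply/curve_lengthP => n t tp.
have [t0 tn tm] := tp.
(* A subdivision for the concatenation is truncated to each half. Intervals lying in the other half
   become degenerate, and the one straddling 1/2 is cut there by the triangle inequality. *)
pose u i := Num.min (2 * t i) 1; pose v i := Num.max (2 * t i - 1) 0.
have up : subdivision n u.
  split; rewrite /u ?t0 ?tn.
  - by rewrite mulr0 min_l.
  - by rewrite min_r //; lra.
  - move=> i /tm le; rewrite le_min !ge_min lexx orbT andbT.
    by apply/orP; left; lra.
have vp : subdivision n v.
  split; rewrite /v ?t0 ?tn.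
  - by rewrite max_r //; lra.
  - by rewrite max_l; lra.
  - move=> i /tm le; rewrite ge_max !le_max lexx orbT andbT.
    by apply/orP; left; lra.
apply: le_trans (lerD (gl _ _ up) (hm _ _ vp)).
rewrite /polygon -big_split /=; apply: ler_sum => -[i /= ilt] _.
have le := tm _ ilt; rewrite /concat /u /v.
have [a|a] := leP (t i) 2^-1; have [b|b] := leP (t i.+1) 2^-1.
- rewrite (min_l (x := 2 * t i)); last lra.
  rewrite (min_l (x := 2 * t i.+1)); last lra.
  by rewrite lerDl mdist_ge0.
- rewrite (min_l (x := 2 * t i)); last lra.
  rewrite (min_r (x := 2 * t i.+1)); last lra.
  rewrite (max_r (x := 2 * t i - 1)); last lra.
  rewrite (max_l (x := 2 * t i.+1 - 1)); last lra.
  by rewrite gh; exact: metric_triangle.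
- lra.
- rewrite (max_l (x := 2 * t i - 1)); last lra.
  rewrite (max_l (x := 2 * t i.+1 - 1)); last lra.
  by rewrite lerDr mdist_ge0.
Qed.

Lemma curve_length_rev g (l : R) : (curve_length g <= l%:E)%E ->
  (curve_length (revp g) <= l%:E)%E.
Proof.
move=> /curve_lengthP gl; apply/curve_lengthP => n t [t0 tn tm].
pose u i := 1 - t (n - i)%N.
have up : subdivision n u.
  split; rewrite /u ?subn0 ?subnn ?t0 ?tn ?subrr ?subr0 // => i ilt.
  have := tm (n - i.+1)%N; rewrite -subSn // subSS => /(_ _) h.
  by rewrite lerB // h //; lia.
apply: le_trans (gl _ _ up); rewrite /polygon [leRHS](reindex_inj rev_ord_inj) /=.
apply: ler_sum => -[i /= ilt] _; rewrite /Defs.rev_path /u metric_sym.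
have -> : (n - (n - i.+1))%N = i.+1 by lia.
have -> : (n - (n - i.+1).+1)%N = i by lia.
by [].
Qed.

(** Subdivisions of the two pieces merge into one of the whole curve, so any two polygon sums add up
    to at most [l]. Take for [l1] the supremum over the first piece; then [l - l1] bounds the
    second. *)
Lemma curve_length_split g (l a : R) : I01 a -> (curve_length g <= l%:E)%E ->
  exists l1 l2, [/\ l1 + l2 <= l,
   (curve_length (fun s => g (a * s)%R) <= l1%:E)%E &
   (curve_length (fun s => g (a + (1 - a) * s)%R) <= l2%:E)%E].
Proof.
move=> /I01P[a0 a1] /curve_lengthP gl.
set g1 := (fun s => g (a * s)); set g2 := (fun s => g (a + (1 - a) * s)).
have key n t m u : subdivision n t -> subdivision m u ->
    polygon g1 n t + polygon g2 m u <= l.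
  move=> [t0 tn tm] [u0 um umn].
  pose w i := if (i < n)%N then a * t i else a + (1 - a) * u (i - n)%N.
  have wn : w n = a * t n by rewrite /w ltnn subnn u0 mulr0 addr0 tn mulr1.
  have wp : subdivision (n + m) w.
    split.
    - by rewrite /w; case: (posnP n) tn => [->|n0] tn; [rewrite subnn u0; move: t0; rewrite tn => /eqP; rewrite oner_eq0|rewrite t0 mulr0].
    - by rewrite /w ltnNge leq_addr /= addKn um; lra.
    - move=> i ilt; have [lt|ge] := ltnP i n.
        have -> : w i = a * t i by rewrite /w lt.
        have -> : w i.+1 = a * t i.+1.
          by move: lt; rewrite leq_eqVlt => /orP[/eqP ->|lt]; [|rewrite /w lt].
        by apply: ler_wpM2l => //; apply: tm.
      rewrite /w !ltnNge ge (leqW ge) /= subSn //.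
      rewrite lerD2l; apply: ler_wpM2l; first lra.
      by apply: umn; lia.
  apply: le_trans (gl _ _ wp); rewrite /polygon big_split_ord /=.
  apply: lerD; apply: ler_sum => -[i /= ilt] _.
    have -> : w i = a * t i by rewrite /w ilt.
    suff -> : w i.+1 = a * t i.+1 by [].
    by move: ilt; rewrite leq_eqVlt => /orP[/eqP ->|lt]; [|rewrite /w lt].
  by rewrite /w !ltnNge -addnS !leq_addr /= !addKn.
pose S1 := [set z | exists n t, subdivision n t /\ z = polygon g1 n t].
pose triv (i : nat) : R := if i == 0%N then 0 else 1.
have trivp : subdivision 1 triv by split => // -[|i] //=; rewrite /triv /= ler01.
have S1n : S1 !=set0 by exists (polygon g1 1 triv), 1%N, triv.
have S1b : has_sup S1.
  split=> //; exists (l - polygon g2 1 triv) => _ [n [t [tp ->]]].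
  by rewrite lerBrDr; exact: key.
exists (sup S1), (l - sup S1); split; first by rewrite addrC subrK.
  apply/curve_lengthP => n t tp; apply: ub_le_sup; first exact: (proj2 S1b).
  by exists n, t.
apply/curve_lengthP => n t tp; rewrite lerBrDr -lerBrDl.
apply: ge_sup => // _ [n' [t' [tp' ->]]].
by rewrite lerBrDr; exact: key.
Qed.

End CurveLength.

(** * Segments in the plane of parameters *)

Section Segments.
Variables (R : realType).

Definition segm (a b : R * R) (s : R) : R * R :=
  (a.1 + s * (b.1 - a.1), a.2 + s * (b.2 - a.2)).

Lemma segm0 a b : segm a b 0 = a.
Proof. by rewrite /segm !mul0r !addr0 -surjective_pairing. Qed.

Lemma segm1 a b : segm a b 1 = b.
Proof. by rewrite /segm !mul1r ![_ + (_ - _)]addrC !subrK -surjective_pairing. Qed.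

Lemma continuous_segm a b : continuous (segm a b).
Proof. by rewrite /segm; cont. Qed.

Lemma homotopic_segm (T : topologicalType) (F : R * R -> T) a b c :
  continuous F ->
  homotopic (concat (F \o segm a b) (F \o segm b c)) (F \o segm a c).
Proof.
move=> Fc; rewrite -comp_concat; apply: homotopic_line => //.
- by apply: continuous_concat; rewrite ?segm0 ?segm1 //; exact: continuous_segm.
- exact: continuous_segm.
- by rewrite concat0 !segm0.
- by rewrite concat1 !segm1.
Qed.

(** Sup-norm balls are convex. This turns continuity at one point into control along whole segments,
    which is what extending a lift requires. *)
Lemma segm_near (a : R * R) (W : set (R * R)) : nbhs a W ->
  \forall b \near a, forall s, I01 s -> W (segm a b s).
Proof.
move=> /nbhs_ballP[e /= e0 eW]; apply/nbhs_ballP; exists e => //= b [b1 b2] s /I01P[s0 s1].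
apply: eW; split; rewrite /segm /ball /= in b1 b2 *.
  rewrite opprD addrA subrr add0r normrN normrM (ger0_norm s0) distrC.
  by apply: le_lt_trans b1; rewrite -[leRHS]mul1r; apply: ler_wpM2r.
rewrite opprD addrA subrr add0r normrN normrM (ger0_norm s0) distrC.
by apply: le_lt_trans b2; rewrite -[leRHS]mul1r; apply: ler_wpM2r.
Qed.

End Segments.

Section Cancel.
Variables (R : realType) (T : topologicalType).
Implicit Types (g h k : R -> T).

Lemma homotopic_of_loop h k : continuous h -> continuous k -> h 1 = k 1 ->
  homotopic (concat h (revp k)) (fun=> h 0) -> h 0 = k 0 -> homotopic h k.
Proof.
move=> hc kc e1 hk e0; have rc := continuous_rev kc.
apply: homotopic_trans (homotopic_sym (homotopic_concat_cst hc)) _.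
apply: (@homotopic_trans _ _ _ (concat h (concat (revp k) k))).
  apply: homotopic_concat => //; first exact: homotopic_refl.
  by rewrite e1; apply: homotopic_sym; exact: homotopic_rev_concat.
apply: (@homotopic_trans _ _ _ (concat (concat h (revp k)) k)).
  by apply: homotopic_sym; apply: homotopic_concatA => //; rewrite ?rev_path0 ?rev_path1.
apply: (@homotopic_trans _ _ _ (concat (fun=> h 0) k)).
  apply: homotopic_concat => //; last exact: homotopic_refl.
  by rewrite concat1 rev_path1.
by rewrite e0; exact: homotopic_cst_concat.
Qed.

Lemma homotopic_cancel g h k : continuous g -> continuous h -> continuous k ->
  g 1 = h 0 -> g 1 = k 0 ->
  homotopic (concat g h) (concat g k) -> homotopic h k.
Proof.
move=> gc hc kc gh gk H; have rc := continuous_rev gc.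
have key m : continuous m -> g 1 = m 0 -> homotopic (concat (revp g) (concat g m)) m.
  move=> mc gm.
  apply: (@homotopic_trans _ _ _ (concat (concat (revp g) g) m)).
    by apply: homotopic_sym; apply: homotopic_concatA => //; rewrite ?rev_path1.
  apply: (@homotopic_trans _ _ _ (concat (fun=> g 1) m)).
    apply: homotopic_concat; first by rewrite concat1.
      exact: homotopic_rev_concat.
    exact: homotopic_refl.
  by rewrite gm; exact: homotopic_cst_concat.
apply: homotopic_trans (homotopic_sym (key _ hc gh)) _.
apply: homotopic_trans _ (key _ kc gk).
apply: homotopic_concat => //; first by rewrite rev_path1 concat0.
exact: homotopic_refl.
Qed.

End Cancel.

(** * Short paths and small balls in the base space *)

Section LocalPaths.
Variables (R : realType) (X : metricType R).

Lemma mdist_continuous_near (T : topologicalType) (g : T -> X) (t : T) (e : R) :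
  continuous g -> 0 < e -> \forall u \near t, mdist (g t) (g u) < e.
Proof.
move=> gc e0; have := gc t; move=> /(@metricType_numDomainType.cvgrPdist_lt _ X).
exact.
Qed.

Lemma continuous_mdistP (T : topologicalType) (g : T -> X) :
  (forall t e, 0 < e -> \forall u \near t, mdist (g t) (g u) < e) -> continuous g.
Proof.
move=> H t; apply/(@metricType_numDomainType.cvgrPdist_lt _ X) => e e0; exact: H.
Qed.

Lemma nbhs_mdist (x : X) (e : R) : 0 < e -> nbhs x [set y | mdist x y < e].
Proof.
move=> e0; have := nbhsx_ballx x e e0.
by rewrite ballEmdist.
Qed.

Lemma nbhs_mdistE (x : X) (W : set X) : nbhs x W ->
  exists2 e : R, 0 < e & forall y, mdist x y < e -> W y.
Proof.
move=> /nbhs_ballP[e /= e0 eW]; exists e => // y xy; apply: eW.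
by rewrite ballEmdist.
Qed.

(** A Lebesgue number argument: by compactness one radius works for simply connected sets around all
    points. Two paths in such a set with the same ends form a loop that contracts there; the
    homotopy is allowed to leave the ball. *)
Lemma uniformly_simply_connected : compact [set: X] ->
  locally_simply_connected R X ->
  exists2 r : R, 0 < r & forall (x : X) (h k : R -> X),
    continuous h -> continuous k -> h 0 = k 0 -> h 1 = k 1 ->
    (forall t, I01 t -> mdist x (h t) < r) ->
    (forall t, I01 t -> mdist x (k t) < r) -> homotopic h k.
Proof.
move=> cX sX.
pose P (r : R) (x : X) := exists V : set X, simply_connected R V /\
  forall y, mdist x y < r -> V y.
have /compact_near_coveringP/(_ R (0^'+) P) : compact [set: X] by [].
case.
- move=> x _; have [V [oV [Vx [_ sV]]]] := sX x setT filterT.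
  have [e e0 eV] := nbhs_mdistE (open_nbhs_nbhs (conj oV Vx)).
  exists ([set y | mdist x y < e / 2], [set r | r < e / 2]).
    split => /=; first by apply: nbhs_mdist; rewrite divr_gt0.
    by apply: nbhs_right_lt; rewrite divr_gt0.
  move=> [y r] /= [xy re]; exists V; split => // z yz; apply: eV.
  by apply: le_lt_trans (metric_triangle x y z) _; lra.
- move=> e /= e0 eP.
  have H : [set: X] `<=` P (e / 2).
    apply: eP; last by rewrite /= divr_gt0.
    by rewrite /ball_ /= sub0r normrN gtr0_norm ?divr_gt0 //; lra.
  exists (e / 2); first lra.
  move=> x h k hc kc e0' e1 hx kx.
  have [V [[_ sV] eV]] := H x I.
  pose m := concat h (revp k).
  have mc : continuous m by apply: continuous_concat; rewrite ?rev_path0 //; exact: continuous_rev.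
  have I0 : I01 (0 : R) by apply/I01P.
  have mV : homotopic m (fun=> h 0).
    have Vh0 : V (h 0) by apply: eV; exact: hx.
    have pm : path_in V m (h 0) (h 0).
      split; first exact: continuous_subspaceT.
      rewrite /m concat0 concat1 rev_path1; do !split => //.
      move=> _ [t /I01P[t0 t1] <-]; apply: eV; rewrite /concat /Defs.rev_path.
      by case: ifP => t2; [apply: hx|apply: kx]; apply/I01P; lra.
    have [K [Kc [K1 [K2 _]]]] := sV _ _ Vh0 pm.
    by exists K; split=> [|]; [exact: Kc|split=> [|]; [exact: K1|split=> [|]; [exact: K2|]]].
  by apply: homotopic_of_loop.
Qed.

Lemma length_space_short_path (x y : X) (e : R) : length_space X -> mdist x y < e ->
  exists (h : R -> X) (l : R), [/\ continuous h, h 0 = x, h 1 = y, l < e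
    & (curve_length h <= l%:E)%E].
Proof.
move=> lX xy; have : (ereal_inf [set curve_length g | g in [set g | is_path g x y]] < e%:E)%E.
  by rewrite -lX lte_fin.
move=> /ereal_inf_lt[_ [g [gc [g0 [g1 _]]] <-] ge].
have gE : curve_length (g \o @clamp R) = curve_length g.
  by apply: curve_length_ext => s Is /=; rewrite clamp_id.
have [l le gl] : exists2 l, l < e & (curve_length g <= l%:E)%E.
  case: (curve_length g) ge => [r| |].
  - by rewrite lte_fin => re; exists r.
  - by rewrite ltNge leey.
  - by move=> _; exists (e - 1); rewrite ?leNye //; lra.
exists (g \o @clamp R), l; split => //=.
- exact: continuous_within_comp gc (@continuous_clamp R) (@clampI R).
- by rewrite clamp0.
- by rewrite clamp1.
- by rewrite gE.
Qed.

End LocalPaths.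

(** * The universal cover *)

Section PathClasses.
Variables (R : realType) (X : metricType R) (x0 : X).

(** A homotopy class is encoded as the predicate of being homotopic to a path from [x0], so
    homotopic paths give equal classes by extensionality. *)
Definition path_class := {A : set (R -> X) | exists g : R -> X,
  continuous g /\ g 0 = x0 /\ A = homotopic g}.
HB.instance Definition _ := gen_eqMixin path_class.
HB.instance Definition _ := gen_choiceMixin path_class.

Implicit Types (a b c : path_class) (g h k : R -> X).

Definition rep a : R -> X := projT1 (cid (proj2_sig a)).
Lemma continuous_rep a : continuous (rep a).
Proof. by rewrite /rep; case: cid => g []. Qed.
Lemma rep0 a : rep a 0 = x0.
Proof. by rewrite /rep; case: cid => g [? []]. Qed.
Lemma sval_rep a : sval a = homotopic (rep a).
Proof. by rewrite /rep; case: cid => g [? []]. Qed.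

Lemma path_class0_subproof : exists g : R -> X, continuous g /\ g 0 = x0 /\
  homotopic (T := X) (fun=> x0) = homotopic g.
Proof. by exists (fun=> x0); split => //; cont. Qed.

(** Functions that are not continuous or do not start at [x0] are sent to the class of the constant
    path, which makes [cls] total. *)
Definition cls g : path_class :=
  match pselect (continuous g /\ g 0 = x0) with
  | left p => exist _ (homotopic g) (ex_intro _ g (conj (proj1 p) (conj (proj2 p) erefl)))
  | right _ => exist _ _ path_class0_subproof
  end.

Lemma sval_cls g : continuous g -> g 0 = x0 -> sval (cls g) = homotopic g.
Proof. by move=> gc g0; rewrite /cls; case: pselect => // -[]. Qed.

Lemma path_class_inj a b : sval a = sval b -> a = b.
Proof. by case: a b => [A pA] [B pB] /= AB; apply: eq_exist. Qed.

Lemma homotopic_set g h : homotopic g h -> homotopic g = homotopic h.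
Proof.
move=> gh; apply/seteqP; split=> k; first exact: homotopic_trans (homotopic_sym gh).
exact: homotopic_trans.
Qed.

Lemma cls_hom g h : continuous g -> continuous h -> g 0 = x0 -> homotopic g h ->
  cls g = cls h.
Proof.
move=> gc hc g0 gh; have [h0 _] := homotopic_ends gh.
by apply: path_class_inj; rewrite !sval_cls ?h0 //; exact: homotopic_set.
Qed.

Lemma hom_cls g h : continuous g -> continuous h -> g 0 = x0 -> h 0 = x0 ->
  cls g = cls h -> homotopic g h.
Proof.
move=> gc hc g0 h0 /(congr1 sval); rewrite !sval_cls // => ->.
exact: homotopic_refl.
Qed.

Lemma rep_cls g : continuous g -> g 0 = x0 -> homotopic (rep (cls g)) g.
Proof.
move=> gc g0; have := sval_rep (cls g); rewrite sval_cls // => <-.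
exact: homotopic_refl.
Qed.

Lemma cls_rep a : cls (rep a) = a.
Proof.
by apply: path_class_inj; rewrite sval_cls ?sval_rep ?rep0 //; exact: continuous_rep.
Qed.

Definition endpt a : X := rep a 1.

Lemma endpt_cls g : continuous g -> g 0 = x0 -> endpt (cls g) = g 1.
Proof. by move=> gc g0; have [_ ->] := homotopic_ends (rep_cls gc g0). Qed.

(** Transport of [a] along a path of the base that starts at its end point; lifts of paths and
    homotopies are all expressed through it. *)
Definition ext a h : path_class := cls (concat (rep a) h).

Lemma continuous_rep_concat a h : continuous h -> h 0 = endpt a ->
  continuous (concat (rep a) h).
Proof. by move=> hc h0; apply: continuous_concat => //; exact: continuous_rep. Qed.

Lemma rep_concat0 a h : concat (rep a) h 0 = x0.
Proof. by rewrite concat0 rep0. Qed.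

Hint Resolve rep_concat0 continuous_rep rep0 : core.

Lemma endpt_ext a h : continuous h -> h 0 = endpt a -> endpt (ext a h) = h 1.
Proof. by move=> hc h0; rewrite endpt_cls ?concat1 //; exact: continuous_rep_concat. Qed.

Lemma rep_ext a h : continuous h -> h 0 = endpt a ->
  homotopic (rep (ext a h)) (concat (rep a) h).
Proof. by move=> hc h0; apply: rep_cls => //; exact: continuous_rep_concat. Qed.

Lemma ext_hom a h k : continuous h -> continuous k -> h 0 = endpt a ->
  homotopic h k -> ext a h = ext a k.
Proof.
move=> hc kc h0 hk; have [k0 _] := homotopic_ends hk.
apply: cls_hom => //; try by apply: continuous_rep_concat; rewrite // k0.
by apply: homotopic_concat => //; exact: homotopic_refl.
Qed.

Lemma ext_ext a h k : continuous h -> continuous k -> h 0 = endpt a -> h 1 = k 0 ->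
  ext (ext a h) k = ext a (concat h k).
Proof.
move=> hc kc h0 hk; have e := endpt_ext hc h0.
have hkc := continuous_concat hc kc hk.
apply: cls_hom => //.
- by apply: continuous_rep_concat; rewrite // e.
- by apply: continuous_rep_concat; rewrite // concat0.
apply: (@homotopic_trans _ _ _ (concat (concat (rep a) h) k)).
  apply: homotopic_concat; [by rewrite -hk -e|exact: rep_ext|exact: homotopic_refl].
by apply: homotopic_concatA.
Qed.

Lemma ext_cst a : ext a (fun=> endpt a) = a.
Proof.
rewrite -[RHS]cls_rep; apply: cls_hom => //.
- by apply: continuous_rep_concat => //; cont.
exact: homotopic_concat_cst.
Qed.

Lemma ext_loop a h : continuous h -> h 0 = endpt a ->
  homotopic h (fun=> endpt a) -> ext a h = a.
Proof.
by move=> hc h0 hh; rewrite (ext_hom hc _ h0 hh) ?ext_cst //; cont.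
Qed.

Lemma ext_inj a h k : continuous h -> continuous k -> h 0 = endpt a -> k 0 = endpt a ->
  ext a h = ext a k -> homotopic h k.
Proof.
move=> hc kc h0 k0 e; apply: (@homotopic_cancel _ _ (rep a)) => //.
by apply: hom_cls e => //; exact: continuous_rep_concat.
Qed.

Lemma ext_rev a h : continuous h -> h 0 = endpt a -> ext (ext a h) (revp h) = a.
Proof.
move=> hc h0; rewrite ext_ext ?rev_path0 //; last exact: continuous_rev.
apply: ext_loop; rewrite ?concat0 //.
  by apply: continuous_concat; rewrite ?rev_path0 //; exact: continuous_rev.
by rewrite -h0; exact: homotopic_concat_rev.
Qed.

Lemma ext_joins a b : exists h, [/\ continuous h, h 0 = endpt a, h 1 = endpt b & ext a h = b].
Proof.
have rc := continuous_rev (@continuous_rep a).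
have hc : continuous (concat (revp (rep a)) (rep b)).
  by apply: continuous_concat; rewrite // rev_path1 !rep0.
exists (concat (revp (rep a)) (rep b)); split; rewrite ?concat0 ?rev_path0 ?concat1 //.
rewrite -[RHS]cls_rep; apply: cls_hom => //.
  by apply: continuous_rep_concat; rewrite // concat0 rev_path0.
apply: (@homotopic_trans _ _ _ (concat (concat (rep a) (revp (rep a))) (rep b))).
  by apply: homotopic_sym; apply: homotopic_concatA; rewrite ?rev_path0 ?rev_path1 ?rep0.
apply: (@homotopic_trans _ _ _ (concat (fun=> rep a 0) (rep b))).
  apply: homotopic_concat; first by rewrite concat1 rev_path1 !rep0.
    exact: homotopic_concat_rev.
  exact: homotopic_refl.
rewrite rep0 -(rep0 b); exact: homotopic_cst_concat.
Qed.

End PathClasses.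

(** * Length metric on path classes *)

Section CoverMetric.
Variables (R : realType) (X : metricType R) (x0 : X).
Variable r0 : R.
Hypothesis r0_gt0 : 0 < r0.
Hypothesis r0P : forall (x : X) (h k : R -> X),
    continuous h -> continuous k -> h 0 = k 0 -> h 1 = k 1 ->
    (forall t, I01 t -> mdist x (h t) < r0) ->
    (forall t, I01 t -> mdist x (k t) < r0) -> homotopic h k.
Hypothesis lX : length_space X.

Local Notation Y := (path_class x0).
Implicit Types (a b c : Y) (g h k : R -> X).

(** A short piece of [h] may be replaced by a path of finite length inside the same ball of radius
    [r0], which is homotopic to it by [r0P]. Continuation along [0, 1] does the rest. This makes
    distances in the cover finite. *)
Lemma homotopic_rectifiable h : continuous h ->
  exists k l, [/\ continuous k, homotopic h k & (curve_length k <= l%:E)%E].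
Proof.
move=> hc; pose F (p : R * R) := h p.1.
have Fc : continuous F by rewrite /F; cont.
pose P t := exists k l, [/\ continuous k, homotopic (F \o segm (0, 0) (t, 0)) k
  & (curve_length k <= l%:E)%E].
have Fs (p q : R * R) : continuous (F \o segm p q).
  by have sc := @continuous_segm _ p q; rewrite /comp; cont.
have step t u : (forall s, I01 s -> mdist (h t) (F (segm (t, 0) (u, 0) s)) < r0) -> P t -> P u.
  move=> small [k [l [kc Hk kl]]].
  have e1 : F (segm (t, 0) (u, 0) 0) = h t by rewrite segm0.
  have e2 : F (segm (t, 0) (u, 0) 1) = h u by rewrite segm1.
  have [m [l' [mc m0 m1 ml' mL]]] : exists (m : R -> X) (l' : R), [/\ continuous m, m 0 = h t, m 1 = h u, l' < r0
    & (curve_length m <= l'%:E)%E].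
    apply: length_space_short_path => //; rewrite -e2; apply: small.
    by apply/I01P.
  have k1 : k 1 = h t.
    by have [_ ->] := homotopic_ends Hk; rewrite /= segm1.
  exists (concat k m), (l + l'); split.
  - by apply: continuous_concat; rewrite // k1.
  - apply: homotopic_trans (homotopic_sym (homotopic_segm (0, 0) (t, 0) (u, 0) Fc)) _.
    apply: homotopic_concat => //; first by rewrite /= segm0 segm1.
    apply: (@r0P (h t)) => //; rewrite ?m0 ?m1 /= ?segm0 ?segm1 //.
    by move=> s Is; rewrite -m0; apply: le_lt_trans (curve_length_dist mL Is) _.
  - by apply: curve_length_concat; rewrite // k1.
suff [k [l [kc Hk kl]]] : P 1.
  exists k, l; split => //; apply: homotopic_trans Hk.
  by apply: homotopic_ext => // s _; rewrite /= /F /segm /= subr0 mulr1 add0r.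
apply: clopen_real_ind.
  exists (fun=> h 0), 0; split; [by cont| |exact: curve_length_cst].
  by apply: homotopic_ext => // s _; rewrite /= /F /segm /= subr0 mulr0 addr0.
move=> t.
(* Continuation must work from [t] to [u] and back; with half the radius, the segment also stays in
   the ball of radius [r0] centred at [h u]. *)
have N : nbhs (t, 0 : R) [set q | mdist (h t) (F q) < r0 / 2].
  have := @mdist_continuous_near _ _ _ F (t, 0) (r0 / 2) Fc; rewrite /F /=; apply.
  by rewrite divr_gt0.
have N2 := segm_near N.
have pc : continuous (fun u : R => (u, 0 : R)) by cont.
have {}N2 : \forall u \near t, forall s, I01 s -> mdist (h t) (F (segm (t, 0) (u, 0) s)) < r0 / 2.
  exact: (pc t _ N2).
apply: filterS N2 => u small; split; apply: step => s Is.
  have flip : F (segm (u, 0) (t, 0) s) = F (segm (t, 0) (u, 0) (1 - s)).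
    by rewrite /F /segm /=; congr h; ring.
  have hu : mdist (h t) (h u) < r0 / 2.
    by have := small 1; rewrite segm1; apply; apply/I01P.
  rewrite flip; apply: le_lt_trans (metric_triangle _ (h t) _) _.
  rewrite metric_sym [ltRHS](splitr r0); apply: ltrD => //; apply: small.
  by move/I01P: Is => [s0 s1]; apply/I01P; lra.
by apply: (lt_trans (small s Is)); rewrite ltr_pdivrMr // ltr_pMr // ltr1n.
Qed.

Definition join_lengths a b : set R := [set l | exists h,
  [/\ continuous h, h 0 = endpt a, ext a h = b & (curve_length h <= l%:E)%E]].

Definition cdist a b : R := inf (join_lengths a b).

Lemma join_lengths_ge a b l : join_lengths a b l -> mdist (endpt a) (endpt b) <= l.
Proof.
move=> [h [hc h0 <- hl]]; rewrite endpt_ext // -h0; apply: curve_length_dist hl _.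
by apply/I01P.
Qed.

Lemma join_lengths_neq0 a b : join_lengths a b !=set0.
Proof.
have [h [hc h0 h1 <-]] := ext_joins a b.
have [k [l [kc hk kl]]] := homotopic_rectifiable hc.
have [k0 _] := homotopic_ends hk.
by exists l, k; split; rewrite ?k0 //; exact/esym/ext_hom.
Qed.

Lemma join_lengths_lb a b : has_lbound (join_lengths a b).
Proof. by exists (mdist (endpt a) (endpt b)) => l; exact: join_lengths_ge. Qed.

Lemma cdist_le a b l : join_lengths a b l -> cdist a b <= l.
Proof. by move=> H; apply: ge_inf H; exact: join_lengths_lb. Qed.

Lemma cdist_lt a b e : cdist a b < e -> exists2 l, join_lengths a b l & l < e.
Proof. by apply: inf_lt; exact: join_lengths_neq0. Qed.

Lemma endpt_cdist a b : mdist (endpt a) (endpt b) <= cdist a b.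
Proof.
by apply: lb_le_inf; [exact: join_lengths_neq0|move=> l; exact: join_lengths_ge].
Qed.

(** A nearly shortest path between the ends of [k] also stays in the ball of radius [r0], hence is
    homotopic to [k] and leads to the same class. *)
Lemma cdist_ball a k : continuous k -> k 0 = endpt a ->
  (forall t, I01 t -> mdist (endpt a) (k t) < r0) ->
  cdist a (ext a k) = mdist (endpt a) (k 1).
Proof.
move=> kc k0 small; apply/eqP; rewrite eq_le; apply/andP; split; last first.
  by rewrite -(endpt_ext kc k0); exact: endpt_cdist.
apply/ler_addgt0Pl => e e0.
have I1 : I01 (1 : R) by apply/I01P.
pose e' := Num.min (e + mdist (endpt a) (k 1)) r0.
have lt : mdist (endpt a) (k 1) < e' by rewrite lt_min ltrDr e0 small.
have [m [l [mc m0 m1 le ml]]] := length_space_short_path lX lt.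
apply: (@le_trans _ _ l); last by apply: ltW (lt_le_trans le _); rewrite ge_min lexx.
apply: cdist_le; exists m; split => //.
apply: ext_hom => //; apply: (@r0P (endpt a)); rewrite ?m0 ?m1 // => t It.
rewrite -m0; apply: le_lt_trans (curve_length_dist ml It) _.
by apply: (lt_le_trans le); rewrite ge_min lexx orbT.
Qed.

Lemma cdist_local_iso a b : cdist a b < r0 -> mdist (endpt a) (endpt b) = cdist a b.
Proof.
move=> /cdist_lt[l [h [hc h0 <- hl]] lr].
rewrite cdist_ball ?endpt_ext // => t It; rewrite -h0.
exact: le_lt_trans (curve_length_dist hl It) lr.
Qed.

Lemma cdistxx a : cdist a a = 0.
Proof.
rewrite -{2}(ext_cst a) cdist_ball ?mdistxx //; first by cont.
Qed.

(** The end points agree, and the classes differ by a loop shorter than [r0], which is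
    contractible. *)
Lemma cdist_positivity a b : cdist a b = 0 -> a = b.
Proof.
move=> ab; have : cdist a b < r0 by rewrite ab.
move=> /cdist_lt[l [h [hc h0 hb hl]] lr].
have e : endpt a = endpt b.
  by apply: mdist_positivity; rewrite cdist_local_iso ab.
rewrite -hb; apply/esym/ext_loop => //; apply: (@r0P (endpt a)) => //.
- by cont.
- by rewrite -(endpt_ext hc h0) hb.
- by move=> t It; rewrite -h0; exact: le_lt_trans (curve_length_dist hl It) lr.
- by move=> t It; rewrite mdistxx.
Qed.

Lemma cdist_sym_le a b : cdist a b <= cdist b a.
Proof.
apply: lb_le_inf; first exact: join_lengths_neq0.
move=> l [h [hc h0 <- hl]]; apply: cdist_le; exists (revp h); split.
- exact: continuous_rev.
- by rewrite rev_path0 endpt_ext.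
- exact: ext_rev.
- exact: curve_length_rev.
Qed.

Lemma cdist_sym a b : cdist a b = cdist b a.
Proof. by apply/eqP; rewrite eq_le !cdist_sym_le. Qed.

Lemma cdist_triangle b a c : cdist a c <= cdist a b + cdist b c.
Proof.
apply/ler_addgt0Pl => e e0.
have [l [h [hc h0 hb hl]] le] : exists2 l, join_lengths a b l & l < cdist a b + e / 2.
  by apply: cdist_lt; rewrite ltrDl divr_gt0.
have [m [k [kc k0 kb km]] me] : exists2 l, join_lengths b c l & l < cdist b c + e / 2.
  by apply: cdist_lt; rewrite ltrDl divr_gt0.
have h1 : h 1 = k 0 by rewrite k0 -hb endpt_ext.
apply: (@le_trans _ _ (l + m)); last lra.
apply: cdist_le; exists (concat h k); split.
- exact: continuous_concat.
- by rewrite concat0.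
- by rewrite -ext_ext // hb.
- exact: curve_length_concat.
Qed.

Definition univ_cover : metricType R := HB.pack Y
  (isMetric.Build R Y cdistxx cdist_positivity cdist_sym cdist_triangle).

End CoverMetric.

(** * Lifting, covering property and simple connectedness *)

Section CoverTopology.
Variables (R : realType) (X : metricType R) (x0 : X).
Variable r0 : R.
Hypothesis r0_gt0 : 0 < r0.
Hypothesis r0P : forall (x : X) (h k : R -> X),
    continuous h -> continuous k -> h 0 = k 0 -> h 1 = k 1 ->
    (forall t, I01 t -> mdist x (h t) < r0) ->
    (forall t, I01 t -> mdist x (k t) < r0) -> homotopic h k.
Hypothesis lX : length_space X.

Let Y : metricType R := univ_cover x0 r0_gt0 r0P lX.
Let p : Y -> X := @endpt R X x0.
Let Ext (a : Y) (h : R -> X) : Y := ext a h.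
Implicit Types (a b c : Y) (g h k : R -> X).

Lemma cover_le a b : mdist (p a) (p b) <= mdist a b.
Proof. exact: (endpt_cdist r0_gt0 r0P lX). Qed.

Lemma cover_local_iso a b : mdist a b < r0 -> mdist (p a) (p b) = mdist a b.
Proof. exact: (cdist_local_iso r0_gt0 r0P lX). Qed.

Lemma cover_ball a k : continuous k -> k 0 = p a ->
  (forall t, I01 t -> mdist (p a) (k t) < r0) ->
  mdist a (Ext a k) = mdist (p a) (k 1).
Proof. exact: (cdist_ball r0_gt0 r0P lX). Qed.

Lemma cover_lift_ball a x : mdist (p a) x < r0 ->
  exists b, p b = x /\ mdist a b = mdist (p a) x.
Proof.
move=> ax; have [h [l [hc h0 h1 lr hl]]] := length_space_short_path lX ax.
exists (Ext a h); split; first by rewrite /p endpt_ext.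
rewrite cover_ball ?h1 // => t It; rewrite -{1}h0.
exact: le_lt_trans (curve_length_dist hl It) lr.
Qed.

Lemma cover_inj a b : mdist a b < r0 -> p a = p b -> a = b.
Proof.
by move=> ab e; apply: mdist_positivity; rewrite -cover_local_iso // e mdistxx.
Qed.

Lemma continuous_cover : continuous p.
Proof.
apply: continuous_mdistP => a e e0; apply: filterS (nbhs_mdist a e0) => b /=.
exact: le_lt_trans (cover_le a b).
Qed.

(* Since squares are convex, extending along segments lifts paths and homotopies at once. *)
Definition lift (F : R * R -> X) (a : Y) (u : R * R) : Y := Ext a (F \o segm (0, 0) u).

Section Lift.
Variables (F : R * R -> X) (a : Y).
Hypotheses (Fc : continuous F) (F0 : F (0, 0) = p a).

Let Fs (u v : R * R) : continuous (F \o segm u v).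
Proof. by have sc := @continuous_segm _ u v; rewrite /comp; cont. Qed.

Lemma lift0 : lift F a (0, 0) = a.
Proof.
rewrite /lift /Ext.
have -> : F \o segm (0, 0) (0, 0) = fun=> p a.
  by apply/funext => s; rewrite /= /segm /= subr0 mulr0 addr0.
exact: ext_cst.
Qed.

Lemma liftK u : p (lift F a u) = F u.
Proof. by rewrite /p /lift endpt_ext /= ?segm0 ?segm1. Qed.

Lemma lift_ext u v : lift F a v = Ext (lift F a u) (F \o segm u v).
Proof.
rewrite /lift /Ext ext_ext /= ?segm0 ?segm1 //; apply: ext_hom => //=.
- by apply: continuous_concat; rewrite //= segm0 segm1.
- by rewrite segm0.
by apply: homotopic_sym; exact: homotopic_segm.
Qed.

Lemma continuous_lift : continuous (lift F a).
Proof.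
apply: continuous_mdistP => u e e0.
have e0' : 0 < Num.min e r0 by rewrite lt_min e0 r0_gt0.
have N : nbhs u [set q | mdist (F u) (F q) < Num.min e r0].
  exact: (@mdist_continuous_near _ _ _ F u _ Fc e0').
apply: filterS (segm_near N) => v small.
rewrite (lift_ext u v) cover_ball /= ?segm0 ?liftK ?segm1 //.
  have := small 1; rewrite /= segm1; move=> /(_ _); rewrite lt_min.
  by move=> H; have /andP[] : (mdist (F u) (F v) < e) && (mdist (F u) (F v) < r0) by apply: H; apply/I01P.
by move=> t It; apply: (lt_le_trans (small t It)); rewrite ge_min lexx orbT.
Qed.

End Lift.

(** Two points of one fibre closer than [r0] coincide, so agreement and disagreement of the lifts
    both persist for nearby parameters. *)
Lemma lift_unique (G1 G2 : R -> Y) : continuous G1 -> continuous G2 ->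
  (forall t, p (G1 t) = p (G2 t)) -> G1 0 = G2 0 -> G1 = G2.
Proof.
move=> c1 c2 e e0; apply/funext; apply: clopen_real_ind => // t.
have r2 : 0 < r0 / 2 by rewrite divr_gt0.
apply: filterS2 (mdist_continuous_near t c1 r2) (mdist_continuous_near t c2 r2) => u n1 n2.
split=> E; apply: cover_inj => //.
  apply: le_lt_trans (metric_triangle _ (G1 u) _) _.
  by rewrite {2}E [ltRHS](splitr r0) (metric_sym (G2 u)); apply: ltrD.
apply: le_lt_trans (metric_triangle _ (G1 t) _) _.
by rewrite {2}E [ltRHS](splitr r0) metric_sym; apply: ltrD.
Qed.

Lemma path_lift g a : continuous g -> g 0 = p a -> exists G : R -> Y,
  [/\ continuous G, G 0 = a, forall t, p (G t) = g t & G 1 = Ext a g].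
Proof.
move=> gc g0; pose F (u : R * R) := g u.1.
have Fc : continuous F by rewrite /F; cont.
exists (fun t => lift F a (t, 0)); split.
- have lc := continuous_lift Fc g0.
  have pc : continuous (fun t : R => (t, 0 : R)) by cont.
  by move=> t; apply: continuous_comp; [exact: pc|exact: lc].
- exact: lift0.
- by move=> t; rewrite liftK.
- rewrite /lift; congr Ext; apply/funext => s.
  by rewrite /= /F /segm /= subr0 mulr1 add0r.
Qed.

Lemma path_Ext (G : R -> Y) : continuous G -> G 1 = Ext (G 0) (p \o G).
Proof.
move=> Gc; have gc : continuous (p \o G).
  by move=> t; apply: continuous_comp; [exact: Gc|exact: continuous_cover].
have [G' [G'c G0 pG <-]] := path_lift gc (erefl : (p \o G) 0 = p (G 0)).
by rewrite (lift_unique Gc G'c).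
Qed.

(** Both sides are infima over the same curves: a path of the base that carries [a] to [b] lifts,
    and a path upstairs projects to such a path by [path_Ext]. *)
Lemma lifted_dist_cover a b : lifted_dist p a b = (mdist a b)%:E.
Proof.
apply/eqP; rewrite eq_le; apply/andP; split.
  apply/lee_addgt0Pr => e e0.
  have lt : mdist a b < mdist a b + e by rewrite ltrDl.
  have [l [h [hc h0 hb hl]] le] := cdist_lt r0_gt0 r0P lX lt.
  have [G [Gc G0 pG G1]] := path_lift hc h0.
  apply: (@le_trans _ _ (l%:E)); last by rewrite -EFinD lee_fin ltW.
  apply: le_trans hl; apply: ereal_inf_lbound => /=; exists G.
    split; first exact: continuous_subspaceT.
    by rewrite G1 /Ext hb.
  by congr curve_length; apply/funext => t /=.
apply/ereal_infP => _ [G [Gc [G0 [G1 _]]] <-].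
have Gc' : continuous (G \o @clamp R).
  exact: continuous_within_comp Gc (@continuous_clamp R) (@clampI R).
have pGc : continuous (p \o (G \o @clamp R)).
  by move=> t; apply: continuous_comp; [exact: Gc'|exact: continuous_cover].
have -> : curve_length (p \o G) = curve_length (p \o (G \o @clamp R)).
  by apply: curve_length_ext => s Is /=; rewrite clamp_id.
have J l : (curve_length (p \o (G \o @clamp R)) <= l%:E)%E -> mdist a b <= l.
  move=> cl; apply: cdist_le; exists (p \o (G \o @clamp R)); split => //.
    by rewrite /= clamp0 G0.
  by have := path_Ext Gc'; rewrite /= clamp0 clamp1 G0 G1.
case: (curve_length _) J => [l| |] J.
- by rewrite lee_fin; apply: J.
- exact: leey.
(* A length of [-oo] would make the distance at most one less than itself. *)
- by have := J (mdist a b - 1 : R); rewrite leNye => /(_ isT); rewrite leNgt ltrBlDr ltrDl ltr01.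
Qed.

Lemma continuous_mdist (T : topologicalType) (Z : metricType R) (z : Z) (G : T -> Z) :
  continuous G -> continuous (fun t => mdist z (G t)).
Proof.
move=> Gc t; apply/(@cvgrPdist_lt _ R^o) => e e0.
apply: filterS (mdist_continuous_near t Gc e0) => u tu.
apply: le_lt_trans tu; rewrite ler_norml; apply/andP; split.
  by have := metric_triangle z (G t) (G u); lra.
by have := metric_triangle z (G u) (G t); rewrite (metric_sym (G u)); lra.
Qed.

(** The intermediate value theorem finds a point at distance [s] on the lift of a nearly shortest
    path; splitting the length there bounds what remains. The error [e] disappears once closed balls
    are known to be compact. *)
Lemma cover_between a b s e : 0 <= s <= mdist a b -> 0 < e ->
  exists c, mdist a c = s /\ mdist c b <= mdist a b - s + e.
Proof.
move=> sab e0.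
have lt : mdist a b < mdist a b + e by rewrite ltrDl.
have [l [h [hc h0 hb hl]] le] := cdist_lt r0_gt0 r0P lX lt.
have [G [Gc G0 pG G1]] := path_lift hc h0.
have {}G1 : G 1 = b by rewrite G1.
have [t] : exists2 t, t \in `[0, 1]%R & mdist a (G t) = s.
  apply: IVT => //.
    by apply: continuous_subspaceT; exact: continuous_mdist.
  by rewrite G0 G1 mdistxx min_l ?max_r ?mdist_ge0.
rewrite in_itv /= => /andP[t0 t1] ts.
have [l1 [l2 [l12 hl1 hl2]]] := curve_length_split (proj2 (I01P t) (conj t0 t1)) hl.
exists (G t); split=> //.
have c1 : continuous (fun s : R => G (t * s)).
  by move=> u; apply: (@continuous_comp _ _ _ (fun s : R => t * s) G); [exact: mulrl_continuous|exact: Gc].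
have c2 : continuous (fun s : R => G (t + (1 - t) * s)).
  have cc : continuous (fun s : R => t + (1 - t) * s) by cont.
  by move=> u; apply: (@continuous_comp _ _ _ (fun s : R => t + (1 - t) * s) G); [exact: cc|exact: Gc].
have pG' (f : R -> R) : p \o (fun s => G (f s)) = fun s => h (f s).
  by apply/funext => u /=.
have s1 : s <= l1.
  rewrite -ts; apply: cdist_le; exists (fun s => h (t * s)); split=> //.
  - by rewrite -(pG' (fun s => t * s)) => u; apply: continuous_comp; [exact: c1|exact: continuous_cover].
  - by rewrite mulr0 h0.
  - by have := path_Ext c1; rewrite (pG' (fun s => t * s)) mulr1 mulr0 G0.
apply: (@le_trans _ _ l2); last by lra.
apply: cdist_le; exists (fun s => h (t + (1 - t) * s)); split=> //.
- by rewrite -(pG' (fun s => t + (1 - t) * s)) => u; apply: continuous_comp; [exact: c2|exact: continuous_cover].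
- by rewrite mulr0 addr0 -pG.
- have := path_Ext c2; rewrite (pG' (fun s => t + (1 - t) * s)) mulr1 mulr0 addr0.
  by rewrite addrC subrK G1.
Qed.

Lemma cover_surj x : exists a, p a = x.
Proof.
have [h [l [hc h0 h1 lr hl]]] : exists (h : R -> X) (l : R), [/\ continuous h, h 0 = x0, h 1 = x, l < mdist x0 x + 1
    & (curve_length h <= l%:E)%E].
  by apply: length_space_short_path; rewrite // ltrDl.
by exists (cls x0 h); rewrite /p endpt_cls.
Qed.

(** The sheets over the ball of radius [r0 / 2] at [x] are the balls of that radius at the points of
    the fibre. Half of [r0] ensures that two points of one sheet, or two centres of meeting sheets,
    are closer than [r0]. *)
Lemma covering_map_cover : covering_map p.
Proof.
split; first exact: continuous_cover.
split; first exact: cover_surj.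
move=> x; have r2 : 0 < r0 / 2 by rewrite divr_gt0.
have oball (Z : metricType R) (z : Z) : open [set y | mdist z y < r0 / 2].
  rewrite openE => y /= zy; rewrite /interior /=.
  have zy0 : 0 < r0 / 2 - mdist z y by rewrite subr_gt0.
  apply: filterS (nbhs_mdist y zy0) => w /= yw.
  by apply: le_lt_trans (metric_triangle z y w) _; rewrite -ltrBrDl.
have r2r : r0 / 2 < r0 by rewrite ltr_pdivrMr // ltr_pMr // ltr1n.
exists [set y | mdist x y < r0 / 2]; split; first exact: oball.
split; first by rewrite /= mdistxx.
have near a b c : mdist a b < r0 / 2 -> mdist a c < r0 / 2 -> mdist b c < r0.
  move=> ab ac; apply: le_lt_trans (metric_triangle _ a _) _.
  by rewrite [ltRHS](splitr r0) metric_sym ltrD.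
exists {a : Y | p a = x}, (fun i => [set b : Y | mdist (sval i) b < r0 / 2]).
split; [|split; [|split]].
- apply/seteqP; split=> b /=.
    rewrite metric_sym => xb; have [a [pa ab]] := cover_lift_ball (lt_trans xb r2r).
    by exists (exist _ a pa) => //=; rewrite metric_sym ab.
  by move=> [[a /= pa] _ /= ab]; rewrite -pa; exact: le_lt_trans (cover_le _ _) ab.
- by move=> i; exact: oball.
- move=> [a pa] [b pb] ab; rewrite -subset0 => c /= [ac bc]; apply: ab.
  apply: eq_exist; apply: cover_inj; rewrite ?pa ?pb //.
  by apply: (near c); rewrite metric_sym.
- move=> [a pa] /=; split.
    by move=> b c; rewrite !inE /= => ab ac e; apply: cover_inj => //; exact: near ab ac.
  have /choice[s sP] (u : X) : exists b : Y, mdist x u < r0 / 2 -> mdist a b < r0 / 2 /\ p b = u.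
    have [xu|xu] := ltP (mdist x u) (r0 / 2); last by exists a.
    have [|b [pb ab]] := @cover_lift_ball a u; first by rewrite pa (lt_trans xu).
    by exists b => _; rewrite ab pa.
  split.
    apply/seteqP; split=> u /=.
      by move=> [b ab <-]; rewrite -pa; exact: le_lt_trans (cover_le _ _) ab.
    by move=> /sP[? ?]; exists (s u).
  exists s; split; first by move=> u; exact: sP.
  apply/subspace_continuousP => u xu; apply/(@metricType_numDomainType.cvgrPdist_lt _ Y) => e e0.
  have := nbhs_mdist u e0; apply: filterS => v /= uv xv.
  have [su psu] := sP _ xu; have [sv psv] := sP _ xv.
  by rewrite -cover_local_iso ?psu ?psv //; exact: near su sv.
Qed.

(** Extending [a] along the projection of a loop at [a] gives back [a], so the projection is
    null-homotopic by [ext_inj]. The null-homotopy lifts, and uniqueness of lifts identifies its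
    four sides. *)
Lemma simply_connected_cover : simply_connected R [set: Y].
Proof.
split.
  move=> a b _ _; have [h [hc h0 h1 hb]] := ext_joins a b.
  have [G [Gc G0 _ G1]] := path_lift hc h0.
  exists G; split; first exact: continuous_subspaceT.
  by rewrite G1 /Ext hb.
move=> a G _ [Gc [G0 [G1 _]]].
have Gc' : continuous (G \o @clamp R).
  exact: continuous_within_comp Gc (@continuous_clamp R) (@clampI R).
pose g := p \o (G \o @clamp R).
have gc : continuous g.
  by move=> t; apply: continuous_comp; [exact: Gc'|exact: continuous_cover].
have g0 : g 0 = p a by rewrite /g /= clamp0 G0.
have : homotopic g (fun=> p a).
  apply: (@ext_inj _ _ _ a) => //; first by cont.
  have e : a = ext a g by have := path_Ext Gc'; rewrite /= clamp0 clamp1 G0 G1.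
  by rewrite -e; apply/esym; exact: ext_cst.
move=> /homotopicE[H [Hc H0 H1 Hl Hr]].
have H00 : H (0, 0) = p a by rewrite Hl.
have Lc := continuous_lift Hc H00; have L0 := lift0 H00; have pL := liftK Hc H00.
set L := lift H a in Lc L0 pL.
have sc (c : R -> R * R) : continuous c -> continuous (L \o c).
  by move=> cc t; apply: continuous_comp; [exact: cc|exact: Lc].
have cc (z : Y) : continuous (fun _ : R => z) by cont.
have Lleft : L \o (fun s => (0, s)) = fun=> a.
  apply: lift_unique => //=; first by apply: sc; cont.
  by move=> t; rewrite pL Hl g0.
have Lbot : L \o (fun t => (t, 0)) = G \o @clamp R.
  apply: lift_unique => //=; first by apply: sc; cont.
    by move=> t; rewrite pL H0 /g /= (clamp_id (clampI t)).
  by rewrite L0 clamp0 G0.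
have Ltop : L \o (fun t => (t, 1)) = fun=> a.
  apply: lift_unique => //=; first by apply: sc; cont.
    by move=> t; rewrite pL H1.
  exact: (congr1 (fun f => f 1) Lleft).
have Lright : L \o (fun s => (1, s)) = fun=> a.
  apply: lift_unique => //=; first by apply: sc; cont.
    by move=> t; rewrite pL Hr /g /= clamp1 G1.
  by rewrite (congr1 (fun f => f 1) Lbot : L (1, 0) = _) /= clamp1.
apply: (@homotopicI _ _ L) => //.
- by move=> t It; rewrite (congr1 (fun f => f t) Lbot : L (t, 0) = _) /= clamp_id.
- by move=> t It; exact: (congr1 (fun f => f t) Ltop).
- by move=> t It; rewrite G0; exact: (congr1 (fun f => f t) Lleft).
- by move=> t It; rewrite G1; exact: (congr1 (fun f => f t) Lright).
Qed.

Lemma universal_cover_cover : universal_cover R p.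
Proof. by split; [exact: covering_map_cover|exact: simply_connected_cover]. Qed.

End CoverTopology.

Lemma homotopic_cancelr (R : realType) (T : topologicalType) (g h k : R -> T) :
  continuous g -> continuous h -> continuous k -> g 1 = k 0 -> h 1 = k 0 ->
  homotopic (concat g k) (concat h k) -> homotopic g h.
Proof.
move=> gc hc kc gk hk H; have rc := continuous_rev kc.
have key (m : R -> T) : continuous m -> m 1 = k 0 -> homotopic (concat (concat m k) (revp k)) m.
  move=> mc mk.
  apply: (@homotopic_trans _ _ _ (concat m (concat k (revp k)))).
    by apply: homotopic_concatA; rewrite ?rev_path0.
  apply: (@homotopic_trans _ _ _ (concat m (fun=> m 1))).
    apply: homotopic_concat; first by rewrite concat0.
      exact: homotopic_refl.
    by rewrite mk; exact: homotopic_concat_rev.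
  exact: homotopic_concat_cst.
apply: homotopic_trans (homotopic_sym (key _ gc gk)) _.
apply: homotopic_trans _ (key _ hc hk).
apply: homotopic_concat => //; first by rewrite rev_path0 concat1.
exact: homotopic_refl.
Qed.

(** * Action of loops on path classes *)

Section Deck.
Variables (R : realType) (X : metricType R) (x0 : X).
Implicit Types (a b : path_class x0) (g h : R -> X).

(** The loop is put in front of the path, so that the action commutes with extension at the other
    end and is by isometries. *)
Definition act g a : path_class x0 := cls x0 (concat (g \o @clamp R) (rep a)).

Local Notation loop g := (is_path (R := R) g x0 x0).

Lemma loop_clamp g : loop g ->
  [/\ continuous (g \o @clamp R), (g \o @clamp R) 0 = x0 & (g \o @clamp R) 1 = x0].
Proof.
move=> [gc [g0 [g1 _]]]; split; rewrite /= ?clamp0 ?clamp1 //.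
exact: continuous_within_comp gc (@continuous_clamp R) (@clampI R).
Qed.

Let continuous_rep' a : continuous (rep a). Proof. exact: continuous_rep. Qed.
Let rep0' a : rep a 0 = x0. Proof. exact: rep0. Qed.
Hint Resolve continuous_rep' rep0' : core.

Lemma loop_concat_rep g a : loop g ->
  continuous (concat (g \o @clamp R) (rep a)) /\ concat (g \o @clamp R) (rep a) 0 = x0.
Proof.
move=> /loop_clamp[gc g0 g1]; split; last by rewrite concat0.
by apply: continuous_concat; rewrite // g1 rep0.
Qed.

Lemma rep_act g a : loop g -> homotopic (rep (act g a)) (concat (g \o @clamp R) (rep a)).
Proof. by move=> /(loop_concat_rep a)[c c0]; exact: rep_cls. Qed.

Lemma endpt_act g a : loop g -> endpt (act g a) = endpt a.
Proof. by move=> /(loop_concat_rep a)[c c0]; rewrite endpt_cls // concat1. Qed.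

Lemma act_ext g a h : loop g -> continuous h -> h 0 = endpt a ->
  act g (ext a h) = ext (act g a) h.
Proof.
move=> lg hc h0; have [c c0] := loop_concat_rep a lg.
have [c' c0'] := loop_concat_rep (ext a h) lg; have [gc g0 g1] := loop_clamp lg.
apply: cls_hom => //; first by apply: continuous_rep_concat; rewrite // endpt_act.
apply: (@homotopic_trans _ _ _ (concat (g \o @clamp R) (concat (rep a) h))).
  apply: homotopic_concat; first by rewrite g1 rep0.
    exact: homotopic_refl.
  exact: rep_ext.
apply: (@homotopic_trans _ _ _ (concat (concat (g \o @clamp R) (rep a)) h)).
  by apply: homotopic_sym; apply: homotopic_concatA; rewrite // ?g1 ?rep0.
apply: homotopic_concat; [by rewrite concat1| |exact: homotopic_refl].
by apply: homotopic_sym; exact: rep_act.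
Qed.

Lemma act_hom g h a : loop g -> loop h -> homotopic g h -> act g a = act h a.
Proof.
move=> lg lh gh; have [c c0] := loop_concat_rep a lg; have [d d0] := loop_concat_rep a lh.
have [gc g0 g1] := loop_clamp lg.
apply: cls_hom => //; apply: homotopic_concat; [by rewrite g1 rep0| |exact: homotopic_refl].
apply: homotopic_trans (homotopic_clamp (proj1 lg)) _.
apply: homotopic_trans gh _.
by apply: homotopic_sym; apply: homotopic_clamp; exact: (proj1 lh).
Qed.

Lemma act_inj g h a : loop g -> loop h -> act g a = act h a -> homotopic g h.
Proof.
move=> lg lh e; have [c c0] := loop_concat_rep a lg; have [d d0] := loop_concat_rep a lh.
have [gc g0 g1] := loop_clamp lg; have [hc h0 h1] := loop_clamp lh.
have := hom_cls c d c0 d0 e.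
move=> /homotopic_cancelr H.
apply: homotopic_trans (homotopic_sym (homotopic_clamp (proj1 lg))) _.
apply: homotopic_trans _ (homotopic_clamp (proj1 lh)).
by apply: H; rewrite // ?g1 ?h1 rep0.
Qed.

Lemma loop_cst : loop (fun=> x0).
Proof. by split; [apply: continuous_subspaceT; cont|]. Qed.

Lemma act_cst a : act (fun=> x0) a = a.
Proof.
have [c c0] := loop_concat_rep a loop_cst.
rewrite -[RHS]cls_rep; apply: cls_hom => //.
by rewrite -{1}(rep0 a); exact: homotopic_cst_concat.
Qed.

Lemma concat_clamp g h t : I01 t ->
  concat g h t = concat (g \o @clamp R) (h \o @clamp R) t.
Proof.
by move=> /I01P[t0 t1]; rewrite /concat /=; case: ifP => t2; rewrite clamp_id //; apply/I01P; lra.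
Qed.

Lemma loop_concat g h : loop g -> loop h -> loop (concat g h).
Proof.
move=> lg lh; have [gc g0 g1] := loop_clamp lg; have [hc h0 h1] := loop_clamp lh.
have e : g 1 = x0 /\ h 1 = x0 /\ g 0 = x0.
  by move: g0 g1 h1; rewrite /= clamp0 clamp1.
split; last by rewrite concat0 concat1; case: e => _ [-> ->].
apply: (subspace_eq_continuous (f := concat (g \o @clamp R) (h \o @clamp R))).
  by move=> t; rewrite inE => It; rewrite -concat_clamp.
by apply: continuous_subspaceT; apply: continuous_concat; rewrite // g1.
Qed.

Lemma loop_rev g : loop g -> loop (revp g).
Proof.
move=> lg; have [gc g0 g1] := loop_clamp lg; have [_ [e0 [e1 _]]] := lg.
split; last by rewrite rev_path0 rev_path1.
apply: (subspace_eq_continuous (f := revp (g \o @clamp R))).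
  move=> t; rewrite inE => /I01P[t0 t1]; rewrite /Defs.rev_path /= clamp_id //.
  by apply/I01P; lra.
by apply: continuous_subspaceT; exact: continuous_rev.
Qed.

Lemma act_concat g h a : loop g -> loop h -> act (concat g h) a = act g (act h a).
Proof.
move=> lg lh; have lgh := loop_concat lg lh.
have [c c0] := loop_concat_rep a lgh; have [d d0] := loop_concat_rep (act h a) lg.
have [gc g0 g1] := loop_clamp lg; have [hc h0 h1] := loop_clamp lh.
have [ghc gh0 gh1] := loop_clamp lgh.
have cc : continuous (concat (g \o @clamp R) (h \o @clamp R)).
  by apply: continuous_concat; rewrite // g1.
apply: cls_hom => //.
apply: (@homotopic_trans _ _ _ (concat (concat (g \o @clamp R) (h \o @clamp R)) (rep a))).
  apply: homotopic_concat; [by rewrite gh1 rep0| |exact: homotopic_refl].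
  by apply: homotopic_ext => // t It; rewrite /= clamp_id // concat_clamp.
apply: (@homotopic_trans _ _ _ (concat (g \o @clamp R) (concat (h \o @clamp R) (rep a)))).
  by apply: homotopic_concatA; rewrite ?g1 ?h1 ?rep0.
apply: homotopic_concat; [by rewrite g1 concat0|exact: homotopic_refl|].
by apply: homotopic_sym; exact: rep_act.
Qed.

Lemma act_rev g a : loop g -> act (revp g) (act g a) = a.
Proof.
move=> lg; rewrite -act_concat //; last exact: loop_rev.
rewrite -[RHS]act_cst; apply: act_hom.
- by apply: loop_concat => //; exact: loop_rev.
- exact: loop_cst.
have [gc g0 g1] := loop_clamp lg; have [_ [e0 [e1 _]]] := lg.
apply: (@homotopic_trans _ _ _ (concat (revp (g \o @clamp R)) (g \o @clamp R))).
  apply: homotopic_sym; apply: homotopic_ext.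
    by apply: continuous_concat; rewrite ?rev_path1 //; exact: continuous_rev.
  move=> t /I01P[t0 t1]; rewrite /concat /Defs.rev_path /=.
  by case: ifP => t2; rewrite clamp_id //; apply/I01P; lra.
by rewrite -[X in homotopic _ (fun=> X)]g1; exact: homotopic_rev_concat.
Qed.

Lemma act_transitive a b : endpt a = endpt b -> exists2 g, loop g & act g a = b.
Proof.
move=> e; pose g := concat (rep b) (revp (rep a)).
have rc := continuous_rev (@continuous_rep _ _ _ a).
have gc : continuous g by apply: continuous_concat; rewrite // rev_path0.
have lg : loop g.
  split; first exact: continuous_subspaceT.
  by rewrite /g concat0 concat1 rev_path1 !rep0.
have [g'c g'0 g'1] := loop_clamp lg; have [c c0] := loop_concat_rep a lg.
exists g => //; rewrite -[RHS]cls_rep; apply: cls_hom => //.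
apply: (@homotopic_trans _ _ _ (concat g (rep a))).
  apply: homotopic_concat; [by rewrite g'1 rep0|apply: homotopic_clamp; exact: (proj1 lg)|exact: homotopic_refl].
apply: (@homotopic_trans _ _ _ (concat (rep b) (concat (revp (rep a)) (rep a)))).
  by apply: homotopic_concatA; rewrite ?rev_path0 ?rev_path1.
apply: (@homotopic_trans _ _ _ (concat (rep b) (fun=> rep b 1))).
  apply: homotopic_concat; [by rewrite concat0 rev_path0|exact: homotopic_refl|].
  by have := homotopic_rev_concat (@continuous_rep _ _ _ a); rewrite [rep a 1]e.
exact: homotopic_concat_cst.
Qed.

End Deck.

(* The properties of the universal cover, its lifted metric and its deck group (through
   the action of loops) on which the geometry below rests. *)
Record length_cover (R : realType) (X : metricType R) (x0 : X) := LengthCover {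
  lc_space :> metricType R;
  lc_map : lc_space -> X;
  lc_rad : R;
  lc_act : (R -> X) -> lc_space -> lc_space;
  lc_rad_gt0 : 0 < lc_rad;
  lc_universal : universal_cover R lc_map;
  lc_lifted_dist : forall a b : lc_space, lifted_dist lc_map a b = (mdist a b)%:E;
  lc_short : forall a b : lc_space, mdist (lc_map a) (lc_map b) <= mdist a b;
  lc_local_iso : forall a b : lc_space, mdist a b < lc_rad -> mdist (lc_map a) (lc_map b) = mdist a b;
  lc_lift : forall (a : lc_space) x, mdist (lc_map a) x < lc_rad ->
    exists b, lc_map b = x /\ mdist a b = mdist (lc_map a) x;
  lc_surj : forall x, exists a, lc_map a = x;
  lc_between : forall (a b : lc_space) (s e : R), 0 <= s <= mdist a b -> 0 < e ->
    exists c, mdist a c = s /\ mdist c b <= mdist a b - s + e;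
  lc_act_map : forall g a, is_path g x0 x0 -> lc_map (lc_act g a) = lc_map a;
  lc_act_iso : forall g (a b : lc_space), is_path g x0 x0 -> mdist (lc_act g a) (lc_act g b) = mdist a b;
  lc_act_hom : forall g h a, is_path g x0 x0 -> is_path h x0 x0 -> homotopic g h ->
    lc_act g a = lc_act h a;
  lc_act_inj : forall g h a, is_path g x0 x0 -> is_path h x0 x0 ->
    lc_act g a = lc_act h a -> homotopic g h;
  lc_act_cst : forall a, lc_act (fun=> x0) a = a;
  lc_act_concat : forall g h a, is_path g x0 x0 -> is_path h x0 x0 ->
    lc_act (concat g h) a = lc_act g (lc_act h a);
  lc_act_rev : forall g a, is_path g x0 x0 -> lc_act (revp g) (lc_act g a) = a;
  lc_act_transitive : forall a b : lc_space, lc_map a = lc_map b ->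
    exists2 g, is_path g x0 x0 & lc_act g a = b
}.

Lemma length_cover_exists (R : realType) (X : metricType R) (x0 : X) :
  compact [set: X] -> length_space X -> locally_simply_connected R X ->
  exists C : length_cover x0, True.
Proof.
move=> cX lX sX; have [r0 r0_gt0 r0P] := uniformly_simply_connected cX sX.
(* Acting does not increase distances; applying this to the reversed loop as well gives an
   isometry. *)
have le (g : R -> X) (a b : univ_cover x0 r0_gt0 r0P lX) : is_path g x0 x0 ->
    mdist (act g a : univ_cover x0 r0_gt0 r0P lX) (act g b) <= mdist a b.
  move=> lg; apply: lb_le_inf; first exact: (join_lengths_neq0 r0_gt0 r0P lX).
  move=> l [h [hc h0 hb hl]]; apply: (cdist_le); exists h; split=> //.
    by rewrite endpt_act.
  by rewrite -act_ext // hb.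
unshelve eexists; [|by []].
apply: (@LengthCover _ _ x0 (univ_cover x0 r0_gt0 r0P lX) (@endpt R X x0) r0 (@act R X x0)).
- exact: r0_gt0.
- exact: universal_cover_cover.
- exact: lifted_dist_cover.
- exact: cover_le.
- exact: cover_local_iso.
- exact: cover_lift_ball.
- exact: (@cover_surj _ _ x0 _ r0_gt0 r0P lX).
- exact: cover_between.
- exact: endpt_act.
- move=> g a b lg; apply/eqP; rewrite eq_le le //=.
  by have := le _ (act g a) (act g b) (loop_rev lg); rewrite !act_rev.
- exact: act_hom.
- exact: act_inj.
- exact: act_cst.
- exact: act_concat.
- exact: act_rev.
- exact: act_transitive.
Qed.

(** * Geodesics in the cover *)

(** The finite lists, filtered by inclusion, serve as the parameter in the near-covering form of
    compactness. *)
Lemma compact_finite_cover (T : topologicalType) (I : eqType) (A : set T)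
  (U : I -> set T) : compact A -> (forall x, A x -> exists i, nbhs x (U i)) ->
  exists s : seq I, forall x, A x -> exists2 i, i \in s & U i x.
Proof.
move=> /compact_near_coveringP cA cov.
pose F := filter_from [set: seq I] (fun s => [set t : seq I | {subset s <= t}]).
have FF : Filter F.
  apply: filter_from_filter; first by exists [::].
  move=> s t _ _; exists (s ++ t) => // w /= st.
  by split=> z zs; apply: st; rewrite mem_cat zs ?orbT.
have [x Ax|s _ H] := cA (seq I) F (fun s x => exists2 i, i \in s & U i x) FF.
  have [i Ui] := cov x Ax.
  exists (U i, [set t : seq I | {subset [:: i] <= t}]) => /=.
    by split=> //; exists [:: i].
  by move=> [y s] /= [Uy si]; exists i => //; apply: si; rewrite mem_head.
by exists s => x Ax; apply: (H s) => //= z.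
Qed.

Section MetricTopology.
Variables (R : realType) (Y : metricType R).
Implicit Types (a b c : Y).

Definition closed_ballm a (r : R) : set Y := [set b | mdist a b <= r].

Lemma mdist_lipschitz a b c : `|mdist a b - mdist a c| <= mdist b c.
Proof.
rewrite ler_norml; apply/andP; split.
  by have := metric_triangle a b c; lra.
by have := metric_triangle a c b; rewrite (metric_sym c); lra.
Qed.

Lemma continuous_mdistr a : continuous (fun b => mdist a b).
Proof. by apply: (continuous_mdist (G := id)) => x; exact: cvg_id. Qed.

Lemma open_mdist_lt a (r : R) : open [set b | mdist a b < r].
Proof.
rewrite openE => y /= zy; rewrite /interior /=.
have zy0 : 0 < r - mdist a y by rewrite subr_gt0.
apply: filterS (nbhs_mdist y zy0) => w /= yw.
by apply: le_lt_trans (metric_triangle a y w) _; rewrite -ltrBrDl.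
Qed.

Lemma closed_closed_ballm a (r : R) : closed (closed_ballm a r).
Proof.
rewrite -[X in closed X]setCK; apply: open_closedC.
rewrite openE => y /= /negP; rewrite -ltNge => ry; rewrite /interior /=.
have ry0 : 0 < mdist a y - r by rewrite subr_gt0.
apply: filterS (nbhs_mdist y ry0) => w /= yw; apply/negP; rewrite -ltNge.
have := metric_triangle a w y; rewrite (metric_sym w); lra.
Qed.

End MetricTopology.

(** * Compactness of closed balls of the cover *)

Section Proper.
Variables (R : realType) (X : metricType R) (x0 : X) (Y : length_cover x0).
Hypothesis cX : compact [set: X].
Implicit Types (a b c : Y).
Let p : Y -> X := @lc_map _ _ _ Y.
Local Notation r := (lc_rad Y).

(** The ball is contained in the image of a compact ball of the base under a local section of [p].
    Radius [r / 4] keeps any two lifted points within [r], where [p] is isometric. *)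
Lemma small_ball_compact a : compact (closed_ballm a (r / 4)).
Proof.
have rg := lc_rad_gt0 Y; have r4 : r / 4 < r by lra.
have /choice[s sP] (x : X) : exists b : Y, mdist (p a) x < r -> p b = x /\ mdist a b = mdist (p a) x.
  have [ax|ax] := ltP (mdist (p a) x) r; last by exists a.
  by have [b [pb ab]] := lc_lift ax; exists b.
have scont : {within closed_ballm (p a) (r / 4), continuous s}.
  apply/subspace_continuousP => x ax; apply/(@metricType_numDomainType.cvgrPdist_lt _ Y) => e e0.
  have := nbhs_mdist x e0; apply: filterS => y /= xy ay.
  have [ps1 as1] := sP x (le_lt_trans ax r4); have [ps2 as2] := sP y (le_lt_trans ay r4).
  rewrite -lc_local_iso -?/p ?ps1 ?ps2 //.
  apply: le_lt_trans (metric_triangle _ a _) _; rewrite metric_sym as1 as2.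
  by rewrite /closed_ballm /= in ax ay; move: ax ay r4; lra.
have cb : compact (closed_ballm (p a) (r / 4)).
  by apply: subclosed_compact cX _ => //; exact: closed_closed_ballm.
apply: subclosed_compact (continuous_compact scont cb) _; first exact: closed_closed_ballm.
move=> b ab; rewrite /closed_ballm /= in ab.
have pab : mdist (p a) (p b) <= r / 4 := le_trans (lc_short a b) ab.
exists (p b) => //.
have [ps1 as1] := sP (p b) (le_lt_trans pab r4).
apply: mdist_positivity; rewrite -lc_local_iso -?/p ?ps1 ?mdistxx //.
apply: le_lt_trans (metric_triangle _ a _) _; rewrite metric_sym as1.
by lra.
Qed.

(** The radius grows by [r / 16] at a time. Points of the larger ball are within [r / 8] of the
    smaller one, which finitely many balls of radius [r / 16] cover; so finitely many compact balls
    of radius [r / 4] cover the larger one. *)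
Lemma closed_ball_compact a (s : R) : compact (closed_ballm a s).
Proof.
have rg := lc_rad_gt0 Y.
have step t : 0 <= t -> compact (closed_ballm a t) -> compact (closed_ballm a (t + r / 16)).
  move=> t0 ct.
  have [b ab|D Dcov] := compact_finite_cover (U := fun b => [set c | mdist b c < r / 16]) ct.
    by exists b; apply: nbhs_mdist; lra.
  have cD : compact (\big[setU/set0]_(b <- D) closed_ballm b (r / 4)).
    by apply: bigsetU_compact => b _; exact: small_ball_compact.
  apply: subclosed_compact cD _; first exact: closed_closed_ballm.
  move=> b ab; rewrite /closed_ballm /= in ab.
  have [c [ac cb]] : exists c, mdist a c <= t /\ mdist c b <= r / 8.
    have [abt|abt] := leP (mdist a b) t.
      by exists b; rewrite mdistxx; split => //; lra.
    have [||c [ac cb]] := @lc_between _ _ _ Y a b t (r / 16); [by rewrite t0 ltW|by lra|].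
    by exists c; rewrite ac; split => //; move: ab cb; lra.
  have [d dD dc] := Dcov c ac; rewrite /= in dc.
  rewrite -bigcup_seq; exists d => //; rewrite /closed_ballm /=.
  by apply: le_trans (metric_triangle _ c _) _; lra.
have all n : compact (closed_ballm a (n%:R * (r / 16))).
  elim: n => [|n IH].
    apply: subclosed_compact (small_ball_compact (a := a)) _; first exact: closed_closed_ballm.
    by move=> b; rewrite /closed_ballm /= mul0r; lra.
  rewrite -addn1 natrD mulrDl mul1r; apply: step => //.
  by apply: mulr_ge0 => //; lra.
apply: subclosed_compact (all (Num.truncn (s / (r / 16))).+1) _; first exact: closed_closed_ballm.
move=> b; rewrite /closed_ballm /= => ab; apply: le_trans ab _.
rewrite -ler_pdivrMr; last lra.
by apply: ltW; exact: truncnS_gt.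
Qed.

(** The sphere of radius [s] at [a] is compact, so the distance to [b] attains its minimum there,
    and [lc_between] bounds that minimum up to every positive error. *)
Lemma cover_between_exact a b (s : R) : 0 <= s <= mdist a b ->
  exists c, mdist a c = s /\ mdist c b = mdist a b - s.
Proof.
move=> sab; pose K := closed_ballm a s `&` [set c | s <= mdist a c].
have cK : compact K.
  apply: subclosed_compact (@closed_ball_compact a s) _; last by move=> c [].
  apply: closedI; first exact: closed_closed_ballm.
  rewrite -[X in closed X]setCK; apply: open_closedC.
  have -> : ~` [set c : Y | s <= mdist a c] = [set c | mdist a c < s].
    by apply/seteqP; split=> c /=; rewrite ltNge => /negP.
  exact: open_mdist_lt.
have KE c : K c <-> mdist a c = s.
  by split=> [[/= h1 h2]|e]; [apply/eqP; rewrite eq_le h1|split; rewrite /closed_ballm /= e].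
have [||c cin cmin] := @compact_EVT_min _ R (fun c => mdist b c) K _ cK.
- by have [c [ac _]] := lc_between sab ltr01; exists c; apply/KE.
- by apply: continuous_subspaceT; exact: continuous_mdistr.
have ac : mdist a c = s by apply/KE; rewrite inE in cin.
exists c; split=> //; apply/eqP; rewrite eq_le; apply/andP; split.
  apply/ler_addgt0Pr => e e0; have [c' [ac' cb']] := lc_between sab e0.
  apply: le_trans cb'; rewrite metric_sym (metric_sym c').
  by apply: cmin; rewrite inE; apply/KE.
by have := metric_triangle a c b; lra.
Qed.

End Proper.

(** * Existence of minimizing geodesics *)

Section Minimizers.
Variables (R : realType) (Y : metricType R).
Hypothesis proper : forall (a : Y) (s : R), compact (closed_ballm a s).
Hypothesis between : forall (a b : Y) (s : R), 0 <= s <= mdist a b ->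
  exists c, mdist a c = s /\ mdist c b = mdist a b - s.
Implicit Types (a b c z : Y) (s t u v D : R).

(** Points are placed from left to right, each between its predecessor and [b]. As the distance to
    [b] drops at the full rate, all triangle inequalities among them are equalities. *)
Lemma finite_minimizer b t D (us : seq R) : 0 <= D -> forall s a,
  path <=%R s us -> last s us <= t -> mdist a b = D * (t - s) ->
  exists g : R -> Y, g s = a /\ forall u, u \in s :: us ->
    mdist (g u) b = D * (t - u) /\
    forall v, v \in s :: us -> mdist (g u) (g v) = D * `|u - v|.
Proof.
move=> D0; elim: us => [|w us IH] s a /=.
  move=> _ st ab; exists (fun=> a); split=> // u; rewrite inE => /eqP ->.
  by split=> // v; rewrite inE => /eqP ->; rewrite mdistxx subrr normr0 mulr0.
move=> /andP[sw pw] lt ab.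
have wt : w <= t.
  apply: le_trans lt; have := pw; rewrite (path_sortedE le_trans) => /andP[/allP al _].
  by have := mem_last w us; rewrite inE => /predU1P[->|/al].
have [|z [az zb]] := @between a b (D * (w - s)).
  by rewrite ab mulr_ge0 ?subr_ge0 //= ler_wpM2l // lerB.
have {}zb : mdist z b = D * (t - w) by rewrite zb ab; ring.
have [g [gw gP]] := IH w z pw lt zb.
have ge u : u \in w :: us -> w <= u.
  rewrite inE => /predU1P[->//|]; have := pw; rewrite (path_sortedE le_trans) => /andP[/allP al _].
  exact: al.
(* If [s] occurs again among the times then [w = s], and the new point has distance 0 from [a], so
   the override is consistent. *)
pose g' u := if u == s then a else g u.
have g'E u : u \in w :: us -> g' u = g u.
  move=> uw; rewrite /g'; case: eqP => // us'.
  have ws : w = s by apply/eqP; rewrite eq_le sw andbT -us' ge.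
  by rewrite us' -ws gw; apply: mdist_positivity; rewrite az ws subrr mulr0.
have g's : g' s = a by rewrite /g' eqxx.
have key u : u \in w :: us -> mdist a (g u) = D * `|s - u|.
  move=> uw; have [ub gg] := gP u uw; have wu := ge u uw.
  rewrite distrC ger0_norm ?subr_ge0 ?(le_trans sw) //.
  apply/eqP; rewrite eq_le; apply/andP; split.
    apply: le_trans (metric_triangle _ z _) _.
    rewrite az -gw; have [_ ->] := gP w (mem_head _ _) => //.
    by rewrite distrC ger0_norm ?subr_ge0 // -mulrDr; apply: ler_wpM2l => //; lra.
  have := metric_triangle a (g u) b; rewrite ab ub.
  by rewrite -lerBlDr -mulrBr; apply: le_trans; apply: ler_wpM2l => //; lra.
exists g'; split=> // u; rewrite inE => /predU1P[->|uw]; split.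
- by rewrite g's.
- move=> v; rewrite inE => /predU1P[->|vw].
    by rewrite mdistxx subrr normr0 mulr0.
  by rewrite g's g'E // key.
- by rewrite g'E //; have [] := gP u uw.
- move=> v; rewrite inE => /predU1P[->|vw].
    by rewrite g's g'E // metric_sym key // distrC.
  by rewrite !g'E //; have [_ ->] := gP u uw.
Qed.

Definition isometric_on D s t (g : R -> Y) := forall u v, s <= u <= t -> s <= v <= t ->
  mdist (g u) (g v) = D * `|u - v|.

Lemma nbhs_ptws (f : prod_topology (fun _ : R => Y)) u (e : R) : 0 < e ->
  nbhs f [set h : prod_topology (fun _ : R => Y) | mdist (f u) (h u) < e].
Proof.
move=> e0; exact: (@proj_continuous R (fun=> Y) u f _ (nbhs_mdist (f u) e0)).
Qed.

(* Tychonoff: the conditions imposed by finitely many times can be satisfied one point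
   after the other, and the balls are compact. *)
Lemma minimizer_exists a b s t D : s <= t -> 0 <= D -> mdist a b = D * (t - s) ->
  exists g : R -> Y, [/\ g s = a, g t = b & isometric_on D s t g].
Proof.
move=> st D0 ab; have Dts : 0 <= D * (t - s) by rewrite mulr_ge0 // subr_ge0.
pose good (us : seq R) (f : R -> Y) := forall u, u \in us -> s <= u <= t ->
  [/\ mdist a (f u) = D * (u - s), mdist (f u) b = D * (t - u) &
    forall v, v \in us -> s <= v <= t -> mdist (f u) (f v) = D * `|u - v|].
pose K : set (R -> Y) := [set f | forall i, closed_ballm a (D * (t - s)) (f i)].
have cK : compact (K : set (prod_topology (fun _ : R => Y))).
  exact: (@tychonoff R (fun=> Y) (fun=> closed_ballm a (D * (t - s))) (fun=> @proper _ _)).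
pose F : set_system (prod_topology (fun _ : R => Y)) :=
  filter_from [set: seq R] (fun us => K `&` good us).
have FF : ProperFilter F.
  apply: filter_from_proper; last first.
    move=> us _.
    pose vs := sort <=%R [seq u <- us | s <= u <= t].
    have vsP u : u \in us -> s <= u <= t -> u \in s :: vs.
      by move=> uus ust; rewrite inE mem_sort mem_filter ust uus orbT.
    have vst u : u \in vs -> s <= u <= t by rewrite mem_sort mem_filter => /andP[].
    have vsp : path <=%R s vs.
      rewrite (path_sortedE le_trans) sort_sorted ?andbT; last exact: le_total.
      by apply/allP => u /vst /andP[].
    have vsl : last s vs <= t.
      by have := mem_last s vs; rewrite inE => /predU1P[->//|/vst /andP[]].
    have [g [gs gP]] := finite_minimizer D0 vsp vsl ab.
    have gall u : u \in s :: vs -> mdist a (g u) = D * (u - s).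
      move=> uvs; have [_ gg] := gP s (mem_head _ _).
      rewrite -gs gg // distrC ger0_norm //; rewrite subr_ge0.
      by move: uvs; rewrite inE => /predU1P[->//|/vst /andP[]].
    have ut u : u \in s :: vs -> u <= t.
      by rewrite inE => /predU1P[->//|/vst /andP[]].
    exists (fun u => if u \in s :: vs then g u else a); split.
      move=> u /=; rewrite /closed_ballm /=; case: ifP => [uvs|]; last by rewrite mdistxx.
      by rewrite gall // ler_wpM2l // lerB // ut.
    move=> u uus ust; have uvs := vsP u uus ust; rewrite uvs.
    have [gb gg] := gP u uvs; split=> //; first exact: gall.
    by move=> v vus vst'; rewrite (vsP v) //; apply: gg; exact: vsP.
  apply: filter_from_filter; first by exists [::].
  move=> us vs _ _; exists (us ++ vs) => // f /= [Kf gf].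
  split; split=> // u uus ust.
    have uu : u \in us ++ vs by rewrite mem_cat uus.
    have [h1 h2 h3] := gf u uu ust; split=> // v vus vst; apply: h3 => //.
    by rewrite mem_cat vus.
  have uu : u \in us ++ vs by rewrite mem_cat uus orbT.
  have [h1 h2 h3] := gf u uu ust; split=> // v vus vst; apply: h3 => //.
  by rewrite mem_cat vus orbT.
have FK : F K by exists [::] => // f [].
have [f [Kf clf]] := cK F FF FK.
(* Each property of the limit [f] involves at most two times, and there [f] is approximated by
   functions with the exact distances. *)
have near (u v e : R) : 0 < e -> s <= u <= t -> s <= v <= t -> exists h : R -> Y,
    [/\ good [:: u; v] h, mdist (f u) (h u) < e & mdist (f v) (h v) < e].
  move=> e0 ust vst.
  have N := filterI (@nbhs_ptws f u e e0) (@nbhs_ptws f v e e0).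
  have [|h [[Kh gh] [h1 h2]]] := clf (K `&` good [:: u; v]) _ _ (N _).
    by exists [:: u; v].
  by exists h.
have small (x y : R) : (forall e : R, 0 < e -> `|x - y| <= e) -> x = y.
  move=> H; apply/eqP; rewrite -subr_eq0 -normr_eq0 eq_le normr_ge0 andbT.
  by apply/ler_addgt0Pl => e e0; rewrite addr0; exact: H.
have sst : s <= s <= t by rewrite lexx.
have tst : s <= t <= t by rewrite lexx andbT.
exists f; split.
- apply: mdist_positivity; apply: small => e e0.
  have [h [gh hs _]] := near s s e e0 sst sst.
  have [ah _ _] := gh s (mem_head _ _) sst.
  have := metric_triangle a (h s) (f s); rewrite metric_sym ah subrr mulr0 (metric_sym (h s)).
  by move: (mdist_ge0 a (f s)) => ?; rewrite metric_sym subr0 ger0_norm //; lra.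
- apply: mdist_positivity; apply: small => e e0.
  have [h [gh ht _]] := near t t e e0 tst tst.
  have [_ hb _] := gh t (mem_head _ _) tst.
  have := metric_triangle (f t) (h t) b; rewrite hb subrr mulr0.
  by move: (mdist_ge0 (f t) b) => ?; rewrite subr0 ger0_norm //; lra.
- move=> u v ust vst; apply: small => e e0.
  have e2 : 0 < e / 2 by rewrite divr_gt0.
  have [h [gh hu hv]] := near u v (e / 2) e2 ust vst.
  have [_ _ huv] := gh u (mem_head _ _) ust.
  have {}huv : mdist (h u) (h v) = D * `|u - v| by apply: huv; rewrite // !inE eqxx orbT.
  rewrite -huv; have := mdist_lipschitz (f u) (f v) (h v).
  have := mdist_lipschitz (h v) (f u) (h u).
  rewrite !ler_norml !(metric_sym (h v)); move=> /andP[? ?] /andP[? ?]; apply/andP; split; lra.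
Qed.
End Minimizers.

(** * Uniqueness and continuous dependence of geodesics *)

Section UniqueGeodesics.
Variables (R : realType) (Y : metricType R).
Hypothesis proper : forall (a : Y) (s : R), compact (closed_ballm a s).
Hypothesis between : forall (a b : Y) (s : R), 0 <= s <= mdist a b ->
  exists c, mdist a c = s /\ mdist c b = mdist a b - s.
Let dh (a b : Y) := (mdist a b)%:E.
Hypothesis unique : forall (a b : Y) (g h : R -> Y),
  geodesic dh g a b -> geodesic dh h a b -> forall t, I01 t -> g t = h t.
Implicit Types (a b c z : Y) (s t u v D : R).

Lemma isometric_geodesic D (g : R -> Y) : 0 <= D -> isometric_on D 0 1 g ->
  geodesic dh g (g 0) (g 1).
Proof.
move=> D0 gD; split.
  split; last by split=> //.
  apply/subspace_continuousP => t /I01P It.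
  apply/(@metricType_numDomainType.cvgrPdist_lt _ Y) => e e0.
  have d0 : 0 < e / (D + 1) by rewrite divr_gt0 // ltr_wpDl.
  have : \forall u \near t, `|t - u| < e / (D + 1).
    by apply/nbhs_ballP; exists (e / (D + 1)).
  apply: filterS => u tu /I01P Iu; rewrite gD; [|exact/andP|exact/andP].
  apply: (@le_lt_trans _ _ ((D + 1) * `|t - u|)).
    by rewrite ler_wpM2r // lerDl.
  by rewrite mulrC -ltr_pdivlMr // ltr_wpDl.
exists D; split=> // t _; exists 1; split=> // s s' /I01P Is /I01P Is' _ _.
by rewrite /dh gD //; exact/andP.
Qed.

Lemma geodesic_minimizing (g : R -> Y) a b : geodesic dh g a b ->
  isometric_on (mdist a b) 0 1 g.
Proof.
move=> gg; have [h [h0 h1 hi]] : exists h : R -> Y, [/\ h 0 = a, h 1 = b & isometric_on (mdist a b) 0 1 h].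
  by apply: minimizer_exists; rewrite // ?mdist_ge0 // subr0 mulr1.
have hg := isometric_geodesic (mdist_ge0 a b) hi; rewrite h0 h1 in hg.
move=> u v Iu Iv; rewrite !(unique gg hg) ?hi //; exact/I01P/andP.
Qed.

(** Minimizers from [a] to [z] and from [z] to [b] glue to a geodesic from [a] to [b] at constant
    speed; there is only one such geodesic. *)
Lemma division_unique a b t z z' : I01 t ->
  mdist a z = mdist a b * t -> mdist z b = mdist a b * (1 - t) ->
  mdist a z' = mdist a b * t -> mdist z' b = mdist a b * (1 - t) -> z = z'.
Proof.
move=> It; have /I01P[t0 t1] := It; set D := mdist a b.
have D0 : 0 <= D := mdist_ge0 a b.
have key w : mdist a w = D * t -> mdist w b = D * (1 - t) ->
    exists2 g : R -> Y, geodesic dh g a b & g t = w.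
  move=> aw wb.
  have [|g [g0 gt gi]] := minimizer_exists proper between t0 D0 (a := a) (b := w).
    by rewrite subr0.
  have [h [ht h1 hi]] := minimizer_exists proper between t1 D0 wb.
  pose k u := if u <= t then g u else h u.
  have k0 : k 0 = a by rewrite /k t0.
  have k1 : k 1 = b.
    rewrite /k; case: ifP => // t1'; have e : t = 1 by apply/eqP; rewrite eq_le t1 t1'.
    by rewrite -h1 -e ht gt.
  exists k; last by rewrite /k lexx.
  rewrite -{1}k0 -k1; apply: (isometric_geodesic D0).
  have cross u v : 0 <= u -> u <= t -> t <= v -> v <= 1 -> mdist (g u) (h v) = D * `|u - v|.
    move=> u0 ut tv v1; rewrite distrC ger0_norm ?subr_ge0 ?(le_trans ut) //.
    have gu : mdist (g u) w = D * (t - u).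
      by rewrite -gt gi ?u0 ?ut ?t0 ?lexx // distrC ger0_norm // subr_ge0.
    have hv : mdist w (h v) = D * (v - t).
      by rewrite -ht hi ?lexx ?t1 ?tv // distrC ger0_norm // subr_ge0.
    have au : mdist a (g u) = D * u.
      by rewrite -g0 gi ?u0 ?ut ?t0 ?lexx // distrC subr0 ger0_norm.
    have vb : mdist (h v) b = D * (1 - v).
      by rewrite -h1 hi ?lexx ?t1 ?tv // distrC ger0_norm // subr_ge0.
    apply/eqP; rewrite eq_le; apply/andP; split.
      by have := metric_triangle (g u) w (h v); rewrite gu hv -mulrDr => /le_trans; apply; rewrite ler_wpM2l //; lra.
    have := metric_triangle a (g u) b; have := metric_triangle (g u) (h v) b.
    rewrite au vb -/D => h2 h3; have -> : D * (v - u) = D - D * u - D * (1 - v) by ring.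
    lra.
  move=> u v /andP[u0 u1] /andP[v0 v1]; rewrite /k.
  have [ut|tu] := leP u t; have [vt|tv] := leP v t.
  - by apply: gi; rewrite ?u0 ?v0.
  - by apply: cross => //; exact: ltW.
  - by rewrite metric_sym distrC; apply: cross => //; exact: ltW.
  - by apply: hi; rewrite ?u1 ?v1 ?andbT; exact: ltW.
move=> az zb az' zb'; have [g gg <-] := key z az zb; have [h hh <-] := key z' az' zb'.
exact: unique gg hh _ It.
Qed.

Lemma division_exists a b t : exists z,
  mdist a z = mdist a b * clamp t /\ mdist z b = mdist a b * (1 - clamp t).
Proof.
have /I01P[t0 t1] := clampI t; have ab := mdist_ge0 a b.
have [|z [az zb]] := @between a b (mdist a b * clamp t).
  by rewrite mulr_ge0 //= ler_piMr.
by exists z; rewrite az zb; split=> //; ring.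
Qed.

(** The dividing point is chosen separately for each argument; [division_unique] makes the choices
    fit together. *)
Definition geo a b t : Y := projT1 (cid (division_exists a b t)).

Lemma geoP a b t : mdist a (geo a b t) = mdist a b * clamp t /\
  mdist (geo a b t) b = mdist a b * (1 - clamp t).
Proof. by rewrite /geo; case: cid. Qed.

Lemma geo0 a b : geo a b 0 = a.
Proof.
have [ag _] := geoP a b 0; apply/esym/mdist_positivity.
by rewrite ag clamp0 mulr0.
Qed.

Lemma geo1 a b : geo a b 1 = b.
Proof.
have [_ gb] := geoP a b 1; apply/mdist_positivity.
by rewrite gb clamp1 subrr mulr0.
Qed.

Lemma eq_small (x y k : R) : (forall e : R, 0 < e -> e < 1 -> `|x - y| <= k * e) -> x = y.
Proof.
move=> H; apply/eqP; rewrite -subr_eq0 -normr_eq0 eq_le normr_ge0 andbT.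
have k0 : 0 <= k.
  have e2 : 2^-1 < 1 :> R by rewrite invf_lt1 // ltr1n.
  have i2 : 0 < 2^-1 :> R by rewrite invr_gt0.
  by have := le_trans (normr_ge0 _) (H _ i2 e2); rewrite pmulr_lge0.
apply/ler_addgt0Pl => e e0; rewrite addr0.
pose d := Num.min (e / (k + 1)) 2^-1.
have k1 : 0 < k + 1 by rewrite ltr_wpDl.
have d0 : 0 < d by rewrite lt_min divr_gt0 //= invr_gt0.
have d1 : d < 1 by rewrite gt_min; apply/orP; right; rewrite invf_lt1 // ltr1n.
apply: le_trans (H d d0 d1) _; apply: (@le_trans _ _ ((k + 1) * d)).
  by rewrite ler_wpM2r ?(ltW d0) // lerDl.
by rewrite mulrC -ler_pdivlMr // ge_min lexx.
Qed.

(** The two distances that characterize a dividing point pass to the limit. *)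
Lemma division_limit a b t z :
  (forall e : R, 0 < e -> e < 1 -> exists a' b' t',
    [/\ mdist a a' < e, mdist b b' < e, `|clamp t - clamp t'| < e & mdist z (geo a' b' t') < e]) ->
  z = geo a b t.
Proof.
move=> H; have [ag gb] := geoP a b t; have /I01P[t0 t1] := clampI t.
pose M := mdist a b; have M0 : 0 <= M := mdist_ge0 a b.
suff [az zb] : mdist a z = M * clamp t /\ mdist z b = M * (1 - clamp t).
  by apply: (division_unique (clampI t) az zb).
(* Moving both ends of a segment by [e] changes its length by at most [2 * e]. This occurs once for
   the distance to [z] and once inside the product, where the change of parameter adds [M * e]. *)
have key (e : R) : 0 < e -> e < 1 -> `|mdist a z - M * clamp t| <= (M + 4) * e /\
    `|mdist z b - M * (1 - clamp t)| <= (M + 4) * e.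
  move=> e0 e1; have [a' [b' [t' [aa bb tt zz]]]] := H e e0 e1.
  have [ag' gb'] := geoP a' b' t'; have /I01P[t'0 t'1] := clampI t'.
  set z' := geo a' b' t' in zz ag' gb'.
  have d1 : `|mdist a z - mdist a' z'| <= 2 * e.
    have := mdist_lipschitz a z z'; have := mdist_lipschitz z' a a'.
    by rewrite !(metric_sym z') !ler_norml => /andP[? ?] /andP[? ?]; apply/andP; split; lra.
  have d2 : `|mdist z b - mdist z' b'| <= 2 * e.
    have := mdist_lipschitz z b b'; have := mdist_lipschitz b' z z'.
    by rewrite !(metric_sym b') !ler_norml => /andP[? ?] /andP[? ?]; apply/andP; split; lra.
  have d3 : `|M - mdist a' b'| <= 2 * e.
    have := mdist_lipschitz a b b'; have := mdist_lipschitz b' a a'.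
    by rewrite !(metric_sym b') !ler_norml => /andP[? ?] /andP[? ?]; apply/andP; split; rewrite /M; lra.
  have prod (x y : R) : 0 <= y -> y <= 1 -> `|x - y| < e -> `|M * x - mdist a' b' * y| <= (M + 2) * e.
    move=> y0 y1 xy; have -> : M * x - mdist a' b' * y = M * (x - y) + (M - mdist a' b') * y by ring.
    apply: le_trans (ler_normD _ _) _; rewrite !normrM (ger0_norm M0) (ger0_norm y0) mulrDl.
    apply: lerD; first by apply: ler_wpM2l => //; exact: ltW.
    by apply: le_trans d3; rewrite ler_piMr.
  have p1 := prod (clamp t) (clamp t') t'0 t'1 tt.
  have p2 : `|M * (1 - clamp t) - mdist a' b' * (1 - clamp t')| <= (M + 2) * e.
    apply: prod; [by rewrite subr_ge0|by rewrite gerBl|].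
    have -> : 1 - clamp t - (1 - clamp t') = - (clamp t - clamp t') by ring.
    by rewrite normrN.
  rewrite -ag' in p1; rewrite -gb' in p2.
  have -> : (M + 4) * e = 2 * e + (M + 2) * e by ring.
  split.
    apply: le_trans (ler_distD (mdist a' z') _ _) _; apply: lerD => //.
    by rewrite distrC.
  apply: le_trans (ler_distD (mdist z' b') _ _) _; apply: lerD => //.
  by rewrite distrC.
by split; apply: (eq_small (k := M + 4)) => e e0 e1; have [] := key e e0 e1.
Qed.

(** Counterexamples for smaller and smaller [d] cluster by compactness, and by [division_limit] both
    of their geodesic points cluster at the same dividing point. *)
Lemma geo_uniformly_continuous a0 r (e : R) : 0 < e ->
  exists2 d : R, 0 < d & forall a a' b b' t t',
    closed_ballm a0 r a -> closed_ballm a0 r b ->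
    mdist a a' < d -> mdist b b' < d -> `|clamp t - clamp t'| < d ->
    mdist (geo a b t) (geo a' b' t') < e.
Proof.
move=> e0; apply: contrapT => noD.
have bad (n : nat) : exists w : (Y * Y) * (Y * Y) * (R * R),
    [/\ closed_ballm a0 r w.1.1.1 /\ closed_ballm a0 r w.1.1.2,
     mdist w.1.1.1 w.1.2.1 < n.+1%:R^-1, mdist w.1.1.2 w.1.2.2 < n.+1%:R^-1,
     `|clamp w.2.1 - clamp w.2.2| < n.+1%:R^-1 &
     e <= mdist (geo w.1.1.1 w.1.1.2 w.2.1) (geo w.1.2.1 w.1.2.2 w.2.2)].
  apply: contrapT => noW; apply: noD; exists n.+1%:R^-1 => //.
  move=> a a' b b' t t' ha hb aa bb tt; rewrite ltNge; apply/negP => le.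
  by apply: noW; exists ((a, b), (a', b'), (t, t')).
have [w wP] := choice bad.
pose q n := ((((w n).1.1.1, (w n).1.1.2), clamp (w n).2.1), (geo (w n).1.1.1 (w n).1.1.2 (w n).2.1,
  geo (w n).1.2.1 (w n).1.2.2 (w n).2.2)) : ((Y * Y) * R) * (Y * Y).
(* Perturbed end points lie within [r + 1] of [a0], hence within [2 * (r + 1)] of each other, and a
   point of their geodesic is no further from its start. *)
pose B := closed_ballm a0 (3 * (r + 1)).
have geoB a b t : mdist a0 a <= r + 1 -> mdist a0 b <= r + 1 -> B (geo a b t).
  move=> ha hb; rewrite /B /closed_ballm /=.
  have [ag _] := geoP a b t; have /I01P[t0 t1] := clampI t.
  apply: le_trans (metric_triangle _ a _) _; rewrite ag.
  have ab : mdist a b <= 2 * (r + 1).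
    by apply: le_trans (metric_triangle _ a0 _) _; rewrite metric_sym; lra.
  have : mdist a b * clamp t <= mdist a b by rewrite ler_piMr // mdist_ge0.
  lra.
have cK : compact ((((closed_ballm a0 r) `*` (closed_ballm a0 r)) `*` `[0, 1]%classic) `*` (B `*` B) : set (((Y * Y) * R) * (Y * Y))).
  apply: compact_setX; last by apply: compact_setX; exact: proper.
  by apply: compact_setX; [apply: compact_setX; exact: proper|exact: segment_compact].
have [|[[[a b] tau] [z z']] [_ cl]] := cK (q @ \oo) _.
  exists 0%N => // n _; have [[ha hb] aa bb tt _] := wP n; split; last first.
    have n1 : n.+1%:R^-1 <= 1 :> R by rewrite invf_le1 // ler1n.
    rewrite /closed_ballm /= in ha hb.
    have aa1 := lt_le_trans aa n1; have bb1 := lt_le_trans bb n1.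
    have r1 : r <= r + 1 by rewrite lerDl.
    split; apply: geoB; first [exact: le_trans ha r1|exact: le_trans hb r1|idtac].
      by have := metric_triangle a0 (w n).1.1.1 (w n).1.2.1; lra.
    by have := metric_triangle a0 (w n).1.1.2 (w n).1.2.2; lra.
  by split; [split|rewrite /= in_itv /=; apply/andP; apply/I01P; exact: clampI].
have near (d : R) : 0 < d -> exists n, [/\ n.+1%:R^-1 < d, mdist a (w n).1.1.1 < d /\ mdist b (w n).1.1.2 < d,
    `|tau - clamp (w n).2.1| < d,
    mdist z (geo (w n).1.1.1 (w n).1.1.2 (w n).2.1) < d &
    mdist z' (geo (w n).1.2.1 (w n).1.2.2 (w n).2.2) < d].
  move=> d0.
  have N : nbhs (((a, b), tau), (z, z')) ((([set x | mdist a x < d] `*` [set x | mdist b x < d]) `*`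
      [set t | `|tau - t| < d]) `*` ([set x | mdist z x < d] `*` [set x | mdist z' x < d])).
    exists (([set x | mdist a x < d] `*` [set x | mdist b x < d]) `*` [set t | `|tau - t| < d],
      [set x | mdist z x < d] `*` [set x | mdist z' x < d]) => //; split.
      exists ([set x | mdist a x < d] `*` [set x | mdist b x < d], [set t | `|tau - t| < d]) => //; split.
        by exists ([set x | mdist a x < d], [set x | mdist b x < d]) => //; split; exact: nbhs_mdist.
      by apply/nbhs_ballP; exists d.
    by exists ([set x | mdist z x < d], [set x | mdist z' x < d]) => //; split; exact: nbhs_mdist.
  have M : (q @ \oo) [set x | exists2 n, n.+1%:R^-1 < d & x = q n].
    by apply: filterS (near_infty_natSinv_lt (PosNum d0)) => n nd; exists n.
  have [x [[n nd ->]]] := cl _ _ M N.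
  by move=> [[[/= h1 h2] h3] [/= h4 h5]]; exists n.
have tauI : I01 tau.
  apply/I01P; split; rewrite leNgt; apply/negP => h.
    have h' : 0 < - tau by rewrite oppr_gt0.
    have [n [_ _ + _ _]] := near _ h'; have /I01P[] := clampI (w n).2.1.
    by rewrite ltr_norml => ? ? /andP[]; lra.
  have h' : 0 < tau - 1 by rewrite subr_gt0.
  have [n [_ _ + _ _]] := near _ h'; have /I01P[] := clampI (w n).2.1.
  by rewrite ltr_norml => ? ? /andP[]; lra.
have zE : z = geo a b tau.
  apply: division_limit => d d0 d1; have [n [_ [h1 h2] h3 h4 _]] := near d d0.
  by exists (w n).1.1.1, (w n).1.1.2, (w n).2.1; split; rewrite ?(clamp_id tauI).
have z'E : z' = geo a b tau.
  apply: division_limit => d d0 d1; have d2 : 0 < d / 2 by rewrite divr_gt0.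
  have [n [hn [h1 h2] h3 _ h4]] := near _ d2; have [_ aa bb tt _] := wP n.
  exists (w n).1.2.1, (w n).1.2.2, (w n).2.2; split.
  - apply: le_lt_trans (metric_triangle _ (w n).1.1.1 _) _.
    by rewrite [ltRHS](splitr d) ltrD // (lt_trans aa).
  - apply: le_lt_trans (metric_triangle _ (w n).1.1.2 _) _.
    by rewrite [ltRHS](splitr d) ltrD // (lt_trans bb).
  - apply: le_lt_trans (ler_distD (clamp (w n).2.1) _ _) _.
    by rewrite (clamp_id tauI) [ltRHS](splitr d) ltrD // (lt_trans tt).
  - by apply: lt_trans h4 _; rewrite ltr_pdivrMr // ltr_pMr // ltr1n.
have e2 : 0 < e / 2 by rewrite divr_gt0.
have [n [_ _ _ h4 h5]] := near _ e2; have [_ _ _ _] := wP n.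
rewrite leNgt => /negP; apply; apply: le_lt_trans (metric_triangle _ z _) _.
by rewrite {2}zE -z'E metric_sym [ltRHS](splitr e); apply: ltrD.
Qed.
End UniqueGeodesics.

Lemma clamp_lipschitz (R : realType) (x y : R) : `|clamp x - clamp y| <= `|x - y|.
Proof.
have lo (z : R) : z <= 0 -> clamp z = 0.
  by move=> z0; rewrite /clamp (min_l (x := z)) ?max_l // (le_trans z0).
have hi (z : R) : 1 <= z -> clamp z = 1.
  by move=> z1; rewrite /clamp min_r // max_r.
have mid (z : R) : 0 <= z -> z <= 1 -> clamp z = z.
  by move=> z0 z1; apply: clamp_id; apply/I01P.
have cases (z : R) : [\/ z <= 0 /\ clamp z = 0, [/\ 0 <= z, z <= 1 & clamp z = z] | 1 <= z /\ clamp z = 1].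
  have [z0|z0] := leP z 0; first by constructor 1; split=> //; exact: lo.
  have [z1|z1] := leP z 1; first by constructor 2; split=> //; rewrite ?mid // ltW.
  by constructor 3; split; [exact: ltW|apply: hi; exact: ltW].
have [[x0 ->]|[x0 x1 ->]|[x1 ->]] := cases x; have [[y0 ->]|[y0 y1 ->]|[y1 ->]] := cases y;
  rewrite ler_norml; apply/andP; have [s|s] := lerP 0 (x - y);
  rewrite ?(ger0_norm s) ?(ltr0_norm s); split; lra.
Qed.

(** * Piecewise geodesic paths *)

Section PiecewiseGeodesic.
Variables (R : realType) (Y : metricType R).
Hypothesis proper : forall (a : Y) (s : R), compact (closed_ballm a s).
Hypothesis between : forall (a b : Y) (s : R), 0 <= s <= mdist a b ->
  exists c, mdist a c = s /\ mdist c b = mdist a b - s.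
Let dh (a b : Y) := (mdist a b)%:E.
Hypothesis unique : forall (a b : Y) (g h : R -> Y),
  geodesic dh g a b -> geodesic dh h a b -> forall t, I01 t -> g t = h t.
Local Notation geo := (geo between).

Definition broken_geodesic (P : nat -> Y) (t : R) : Y :=
  geo (P (Num.truncn t)) (P (Num.truncn t).+1) (t - (Num.truncn t)%:R).

Lemma broken_geodesic_near P t : mdist (broken_geodesic P t) (P (Num.truncn t)) <=
  mdist (P (Num.truncn t)) (P (Num.truncn t).+1).
Proof.
rewrite metric_sym; have [-> _] := geoP between (P (Num.truncn t)) (P (Num.truncn t).+1) (t - (Num.truncn t)%:R).
by rewrite ler_piMr ?mdist_ge0 //; have /I01P[] := clampI (t - (Num.truncn t)%:R).
Qed.

(** With [d] at most 1 the two times lie in the same or in adjacent unit cells; in the second case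
    the common vertex splits the estimate into two halves. The bound is uniform in the vertices,
    which allows an induction on coordinates in [cube_map_uniformly_continuous]. *)
Lemma broken_geodesic_uniformly_continuous (M : nat) a0 r (e : R) : 0 < e ->
  exists2 d : R, 0 < d & forall P P' : nat -> Y,
    (forall n, (n <= M.+1)%N -> closed_ballm a0 r (P n) /\ closed_ballm a0 r (P' n)) ->
    (forall n, (n <= M.+1)%N -> mdist (P n) (P' n) < d) ->
    forall t t', 0 <= t <= M%:R -> 0 <= t' <= M%:R -> `|t - t'| < d ->
      mdist (broken_geodesic P t) (broken_geodesic P' t') < e.
Proof.
move=> e0; have e2 : 0 < e / 2 by rewrite divr_gt0.
have [d d0 dP] := geo_uniformly_continuous proper between unique a0 r e2.
exists (Num.min d 1); first by rewrite lt_min d0 ltr01.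
move=> P P' + + t t'; wlog tt' : P P' t t' / t <= t'.
  move=> W B PP It It' dt; have [le|lt] := leP t t'; first exact: W.
  rewrite metric_sym; apply: W => //; [exact: ltW|by move=> n /B[]|by move=> n /PP; rewrite metric_sym|by rewrite distrC].
move=> B PP /andP[t0 tM] /andP[t'0 t'M]; rewrite lt_min => /andP[dt dt1].
have PPd n : (n <= M.+1)%N -> mdist (P n) (P' n) < d.
  by move=> /PP; rewrite lt_min => /andP[].
rewrite /broken_geodesic; set k := Num.truncn t; set k' := Num.truncn t'.
have kt : k%:R <= t by rewrite truncn_le.
have k't : k'%:R <= t' by rewrite truncn_le.
have tk : t < k.+1%:R by exact: truncnS_gt.
have t'k : t' < k'.+1%:R by exact: truncnS_gt.
have kM : (k <= M)%N by rewrite -(ler_nat R); exact: le_trans tM.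
have k'M : (k' <= M)%N by rewrite -(ler_nat R); exact: le_trans t'M.
have kk' : (k <= k')%N by exact: le_truncn.
rewrite ler0_norm ?subr_le0 // in dt dt1.
have [B1 _] := B k (leqW kM); have [B2 _] := B k.+1 kM.
have [B3 _] := B k' (leqW k'M); have [B4 _] := B k'.+1 k'M.
move: kk'; rewrite leq_eqVlt => /orP[/eqP kk'|lt].
  apply: (@lt_trans _ _ (e / 2)); last by rewrite ltr_pdivrMr // ltr_pMr // ltr1n.
  apply: dP => //; [by rewrite -kk'; exact/PPd/leqW|by rewrite -kk'; exact/PPd|].
  apply: le_lt_trans (clamp_lipschitz _ _) _; rewrite -kk' opprB addrA subrK.
  by rewrite distrC ger0_norm ?subr_ge0 // -opprB.
have kk' : k' = k.+1.
  apply/eqP; rewrite eqn_leq lt andbT -ltnS -(ltr_nat R).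
  apply: le_lt_trans k't _; rewrite -(addn1 k.+1) natrD; lra.
have k'P : P k.+1 = P k' by rewrite kk'.
have h1 : mdist (geo (P k) (P k.+1) (t - k%:R)) (P k.+1) < e / 2.
  rewrite -{2}(geo1 between (P k) (P k.+1)); apply: dP => //; rewrite ?mdistxx //.
  apply: le_lt_trans (clamp_lipschitz _ _) _.
  rewrite -addrA -opprD -natr1 in tk *; rewrite ltr0_norm ?opprB; last lra.
  by move: k't dt; rewrite kk' -natr1; lra.
have h2 : mdist (P k') (geo (P' k') (P' k'.+1) (t' - k'%:R)) < e / 2.
  rewrite -{1}(geo0 between (P k') (P k'.+1)); apply: dP => //; [exact/PPd/leqW|exact: PPd|].
  apply: le_lt_trans (clamp_lipschitz _ _) _; rewrite sub0r normrN ger0_norm ?subr_ge0 //.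
  by move: tk; rewrite -kk'; lra.
apply: le_lt_trans (metric_triangle _ (P k') _) _.
by rewrite [ltRHS](splitr e) -{1}k'P; apply: ltrD.
Qed.

End PiecewiseGeodesic.

(** * Translation lengths *)

Section TranslationLength.
Variables (R : realType) (Y : metricType R).
Implicit Types (a b y z : Y) (T U : Y -> Y).

Definition dist_preserving T := forall a b, mdist (T a) (T b) = mdist a b.

Definition translation_length T : R := inf [set mdist y (T y) | y in [set: Y]].
Local Notation tl := translation_length.

(** Replaces the existence of an invariant line: one orbit on which all powers achieve the
    displacement expected from homogeneity. *)
Definition axial T := exists y, forall n, mdist y (iter n T y) = n%:R * tl T.

Lemma translation_length_le T y : tl T <= mdist y (T y).
Proof.
apply: ge_inf; last by exists y.
by exists 0 => _ [z _ <-]; exact: mdist_ge0.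
Qed.

Lemma translation_length_ge T (y0 : Y) (l : R) : (forall y, l <= mdist y (T y)) -> l <= tl T.
Proof.
move=> H; apply: lb_le_inf; first by exists (mdist y0 (T y0)), y0.
by move=> _ [y _ <-].
Qed.

Lemma isometry_iter T n : dist_preserving T -> dist_preserving (iter n T).
Proof. by move=> iT; elim: n => [|n IH] a b //=; rewrite iT. Qed.

Lemma mdist_iter_le T n y : dist_preserving T -> mdist y (iter n T y) <= n%:R * mdist y (T y).
Proof.
move=> iT; elim: n => [|n IH]; first by rewrite mdistxx mul0r.
rewrite iterS -addn1 natrD mulrDl mul1r; apply: le_trans (metric_triangle _ (T y) _) _.
by rewrite iT addrC lerD2r.
Qed.

Lemma le_of_natmul (x c : R) : (forall m : nat, m%:R * x <= c) -> x <= 0.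
Proof.
move=> H; rewrite leNgt; apply/negP => x0.
have := H (Num.truncn (c / x)).+1; rewrite leNgt => /negP; apply.
by rewrite -ltr_pdivrMr //; exact: truncnS_gt.
Qed.

(** Changing the base point costs a constant independent of [n], which is negligible for large
    powers. *)
Lemma axial_displacement T y z n : dist_preserving T ->
  (forall n, mdist y (iter n T y) = n%:R * tl T) ->
  n%:R * tl T <= mdist z (iter n T z) + 2 * mdist y z.
Proof.
move=> iT yT; rewrite -yT; apply: le_trans (metric_triangle _ z _) _.
have := metric_triangle z (iter n T z) (iter n T y).
by rewrite (isometry_iter n iT) (metric_sym z y); lra.
Qed.

Lemma translation_length_iter T n : dist_preserving T -> axial T ->
  tl (iter n T) = n%:R * tl T.
Proof.
move=> iT [y yT]; apply/eqP; rewrite eq_le; apply/andP; split.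
  by rewrite -yT; exact: translation_length_le.
apply: (translation_length_ge y) => z; rewrite -subr_le0.
apply: (@le_of_natmul _ (2 * mdist y z)) => m.
have := axial_displacement z (m * n)%N iT yT; have := mdist_iter_le m z (isometry_iter n iT).
have -> : iter m (iter n T) z = iter (m * n) T z.
  by elim: m => [|m IH] //=; rewrite IH mulSn iterD.
rewrite natrM mulrBr; lra.
Qed.

(** As the maps commute, the m-th power of the product is the product of m-th powers. Comparing
    displacements at one point gives the inequality times [m], up to a constant. *)
Lemma translation_length_comp T U : dist_preserving T -> dist_preserving U -> axial T -> axial U ->
  axial (T \o U) -> (forall y, T (U y) = U (T y)) -> tl (T \o U) <= tl T + tl U.
Proof.
move=> iT iU [y yT] [z zU] [w wTU] TU.
have iTU : dist_preserving (T \o U) by move=> a b; rewrite /= iT iU.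
rewrite -subr_le0; apply: (@le_of_natmul _ (2 * mdist w y + 2 * mdist z y)) => m.
have e : iter m (T \o U) y = iter m T (iter m U y).
  have comm k x : iter k T (U x) = U (iter k T x) by elim: k x => //= k IH x; rewrite IH TU.
  by elim: m => //= m ->; rewrite comm TU.
have h1 := axial_displacement y m iTU wTU.
have h2 : mdist y (iter m (T \o U) y) <= m%:R * tl T + mdist y (iter m U y).
  rewrite e -yT; apply: le_trans (metric_triangle _ (iter m T y) _) _.
  by rewrite (isometry_iter m iT).
have h3 : mdist y (iter m U y) <= m%:R * tl U + 2 * mdist z y.
  rewrite -zU; apply: le_trans (metric_triangle _ z _) _.
  have := metric_triangle z (iter m U z) (iter m U y).
  by rewrite (isometry_iter m iU) (metric_sym y z); lra.
rewrite mulrBr mulrDr; lra.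
Qed.

End TranslationLength.

(** * Orbits of minimal displacement *)

Section Axis.
Variables (R : realType) (Y : metricType R).
Hypothesis proper : forall (a : Y) (s : R), compact (closed_ballm a s).
Hypothesis between : forall (a b : Y) (s : R), 0 <= s <= mdist a b ->
  exists c, mdist a c = s /\ mdist c b = mdist a b - s.
Let dh (a b : Y) := (mdist a b)%:E.
Hypothesis unique : forall (a b : Y) (g h : R -> Y),
  geodesic dh g a b -> geodesic dh h a b -> forall t, I01 t -> g t = h t.

(* The orbit of a geodesic from y to T y is geodesic near its break points, because the
   displacement of every point A s is at least that of y. *)
Lemma minimal_displacement_axial (T : Y -> Y) (y : Y) : dist_preserving T ->
  (forall z, mdist y (T y) <= mdist z (T z)) ->
  forall n, mdist y (iter n T y) = n%:R * mdist y (T y).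
Proof.
move=> iT ymin [|n]; first by rewrite mdistxx mul0r.
set l := mdist y (T y); have l0 : 0 <= l := mdist_ge0 y (T y).
have [|g [g0 g1 gi]] := minimizer_exists proper between (@ler01 R) l0 (a := y) (b := T y).
  by rewrite subr0 mulr1.
(* On [k, k + 1] the path [A] is the k-th translate of the minimizer [g] from [y] to [T y]. *)
pose A t := iter (Num.truncn t) T (g (t - (Num.truncn t)%:R)).
have AE k (t : R) : k%:R <= t <= k.+1%:R -> A t = iter k T (g (t - k%:R)).
  move=> /andP[kt tk]; have t0 : 0 <= t := le_trans (ler0n _ _) kt.
  move: tk; rewrite le_eqVlt => /predU1P[->|tk].
    by rewrite /A natrK subrr g0 -natr1 addrC addKr g1 iterSr.
  by rewrite /A (truncn_def (n := k)) // kt.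
have Acell k (s t : R) : k%:R <= s <= k.+1%:R -> k%:R <= t <= k.+1%:R ->
    mdist (A s) (A t) = l * `|s - t|.
  move=> sk tk; rewrite (AE k s sk) (AE k t tk) isometry_iter // gi; last first.
  - by move: tk; rewrite -natr1 => /andP[? ?]; apply/andP; split; lra.
  - by move: sk; rewrite -natr1 => /andP[? ?]; apply/andP; split; lra.
  by congr (l * `|_|); ring.
have AS (s : R) : 0 <= s -> A (s + 1) = T (A s).
  move=> s0; have /andP[h1 h2] := truncn_itv s0.
  rewrite (AE (Num.truncn s).+1); last by rewrite -!natr1 in h2 *; apply/andP; split; lra.
  by rewrite /A iterS -natr1; congr (T (iter _ T (g _))); ring.
have Aloc (s t : R) : 0 <= s -> s <= t -> t <= s + 1 -> mdist (A s) (A t) = l * (t - s).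
  move=> s0 st ts; have /andP[h1 h2] := truncn_itv s0; set k := Num.truncn s in h1 h2.
  have [tk|tk] := leP t k.+1%:R.
    rewrite (Acell k) ?h1 ?(ltW h2) ?(le_trans h1) //.
    by rewrite distrC ger0_norm // subr_ge0.
  have c1 : k%:R <= s <= k.+1%:R by rewrite h1 ltW.
  have c2 : (k%:R <= k.+1%:R :> R) && (k.+1%:R <= k.+1%:R :> R) by rewrite lexx ler_nat leqnSn.
  have c3 : (k.+1%:R <= k.+1%:R :> R) && (k.+1%:R <= k.+2%:R :> R) by rewrite lexx ler_nat leqnSn.
  have c4 : k.+1%:R <= t <= k.+2%:R.
    by rewrite (ltW tk) /= (le_trans ts) // -[leRHS]natr1 lerD2r ltW.
  have c5 : k.+1%:R <= s + 1 <= k.+2%:R.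
    by rewrite -!natr1 !lerD2r h1 natr1 ltW.
  apply/eqP; rewrite eq_le; apply/andP; split.
    apply: le_trans (metric_triangle _ (A k.+1%:R) _) _.
    have e1 : `|s - k.+1%:R| = k.+1%:R - s by rewrite distrC ger0_norm // subr_ge0 ltW.
    have e2 : `|k.+1%:R - t| = t - k.+1%:R by rewrite distrC ger0_norm // subr_ge0 ltW.
    by rewrite (Acell _ _ _ c1 c2) (Acell _ _ _ c3 c4) e1 e2 -mulrDr ler_wpM2l //; lra.
  have := metric_triangle (A s) (A t) (A (s + 1)).
  rewrite (Acell _ _ _ c4 c5) distrC ger0_norm ?subr_ge0 // AS //.
  have := ymin (A s); rewrite -/l => h3 h4.
  by have := le_trans h3 h4; rewrite -lerBlDr; have -> : l - l * (s + 1 - t) = l * (t - s) by ring.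
pose N : R := n.+1%:R; have N0 : 0 < N by rewrite ltr0n.
pose G u := A (N * u).
have Gloc (s t : R) : I01 s -> I01 t -> `|s - t| < N^-1 -> mdist (G s) (G t) = (N * l) * `|s - t|.
  wlog st : s t / s <= t.
    by move=> W Is It d; have [?|/ltW ?] := leP s t; [exact: W|rewrite metric_sym distrC; apply: W => //; rewrite distrC].
  move=> /I01P[s0 _] /I01P[t0 _]; rewrite distrC ger0_norm ?subr_ge0 // => d.
  rewrite /G Aloc.
  - by rewrite -mulrBr mulrA (mulrC l).
  - by rewrite mulr_ge0 // ltW.
  - by rewrite ler_pM2l.
  - by rewrite -lerBlDl -mulrBr mulrC -ler_pdivlMr // mul1r ltW.
have G0 : G 0 = y by rewrite /G mulr0 /A truncn0 subrr g0.
have G1 : G 1 = iter n.+1 T y by rewrite /G mulr1 /N /A natrK subrr g0.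
have N1 : 0 < N^-1 by rewrite invr_gt0.
have Nl : 0 <= N * l by rewrite mulr_ge0 // ltW.
have Gg : geodesic dh G y (iter n.+1 T y).
  split.
    split; last by rewrite G0 G1.
    apply/subspace_continuousP => t It.
    apply/(@metricType_numDomainType.cvgrPdist_lt _ Y) => e e0.
    pose d := Num.min (e / (N * l + 1)) N^-1.
    have Nl1 : 0 < N * l + 1 by rewrite ltr_wpDl.
    have d0 : 0 < d by rewrite lt_min N1 divr_gt0.
    have : \forall u \near t, `|t - u| < d by apply/nbhs_ballP; exists d.
    apply: filterS => u; rewrite lt_min => /andP[d1 d2] Iu; rewrite Gloc //.
    apply: (@le_lt_trans _ _ ((N * l + 1) * `|t - u|)); first by rewrite ler_wpM2r // lerDl.
    by rewrite mulrC -ltr_pdivlMr.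
  exists (N * l); split=> // t It; exists (N^-1 / 2); split; first by rewrite divr_gt0.
  move=> s s' Is Is' d1 d2; rewrite /dh Gloc //.
  apply: le_lt_trans (ler_distD t _ _) _.
  by rewrite [ltRHS](splitr) ltrD // distrC.
(* [G] now has constant speed equal to the distance of its end points, while on an initial interval
   shorter than [N^-1] its speed is [N * l]; comparing the two at [N^-1 / 2] gives the claim. *)
have := geodesic_minimizing proper between unique Gg.
have Nh : 0 < N^-1 / 2 by rewrite divr_gt0.
have Nh1 : N^-1 / 2 <= 1.
  have half (x : R) : 0 < x -> x <= 1 -> x / 2 <= 1 by lra.
  by apply: half => //; rewrite invf_le1 // ler1n.
have Nh2 : N^-1 / 2 < N^-1 by rewrite ltr_pdivrMr // ltr_pMr // ltr1n.
move=> /(_ 0 (N^-1 / 2)); rewrite lexx ler01 (ltW Nh) Nh1 => /(_ isT isT).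
rewrite Gloc; last 3 first.
- by apply/I01P.
- by apply/I01P; rewrite ltW.
- by rewrite sub0r normrN gtr0_norm.
rewrite sub0r normrN gtr0_norm // => /esym; apply: mulIf.
by rewrite gt_eqF.
Qed.

End Axis.

Lemma finite_above (R : realType) (A : choiceType) (f : A -> R) (D : set A) (l : R) :
  finite_set D -> (forall w, D w -> l < f w) ->
  exists2 m, l < m & forall w, D w -> m <= f w.
Proof.
move=> /finite_seqP[s ->]; elim: s => [|w s IH] H.
  by exists (l + 1) => //; rewrite ltrDl.
have [v vs|m lm mP] := IH; first by apply: H; rewrite /= inE; apply/orP; right.
exists (Num.min m (f w)); first by rewrite lt_min lm H //= mem_head.
move=> v /=; rewrite inE => /predU1P[->|vs]; first by rewrite ge_min lexx orbT.
by rewrite ge_min mP.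
Qed.

(** * Displacement of deck transformations *)

Section DeckTranslations.
Variables (R : realType) (X : metricType R) (x0 : X) (Y : length_cover x0).
Hypothesis cX : compact [set: X].
Hypothesis nX : no_conjugate_points X.
Implicit Types (a b y z w : Y) (g h : R -> X).
Let p : Y -> X := @lc_map _ _ _ Y.
Local Notation r := (lc_rad Y).
Local Notation loop g := (is_path (R := R) g x0 x0).
Let T g : Y -> Y := @lc_act _ _ _ Y g.

Lemma cover_proper a (s : R) : compact (closed_ballm a s).
Proof. exact: closed_ball_compact. Qed.

Lemma cover_geodesically_unique a b (g h : R -> Y) :
  geodesic (fun a b => (mdist a b)%:E) g a b -> geodesic (fun a b => (mdist a b)%:E) h a b ->
  forall t, I01 t -> g t = h t.
Proof.
have [_] := nX (@lc_universal _ _ _ Y) a b.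
suff -> : lifted_dist (@lc_map _ _ _ Y) = fun a b => (mdist a b)%:E by exact.
by apply/funext => u; apply/funext => v; exact: lc_lifted_dist.
Qed.

Lemma cover_fibre_inj a b : mdist a b < r -> p a = p b -> a = b.
Proof.
by move=> ab e; apply: mdist_positivity; rewrite -lc_local_iso // -/p e mdistxx.
Qed.

(** Finitely many balls of radius [r / 2] cover the compact ball, and each contains at most one
    point of the fibre. *)
Lemma fibre_ball_finite x z (s : R) : finite_set [set w : Y | p w = x /\ mdist z w <= s].
Proof.
have rg := lc_rad_gt0 Y; have r2 : 0 < r / 2 by lra.
have [a _|C Ccov] := compact_finite_cover (U := fun c : Y => [set w | mdist c w < r / 2]) (@cover_proper z s).
  by exists a; exact: nbhs_mdist.
have /choice[f fP] (c : Y) : exists v : Y, forall w, p w = x -> mdist c w < r / 2 -> w = v.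
  have [[w [pw cw]]|nw] := pselect (exists w, p w = x /\ mdist c w < r / 2); last first.
    by exists c => w pw cw; exfalso; apply: nw; exists w.
  exists w => v pv cv; apply: cover_fibre_inj; last by rewrite pv pw.
  by apply: le_lt_trans (metric_triangle _ c _) _; rewrite metric_sym; lra.
apply: (@sub_finite_set _ _ (f @` [set` C])); last exact/finite_image/finite_seq.
move=> w /= [pw zw]; have [c cC cw] := Ccov w zw.
by exists c => //; rewrite -(fP c w).
Qed.

Lemma act_isometry g : loop g -> dist_preserving (T g).
Proof. by move=> lg a b; exact: lc_act_iso. Qed.

Lemma act_revK g a : loop g -> T g (T (revp g) a) = a.
Proof.
by move=> lg; have := lc_act_rev a (loop_rev lg); rewrite rev_pathK.
Qed.

(* Points that almost minimize are moved by the deck group near a fixed z; the conjugates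
   of g so obtained move z within a ball, where the fibre of z is finite. *)
Lemma displacement_attained g : loop g ->
  exists y, forall z, mdist y (T g y) <= mdist z (T g z).
Proof.
move=> lg; set l := translation_length (T g).
have rg := lc_rad_gt0 Y.
have app (e : R) : 0 < e -> exists y, mdist y (T g y) < l + e.
  move=> e0; have hi : has_inf [set mdist y (T g y) | y in [set: Y]].
    split; first by have [a _] := lc_surj Y x0; exists (mdist a (T g a)), a.
    by exists 0 => _ [z _ <-]; exact: mdist_ge0.
  by have [_ [y _ <-] ye] := inf_adherent e0 hi; exists y.
have /choice[y yP] (n : nat) : exists y, mdist y (T g y) < l + n.+1%:R^-1.
  by apply: app; rewrite invr_gt0.
have [|x [_ cl]] := @cX (p \o y @ \oo) _; first exact: filterT.
have [z pz] := lc_surj Y x.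
(* One [e] comes from the near-minimality of [y n], the other two from moving the translate of [y n]
   to [z] at both ends of the displacement. *)
have close (e : R) : 0 < e -> e < r -> exists2 h, loop h &
    mdist z (T h (T g (T (revp h) z))) < l + 3 * e.
  move=> e0 er.
  have M : (p \o y @ \oo) [set u | exists2 n, n.+1%:R^-1 < e & u = p (y n)].
    by apply: filterS (near_infty_natSinv_lt (PosNum e0)) => n ne; exists n.
  have [_ [[n ne ->] /= xn]] := cl _ _ M (nbhs_mdist x e0).
  have [u [pu zu]] : exists u, p u = p (y n) /\ mdist z u = mdist x (p (y n)).
    by rewrite -pz; apply: lc_lift; rewrite pz; exact: lt_trans er.
  have [h lh hu] := lc_act_transitive (esym pu).
  exists h => //.
  have uy : T (revp h) u = y n by rewrite -hu; exact: lc_act_rev.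
  have := yP n; rewrite -(act_isometry lh) /T hu -/T -uy => d1.
  have d2 : mdist (T h (T g (T (revp h) u))) (T h (T g (T (revp h) z))) = mdist u z.
    by rewrite (act_isometry lh) (act_isometry lg) (act_isometry (loop_rev lh)).
  have := metric_triangle z u (T h (T g (T (revp h) z))).
  have := metric_triangle u (T h (T g (T (revp h) u))) (T h (T g (T (revp h) z))).
  rewrite d2 (metric_sym u z) zu => h1 h2.
  have d3 := lt_trans d1 (_ : l + n.+1%:R^-1 < l + e); rewrite ltrD2l in d3; have {}d3 := d3 ne.
  lra.
pose W := [set w : Y | (exists2 h, loop h & w = T h (T g (T (revp h) z)))].
suff [w [h lh ->] wl] : exists2 w, W w & mdist z w <= l.
  exists (T (revp h) z) => v; apply: (@le_trans _ _ l); last exact: translation_length_le.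
  by rewrite -(act_isometry lh) act_revK.
apply: contrapT => nW.
have pW w : W w -> p w = x.
  by move=> [h lh ->]; rewrite /p /T !lc_act_map //; exact: loop_rev.
have fin : finite_set [set w : Y | W w /\ mdist z w <= l + 3 * r].
  apply: sub_finite_set (fibre_ball_finite x z (l + 3 * r)).
  by move=> w /= [Ww zw]; split=> //; exact: pW.
have [w [Ww _]|m lm mP] := finite_above (f := mdist z) (l := l) fin.
  by rewrite ltNge; apply/negP => wl; apply: nW; exists w.
(* By finiteness the displacements of [z] under conjugates stay at least [m > l]; with
   [3 * e <= m - l] this contradicts [close]. *)
pose e := Num.min (r / 2) ((m - l) / 3).
have e0 : 0 < e by rewrite lt_min; apply/andP; split; lra.
have er : e < r by rewrite gt_min; apply/orP; left; lra.
have em : 3 * e <= m - l.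
  have : e <= (m - l) / 3 by rewrite ge_min lexx orbT.
  lra.
have [h lh hz] := close e e0 er.
have mW : m <= mdist z (T h (T g (T (revp h) z))).
  by apply: mP; split; [exists h|apply: ltW; lra].
lra.
Qed.

Lemma act_axial g : loop g -> axial (T g).
Proof.
move=> lg; have [y ymin] := displacement_attained lg.
exists y => n; rewrite (minimal_displacement_axial cover_proper _ cover_geodesically_unique (act_isometry lg) ymin).
  congr (_ * _); apply/eqP; rewrite eq_le translation_length_le andbT.
  exact: translation_length_ge.
exact: cover_between_exact.
Qed.

(** A point moved by less than [r] stays in its fibre and is therefore fixed; a loop that fixes a
    point is null-homotopic and acts trivially. *)
Lemma translation_length_discrete g a : loop g -> T g a != a ->
  r <= translation_length (T g).
Proof.
move=> lg ga; apply: (translation_length_ge a) => y; rewrite leNgt; apply/negP => ry.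
have ey : T g y = T (fun=> x0) y.
  rewrite [RHS]lc_act_cst; apply/esym; apply: cover_fibre_inj => //.
  by rewrite /p /T lc_act_map.
have gc := lc_act_inj lg (loop_cst x0) ey.
move: ga => /eqP; apply; rewrite -[RHS]lc_act_cst.
exact: lc_act_hom lg (loop_cst x0) gc.
Qed.

End DeckTranslations.

(** * A cubical Sperner lemma *)

Section CubicalSperner.

Let addF2 (x : 'F_2) : x + x = 0.
Proof. by apply/val_inj; case: x => [[|[|m]] //]. Qed.

Let addF2_eq (x y : 'F_2) : x + y = 0 -> x = y.
Proof. by move=> e; rewrite -[y]add0r -(addF2 x) -addrA e addr0. Qed.

Implicit Types (v w : nat -> nat) (D ds : seq nat) (e f : nat).
Implicit Types (c : nat -> (nat -> nat) -> 'F_2).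

Definition inc v e : nat -> nat := fun i => (v i + (i == e))%N.
Definition upd v e (j : nat) : nat -> nat := fun i => if i == e then j else v i.
Definition del e D := [seq f <- D | f != e].

(* Value on the cube v + {0,1}^D of the mod 2 cup product of the coboundaries of the cochains in bs. *)
Fixpoint cup (bs : seq ((nat -> nat) -> 'F_2)) D v : 'F_2 :=
  if bs is b :: bs' then
    \sum_(e <- D) (b (inc v e) + b v) * cup bs' (del e D) (inc v e)
  else 1.

Lemma cup_cons b bs D v : cup (b :: bs) D v =
  \sum_(e <- D) (b (inc v e) + b v) * cup bs (del e D) (inc v e).
Proof. by []. Qed.

Lemma incC v e f : inc (inc v e) f = inc (inc v f) e.
Proof. by apply: funext => i; rewrite /inc addnAC. Qed.

Lemma delC D e f : del e (del f D) = del f (del e D).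
Proof. by rewrite /del -!filter_predI; apply: eq_filter => x /=; rewrite andbC. Qed.

Lemma sum_sym D (G : nat -> nat -> 'F_2) : (forall e f, G e f = G f e) ->
  \sum_(e <- D) \sum_(f <- del e D) G e f = 0.
Proof.
move=> sG; under eq_bigr do rewrite big_filter big_mkcond /=.
elim: D => [|x D IH]; first by rewrite big_nil.
rewrite big_cons big_cons eqxx add0r.
under [X in _ + X]eq_bigr do rewrite big_cons.
rewrite big_split /= IH addr0.
under [X in X + _]eq_bigr => f _ do rewrite sG eq_sym.
exact: addF2.
Qed.

Lemma sum_swap D (G : nat -> nat -> 'F_2) :
  \sum_(e <- D) \sum_(f <- del e D) G e f = \sum_(e <- D) \sum_(f <- del e D) G f e.
Proof.
under eq_bigr do rewrite big_filter big_mkcond /=.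
under [RHS]eq_bigr do rewrite big_filter big_mkcond /=.
rewrite exchange_big /=; apply: eq_bigr => e _; apply: eq_bigr => f _.
by rewrite eq_sym.
Qed.

(** A product of coboundaries is a cocycle: its sum over the facets of a cube vanishes mod 2. *)
Lemma cup_closed bs D v :
  \sum_(e <- D) (cup bs (del e D) (inc v e) + cup bs (del e D) v) = 0.
Proof.
elim: bs D v => [|b bs IH] D v /=.
  by apply: big1 => e _; exact: addF2.
rewrite big_split /=.
(* In each double sum the terms symmetric in [e] and [f] cancel mod 2. What remains of the two sums
   combines into the induction hypothesis at [inc v e]. *)
have E1 : \sum_(e <- D) \sum_(f <- del e D) (b (inc (inc v e) f) + b (inc v e)) * cup bs (del f (del e D)) (inc (inc v e) f) =
    \sum_(e <- D) b (inc v e) * \sum_(f <- del e D) cup bs (del f (del e D)) (inc (inc v e) f).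
  under eq_bigr do under eq_bigr do rewrite mulrDl.
  under eq_bigr do rewrite big_split /=.
  rewrite big_split /= sum_sym ?add0r; last by move=> e f; rewrite incC delC.
  by apply: eq_bigr => e _; rewrite big_distrr.
have E2 : \sum_(e <- D) \sum_(f <- del e D) (b (inc v f) + b v) * cup bs (del f (del e D)) (inc v f) =
    \sum_(e <- D) b (inc v e) * \sum_(f <- del e D) cup bs (del f (del e D)) (inc v e).
  under eq_bigr do under eq_bigr do rewrite mulrDl.
  under eq_bigr do rewrite big_split /=.
  rewrite big_split /= [X in _ + X = _](_ : _ = 0) ?addr0; last first.
    under eq_bigr do rewrite -big_distrr /=.
    rewrite -big_distrr /= [X in _ * X](_ : _ = 0) ?mulr0 //.
    rewrite -[RHS](@sum_sym D (fun e f => cup bs (del f (del e D)) v)); last by move=> e f; rewrite delC.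
    by apply: eq_bigr => e _; apply: addF2_eq; rewrite -big_split; exact: IH.
  rewrite sum_swap; apply: eq_bigr => e _; rewrite big_distrr /=.
  by apply: eq_bigr => f _; rewrite delC.
rewrite E1 E2 -big_split /=; apply: big1 => e _.
by rewrite -mulrDr -big_split /= IH mulr0.
Qed.

(** The cube has no extent in direction [e], so [c e] is constant on it and the corresponding factor
    vanishes. *)
Lemma cup_eq0 c ds D v e : e \in ds -> e \notin D ->
  (forall w, w e = v e -> c e w = c e v) -> cup (map c ds) D v = 0.
Proof.
elim: ds D v => [//|f ds IH] D v /=; rewrite inE => eds eD cv.
apply: big1_seq => g /andP[_ gD].
have ge : (e == g) = false by apply/eqP => eg; move: eD; rewrite eg gD.
case/predU1P: eds => [ef|eds].
  by rewrite -ef cv ?addF2 ?mul0r // /inc ge addn0.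
rewrite IH ?mulr0 //; first by rewrite mem_filter negb_and eD orbT.
by move=> w; rewrite {1}/inc ge addn0 => we; rewrite cv // [RHS]cv // /inc ge addn0.
Qed.

(** A nonzero term of the product follows a chain of edges of the cube, and along one of them [c e]
    changes. *)
Lemma cup_neq0 c ds D v e : cup (map c ds) D v != 0 -> e \in ds ->
  exists w w', [/\ c e w <> c e w', forall i, (v i <= w i <= v i + (i \in D))%N &
    forall i, (v i <= w' i <= v i + (i \in D))%N].
Proof.
elim: ds D v => [//|f ds IH] D v /= nz eds.
have [g gD gnz] : exists2 g, g \in D & (c f (inc v g) + c f v) * cup (map c ds) (del g D) (inc v g) != 0.
  apply: contrapT => H; move/eqP: nz; apply; apply: big1_seq => g /andP[_ gD].
  by apply/eqP; apply: contrapT => /negP h; apply: H; exists g.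
have [nz1 nz2] : c f (inc v g) + c f v != 0 /\ cup (map c ds) (del g D) (inc v g) != 0.
  by move: gnz; rewrite mulf_eq0 negb_or => /andP.
move: eds; rewrite inE => /predU1P[->|eds].
  exists (inc v g), v; split.
  - by move=> e'; move: nz1; rewrite e' addF2 eqxx.
  - move=> i; rewrite /inc leq_addr leq_add2l; case: eqP => // ->.
    by rewrite gD.
  - by move=> i; rewrite leqnn leq_addr.
have [w [w' [ww wP wP']]] := IH _ _ nz2 eds.
have key u : (forall i, (inc v g i <= u i <= inc v g i + (i \in del g D))%N) ->
    forall i, (v i <= u i <= v i + (i \in D))%N.
  move=> H i; have := H i; rewrite /inc mem_filter.
  by case: (altP (i =P g)) => [->|_]; rewrite ?gD /=; lia.
by exists w, w'; split=> //; exact: key.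
Qed.

Fixpoint grid_sum (M : nat) ds (G : (nat -> nat) -> 'F_2) v : 'F_2 :=
  if ds is e :: ds' then \sum_(j < M) grid_sum M ds' G (upd v e j) else G v.

Variable M : nat.

Lemma eq_grid_sum ds G G' v : G =1 G' -> grid_sum M ds G v = grid_sum M ds G' v.
Proof.
move=> GG; elim: ds v => [|e ds IH] v /=; first exact: GG.
by apply: eq_bigr => j _; exact: IH.
Qed.

Lemma grid_sum0 ds v : grid_sum M ds (fun=> 0) v = 0.
Proof. by elim: ds v => [//|e ds IH] v /=; apply: big1 => j _; exact: IH. Qed.

Lemma grid_sum_big (I : Type) (r : seq I) ds (G : I -> (nat -> nat) -> 'F_2) v :
  grid_sum M ds (fun w => \sum_(i <- r) G i w) v = \sum_(i <- r) grid_sum M ds (G i) v.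
Proof.
elim: ds v => [//|e ds IH] v /=; rewrite exchange_big /=.
by apply: eq_bigr => j _; exact: IH.
Qed.

Lemma updC v e f i j : e != f -> upd (upd v e i) f j = upd (upd v f j) e i.
Proof.
move=> ef; apply: funext => x; rewrite /upd; case: (x =P f) => // ->.
by rewrite eq_sym (negbTE ef).
Qed.

Lemma grid_sum_upd ds G v e j : e \notin ds ->
  grid_sum M ds G (upd v e j) = grid_sum M ds (fun w => G (upd w e j)) v.
Proof.
elim: ds v => [//|f ds IH] v /=; rewrite inE negb_or => /andP[ef eds].
by apply: eq_bigr => i _; rewrite updC // IH.
Qed.

Lemma telescope2 (H : nat -> 'F_2) n :
  \sum_(j < n) (H j.+1 + H j) = H n + H 0%N.
Proof.
elim: n => [|n IH]; first by rewrite big_ord0 addF2.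
by rewrite big_ord_recr /= IH addrC -addrA (addrA (H n)) addF2 add0r.
Qed.

Lemma del_notin e D : e \notin D -> del e D = D.
Proof. by move=> eD; apply/all_filterP/allP => f fD; apply: contra eD => /eqP <-. Qed.

(** Discrete Stokes formula in direction [e], mod 2. *)
Lemma grid_sum_telescope ds H v e : uniq ds -> e \in ds ->
  grid_sum M ds (fun w => H (inc w e) + H w) v =
  grid_sum M (del e ds) (fun w => H (upd w e M) + H (upd w e 0%N)) v.
Proof.
elim: ds v => [//|f ds IH] v /= /andP[fds uds]; rewrite inE.
have [ef _|ef /= eds] := eqVneq e f.
  rewrite /= -ef in fds *; rewrite -/(del e ds) del_notin //.
  under eq_bigr => j _ do rewrite grid_sum_upd //.
  rewrite -grid_sum_big; apply: eq_grid_sum => w.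
  rewrite -(telescope2 (fun j => H (upd w e j))); apply: eq_bigr => j _.
  congr (H _ + _); apply: funext => i; rewrite /inc /upd.
  by case: eqP => _; rewrite ?addn1 ?addn0.
have fe : f != e by rewrite eq_sym.
rewrite /del /=.
rewrite ?fe -/(del e ds) /=; apply: eq_bigr => j _; exact: IH.
Qed.

(** By [cup_closed] the product is the coboundary of [c a] times the remaining factors. On faces in
    the other directions these factors vanish by [cup_eq0]; of the two faces in direction [a] the
    lower has [c a = 0], and the upper gives the same sum in one dimension less. *)
Lemma grid_cup c ds v : uniq ds ->
  (forall e w, e \in ds -> w e = 0%N -> c e w = 0) ->
  (forall e w, e \in ds -> w e = M -> c e w = 1) ->
  grid_sum M ds (cup (map c ds) ds) v = 1.
Proof.
elim: ds v => [//|a ds IH] v uds c0 c1; have /andP[ads uds'] : (a \notin ds) && uniq ds := uds.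
pose H e w := c a w * cup (map c ds) (del e (a :: ds)) w.
transitivity (\sum_(e <- a :: ds) grid_sum M (a :: ds) (fun w => H e (inc w e) + H e w) v).
  rewrite -grid_sum_big.
  apply: eq_grid_sum => w.
  have E : \sum_(e <- a :: ds) c a w * (cup (map c ds) (del e (a :: ds)) (inc w e) +
      cup (map c ds) (del e (a :: ds)) w) = 0.
    by rewrite -mulr_sumr cup_closed mulr0.
  rewrite map_cons cup_cons -[LHS]addr0 -[X in _ + X = _]E -big_split.
  apply: eq_bigr => e _; rewrite /H /= mulrDl mulrDr -addrA; congr (_ + _).
  by rewrite addrA addF2 add0r.
rewrite big_cons big1_seq ?addr0; last first.
  move=> e /andP[_ eds]; rewrite grid_sum_telescope //; last by rewrite inE eds orbT.
  rewrite -[RHS](grid_sum0 (del e (a :: ds)) v); apply: eq_grid_sum => w.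
  have nin : e \notin del e (a :: ds) by rewrite mem_filter eqxx.
  have ein : e \in a :: ds by rewrite inE eds orbT.
  rewrite /H !(@cup_eq0 c ds _ _ e) ?mulr0 ?addr0 //.
    by move=> u; rewrite {1}/upd eqxx => ue; rewrite !c0 // /upd eqxx.
  by move=> u; rewrite {1}/upd eqxx => ue; rewrite !c1 // /upd eqxx.
rewrite grid_sum_telescope // ?mem_head //.
have -> : del a (a :: ds) = ds by rewrite /del /= eqxx -/(del a ds) del_notin.
transitivity (grid_sum M ds (cup (map c ds) ds) (upd v a M)).
  rewrite grid_sum_upd //; apply: eq_grid_sum => w; rewrite /H.
  rewrite c1 ?mem_head ?/upd ?eqxx // c0 ?mem_head ?eqxx // mul1r mul0r addr0.
  by rewrite /del /= eqxx -/(del a ds) del_notin.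
by apply: IH => // e w eds; [apply: c0|apply: c1]; rewrite inE eds orbT.
Qed.

Lemma grid_sum_neq0 ds G v : uniq ds -> grid_sum M ds G v != 0 ->
  exists w, [/\ G w != 0, forall i, i \in ds -> (w i < M)%N & forall i, i \notin ds -> w i = v i].
Proof.
elim: ds v => [|e ds IH] v /=; first by move=> _ nz; exists v.
move=> /andP[eds uds] nz.
have [j jnz] : exists j : 'I_M, grid_sum M ds G (upd v e j) != 0.
  apply: contrapT => H; move/eqP: nz; apply; apply: big1 => j _.
  by apply/eqP; apply: contrapT => /negP h; apply: H; exists j.
have [w [Gw wM wv]] := IH _ uds jnz; exists w; split=> // i; rewrite inE.
  by case/predU1P => [->|/wM //]; rewrite wv // /upd eqxx.
by rewrite negb_or => /andP[ie ids]; rewrite wv // /upd (negbTE ie).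
Qed.

(** A discrete Poincaré-Miranda theorem. The mod 2 sum of the product over all cells is 1, so some
    cell has a nonzero product, and all [k] labellings change on it. *)
Lemma kuhn_lemma (k : nat) (b : nat -> (nat -> nat) -> bool) :
  (forall e w, (e < k)%N -> w e = 0%N -> b e w = false) ->
  (forall e w, (e < k)%N -> w e = M -> b e w = true) ->
  exists v, (forall e, (e < k)%N -> (v e < M)%N) /\
    forall e, (e < k)%N -> exists w w', [/\ b e w, ~~ b e w',
      forall i, (v i <= w i <= (v i).+1)%N & forall i, (v i <= w' i <= (v i).+1)%N].
Proof.
move=> b0 b1; pose c e w : 'F_2 := (b e w)%:R.
have s1 : grid_sum M (iota 0 k) (cup (map c (iota 0 k)) (iota 0 k)) (fun=> 0%N) = 1.
  apply: grid_cup; first exact: iota_uniq.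
    by move=> e w; rewrite mem_iota /= => ek we; rewrite /c b0.
  by move=> e w; rewrite mem_iota /= => ek we; rewrite /c b1.
have nz : grid_sum M (iota 0 k) (cup (map c (iota 0 k)) (iota 0 k)) (fun=> 0%N) != 0.
  by rewrite s1 oner_eq0.
have [v [vnz vM _]] := grid_sum_neq0 (iota_uniq 0 k) nz.
exists v; split; first by move=> e ek; apply: vM; rewrite mem_iota.
move=> e ek; have ein : e \in iota 0 k by rewrite mem_iota.
have [w [w' [ww wP wP']]] := cup_neq0 vnz ein.
have wide u : (forall i, (v i <= u i <= v i + (i \in iota 0 k))%N) ->
    forall i, (v i <= u i <= (v i).+1)%N.
  by move=> H i; have := H i; case: (i \in _); lia.
have := ww; rewrite /c; case bw : (b e w); case bw' : (b e w') => //= _.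
  by exists w, w'; split; rewrite ?bw ?bw' //; exact: wide.
by exists w', w; split; rewrite ?bw ?bw' //; exact: wide.
Qed.

End CubicalSperner.

(** * Hausdorff measure *)

Lemma card_interval_le (N m L : nat) :
  (#|[pred x : 'I_N | (m <= x < m + L)%N]| <= L)%N.
Proof.
rewrite cardE -(size_map val) -{2}(size_iota m L); apply: uniq_leq_size.
  by rewrite map_inj_uniq ?enum_uniq //; exact: val_inj.
by move=> _ /mapP[x + ->]; rewrite mem_enum inE mem_iota.
Qed.

(** Each colour class lies in a box of side [L a], so the boxes must have total volume at least that
    of the grid. *)
Lemma box_count (k N : nat) (A : eqType) (J : seq A) (L : A -> nat)
  (c : {ffun 'I_k -> 'I_N} -> A) :
  (forall i, c i \in J) ->
  (forall i i' e, c i = c i' -> (i e < i' e + L (c i))%N) ->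
  (N ^ k <= \sum_(a <- J) L a ^ k)%N.
Proof.
move=> cJ cL.
have -> : (N ^ k)%N = #|{: {ffun 'I_k -> 'I_N}}| by rewrite card_ffun !card_ord.
have fib a : (#|[pred i | c i == a]| <= L a ^ k)%N.
  have [i0 i0a|none] := pickP (fun i => c i == a); last first.
    by rewrite eq_card0 // => i; rewrite !inE none.
  (* The corner of the box: in each direction a point of the class with the least coordinate. *)
  pose m e := [arg min_(i < i0 | c i == a) (i e : nat)].
  have mP e : c (m e) == a /\ forall i, c i == a -> (m e e <= i e)%N.
    by rewrite /m; case: arg_minnP.
  apply: (@leq_trans #|family (fun e : 'I_k => [pred x : 'I_N | (m e e <= x < m e e + L a)%N])|).
    apply/subset_leq_card/fintype.subsetP => i; rewrite inE => ia; apply/familyP => e.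
    rewrite inE (proj2 (mP e)) //= -(eqP ia); apply: cL.
    by rewrite (eqP ia) (eqP (proj1 (mP e))).
  rewrite card_family.
  have aux (s : seq 'I_k) (g : 'I_k -> nat) : (forall x, g x <= L a)%N ->
      (foldr muln 1 [seq g x | x <- s] <= L a ^ size s)%N.
    by move=> gL; elim: s => //= x s IH; rewrite expnS leq_mul.
  rewrite -[X in (_ <= L a ^ X)%N](card_ord k) cardT.
  by apply: aux => x; exact: card_interval_le.
rewrite -sum1_card.
apply: (@leq_trans (\sum_(i : {ffun 'I_k -> 'I_N}) \sum_(a <- J) (c i == a))%N).
  by apply: leq_sum => i _; rewrite (big_rem (c i)) //= eqxx.
rewrite exchange_big /=; apply: leq_sum => a _; apply: leq_trans (fib a).
by rewrite -sum1_card [leqRHS]big_mkcond /=; apply: leq_sum => i _; rewrite inE; case: eqP.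
Qed.

Section HausdorffCount.
Variables (R : realType).

Lemma ler_sum_uniq_seq (J : seq nat) (a : nat -> R) B : uniq J ->
  (forall j, j \in J -> (j < B)%N) -> (forall n, 0 <= a n) ->
  \sum_(j <- J) a j <= \sum_(0 <= n < B) a n.
Proof.
move=> uJ JB a0; have -> : \sum_(j <- J) a j = \sum_(n <- [seq n <- index_iota 0 B | n \in J]) a n.
  apply: perm_big; apply: uniq_perm => // [|j]; first by rewrite filter_uniq ?iota_uniq.
  by rewrite mem_filter mem_index_iota /=; case jJ : (j \in J) => //=; rewrite JB.
rewrite big_filter [leRHS](bigID (mem J)) /= lerDl.
by apply: sumr_ge0.
Qed.

Lemma geometric_half_sum B : \sum_(0 <= n < B) (2 : R) ^- n.+1 <= 1.
Proof.
suff -> : \sum_(0 <= n < B) (2 : R) ^- n.+1 = 1 - 2 ^- B by rewrite gerBl invr_ge0 exprn_ge0.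
elim: B => [|B IH]; first by rewrite big_geq // expr0 invr1 subrr.
have e : (2 : R) ^- B = 2 * 2 ^- B.+1 by rewrite exprS invfM mulrA divff ?mul1r.
by rewrite big_nat_recr //= IH e; ring.
Qed.

Lemma expr_right_continuous (x e : R) (k : nat) : 0 < e ->
  exists2 t, 0 < t & (x + t) ^+ k < x ^+ k + e.
Proof.
move=> e0; have /(@cvgrPdist_lt _ R^o) H := @exprn_continuous R k x.
have := H e e0 => /nbhs_ballP[d /= d0 dP].
exists (d / 2); first by rewrite divr_gt0.
have := dP (x + d / 2); rewrite /ball /= opprD addrA subrr sub0r normrN gtr0_norm ?divr_gt0 //.
have d2 : d / 2 < d by rewrite ltr_pdivrMr // ltr_pMr // ltr1n.
by move=> /(_ d2); rewrite distrC ltr_norml => /andP[_]; rewrite ltrBlDl.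
Qed.

Variables (X Y : metricType R).

Lemma diam_set_ub (A : set X) (d : R) x y : (forall u v, A u -> A v -> mdist u v <= d) ->
  A x -> A y -> mdist x y <= diam_set A.
Proof.
move=> Ad Ax Ay; apply: ub_le_sup; last by exists x, y.
by exists d => _ [u [v [Au [Av ->]]]]; exact: Ad.
Qed.

Lemma diam_set_ge0 (A : set X) (d : R) : (forall u v, A u -> A v -> mdist u v <= d) ->
  0 <= diam_set A.
Proof.
move=> Ad; have [[w Aw]|nA] := pselect (exists w, A w).
  by rewrite -(mdistxx w); exact: (diam_set_ub Ad Aw Aw).
rewrite /diam_set (_ : [set z | _] = set0) ?sup0 //.
by rewrite -subset0 => z [u [v [Au _]]]; apply: nA; exists u.
Qed.

(** For diameters at most 1 the larger exponent gives the smaller power. As [k] is positive, empty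
    sets and single points contribute 0 on the left. *)
Lemma diam_expr_le_hterm (A : set X) (s : R) (k : nat) : 0 <= s -> s < k%:R ->
  (forall u v, A u -> A v -> mdist u v <= 1) -> diam_set A ^+ k <= hterm s A.
Proof.
move=> s0 sk Ad; have d0 := diam_set_ge0 Ad.
have k0 : (0 < k)%N by rewrite -(ltr_nat R); exact: le_lt_trans sk.
rewrite /hterm; case: pselect => [A0|nA].
  by rewrite A0 /diam_set (_ : [set z | _] = set0) ?sup0 ?expr0n ?gtn_eqF // -subset0 => z [x [y []]].
have d1 : diam_set A <= 1.
  have /set0P[x Ax] : A != set0 by apply/eqP.
  apply: ge_sup; first by exists (mdist x x), x, x.
  by move=> _ [u [v [Au [Av ->]]]]; exact: Ad.
move: d0; rewrite le_eqVlt => /predU1P[<-|d0]; first by rewrite expr0n gtn_eqF // powR_ge0.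
rewrite -powR_mulrn ?(ltW d0) //.
have dp : 0 < diam_set A <= 1 by rewrite d0.
by apply: ger_powR => //; exact: ltW.
Qed.

Variables (p : Y -> X) (r : R) (k : nat) (s : R).
Hypothesis cX : compact [set: X].
Hypothesis r0 : 0 < r.
Hypothesis p_iso : forall a b, mdist a b < r -> mdist (p a) (p b) = mdist a b.
Hypotheses (s0 : 0 <= s) (sk : s < k%:R) (Hs : hausdorff_measure X s = 0%E).

(** Sample points of [K] are chosen whose coordinates [f e] trace a grid of mesh [1 / N], and are
    classified by a ball isometric to its image and a set of a cheap cover of [X]. Each class has
    bounded coordinate spread, so [box_count] contradicts the cheapness. *)
Lemma no_small_cover (K : set Y) (C : R) (f : nat -> Y -> R) : compact K ->
  (forall e a b, `|f e a - f e b| <= mdist a b) ->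
  (forall (q : nat -> R) (eta : R), 0 < eta -> (forall e, C < q e <= C + 1) ->
     exists y, K y /\ forall e, (e < k)%N -> `|f e y - q e| <= eta) -> False.
Proof.
move=> cK f_lip hits.
have r2 : 0 < r / 2 by rewrite divr_gt0.
have [a _|Z Zcov] := compact_finite_cover (U := fun c : Y => [set w | mdist c w < r / 2]) cK.
  by exists a; exact: nbhs_mdist.
(* Chosen so that [size Z] copies of a cover of cost [2 * eps] have total cost below 1. *)
pose eps : R := (2 * (size Z).+1%:R)^-1.
have eps0 : 0 < eps by rewrite invr_gt0 mulr_gt0.
have : (hausdorff_delta X s 1 < eps%:E)%E.
  apply: (@le_lt_trans _ _ 0%E); last by rewrite lte_fin.
  by rewrite -Hs; apply: ereal_sup_ubound => /=; exists 1.
move=> /ereal_inf_lt[_ [U [Ucov [Ud ->]]] Usum].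
pose rho n := diam_set (U n).
have rho0 n : 0 <= rho n by apply: diam_set_ge0; exact: Ud.
have rhok n : rho n ^+ k <= hterm s (U n) by apply: diam_expr_le_hterm => //; exact: Ud.
have hterm0 n : 0 <= hterm s (U n).
  by rewrite /hterm; case: pselect => // _; exact: powR_ge0.
(* The sets are thickened to have a finite subcover; the extra cost [eps * 2 ^- n.+1] sums to at
   most [eps]. *)
have /choice[tau tauP] (n : nat) : exists t : R, 0 < t /\ (rho n + t) ^+ k < rho n ^+ k + eps * 2 ^- n.+1.
  have [|t t0 tP] := @expr_right_continuous (rho n) (eps * 2 ^- n.+1) k.
    by rewrite mulr_gt0 // invr_gt0 exprn_gt0.
  by exists t.
have tau0 n : 0 < tau n by have [] := tauP n.
pose V n := [set x | exists2 u, U n u & mdist u x < tau n / 8].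
have [x _|J0 J0cov] := compact_finite_cover (U := V) cX.
  have [n _ Unx] := Ucov x I; exists n.
  have : 0 < tau n / 8 by rewrite divr_gt0.
  by move=> /(nbhs_mdist x); apply: filterS => y xy; exists x.
pose J := undup J0.
have Jcov x : exists2 j, j \in J & V j x.
  by have [j jJ Vj] := J0cov x I; exists j; rewrite ?mem_undup.
(* The mesh [1 / N] is at most [tau j / 8] for every set of the finite subcover. *)
pose N := (\max_(j <- J) Num.truncn (8 / tau j)).+1.
have N0 : 0 < N%:R :> R by rewrite ltr0n.
have Ntau j : j \in J -> 8 <= N%:R * tau j.
  move=> jJ; rewrite -ler_pdivrMr //; apply: ltW; apply: lt_le_trans (truncnS_gt _) _.
  by rewrite ler_nat ltnS; apply: (leq_bigmax_seq (F := fun j => Num.truncn (8 / tau j))).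
have N10 : 0 < N%:R^-1 :> R by rewrite invr_gt0.
have /choice[y yP] (i : {ffun 'I_k -> 'I_N}) : exists y, K y /\
    forall e : 'I_k, `|f e y - (C + (i e).+1%:R / N%:R)| <= N%:R^-1.
  (* Past the k-th coordinate any admissible value will do; [C + 1] is taken. *)
  pose q (e : nat) : R := if insub e is Some e' then C + (i e').+1%:R / N%:R else C + 1.
  have [|y [Ky yq]] := hits q N%:R^-1 N10.
    move=> e; rewrite /q; case: insub => [e'|]; last by rewrite lexx ltrDl ltr01.
    by rewrite ltrDl divr_gt0 //= lerD2l ler_pdivrMr // mul1r ler_nat.
  by exists y; split=> // e; have := yq e (ltn_ord e); rewrite /q valK.
have /choice[c cP] (i : {ffun 'I_k -> 'I_N}) : exists a : Y * nat,
    [/\ a.1 \in Z, mdist a.1 (y i) < r / 2, a.2 \in J & V a.2 (p (y i))].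
  have [z zZ zy] := Zcov _ (proj1 (yP i)); have [j jJ Vj] := Jcov (p (y i)).
  by exists (z, j).
(* The spread in units of the mesh: diameter [rho], thickening by [tau / 8] on both sides, and
   approximation error [2 / N], which is at most [tau / 4]. *)
pose L (a : Y * nat) := (Num.truncn (N%:R * (rho a.2 + tau a.2 / 2))).+1.
have cL i i' e : c i = c i' -> (i e < i' e + L (c i))%N.
  move=> cc; have [_ zy jJ [u Uu uy]] := cP i; have [_ zy' _ [u' Uu' uy']] := cP i'.
  rewrite -cc in zy' Uu' uy'; set j := (c i).2 in jJ Uu uy Uu' uy'.
  have yy : mdist (y i) (y i') <= rho j + tau j / 4.
    rewrite -p_iso; last first.
      by apply: le_lt_trans (metric_triangle _ (c i).1 _) _; rewrite metric_sym [ltRHS](splitr r) ltrD.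
    have uu : mdist u u' <= rho j by apply: diam_set_ub (Ud j) Uu Uu'.
    have h1 := metric_triangle (p (y i)) u (p (y i')).
    have h2 := metric_triangle u u' (p (y i')).
    rewrite (metric_sym (p (y i)) u) in h1.
    lra.
  have h1 := proj2 (yP i) e; have h2 := proj2 (yP i') e; have h3 := f_lip e (y i) (y i').
  have key : ((i e)%:R - (i' e)%:R) / N%:R <= rho j + tau j / 4 + 2 / N%:R.
    have gen (F G P Q w m t : R) : `|F - (C + (P + 1) * w)| <= w -> `|G - (C + (Q + 1) * w)| <= w ->
        `|F - G| <= m -> m <= t -> (P - Q) * w <= t + 2 * w.
      by rewrite !ler_norml => /andP[? ?] /andP[? ?] /andP[? ?] ?; lra.
    rewrite -(natr1 (i e)) in h1; rewrite -(natr1 (i' e)) in h2.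
    exact: gen h1 h2 h3 yy.
  have {}key : (i e)%:R - (i' e)%:R <= N%:R * (rho j + tau j / 2).
    move: key; rewrite ler_pdivrMr // => key; apply: le_trans key _.
    rewrite mulrDl mulfVK ?gt_eqF //; have := Ntau j jJ; lra.
  rewrite -(ltr_nat R) natrD -ltrBlDl; apply: le_lt_trans key _.
  exact: truncnS_gt.
pose J2 := [seq (z, j) | z <- Z, j <- J].
have count : (N ^ k <= \sum_(a <- J2) L a ^ k)%N.
  apply: (@box_count k N (Y * nat)%type J2 L c) => // i.
  by have [h1 _ h2 _] := cP i; rewrite (surjective_pairing (c i)); apply/allpairsP; exists (c i).
have LN z j : j \in J -> (L (z, j))%:R <= N%:R * (rho j + tau j) :> R.
  move=> jJ; rewrite /L /= -natr1.
  have ge0 : 0 <= N%:R * (rho j + tau j / 2).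
    by rewrite mulr_ge0 ?(ltW N0) // addr_ge0 // divr_ge0 // ltW.
  have : (Num.truncn (N%:R * (rho j + tau j / 2)))%:R <= N%:R * (rho j + tau j / 2) by rewrite truncn_le.
  have := Ntau j jJ; lra.
have Jsum : \sum_(j <- J) (rho j + tau j) ^+ k <= 2 * eps.
  apply: (@le_trans _ _ (\sum_(j <- J) (hterm s (U j) + eps * 2 ^- j.+1))).
    by apply: ler_sum => j _; have [_ /ltW h] := tauP j; apply: le_trans h _; rewrite lerD2r.
  rewrite big_split /= mulrDl mul1r.
  pose B := (\max_(j <- J) j).+1.
  have JB j : j \in J -> (j < B)%N.
    by move=> jJ; rewrite ltnS; apply: (leq_bigmax_seq (F := fun j => j)).
  apply: lerD.
    apply: le_trans (ler_sum_uniq_seq (undup_uniq _) JB hterm0) _.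
    rewrite -lee_fin -sumEFin; apply: le_trans (ltW Usum).
    by apply: nneseries_lim_ge => n _ _; rewrite lee_fin.
  rewrite -mulr_sumr -[leRHS]mulr1 ler_wpM2l ?(ltW eps0) //.
  apply: le_trans (ler_sum_uniq_seq (undup_uniq _) JB _) (geometric_half_sum B).
  by move=> n; rewrite invr_ge0 exprn_ge0.
have : (N%:R ^+ k : R) <= (size Z)%:R * (N%:R ^+ k * (2 * eps)).
  rewrite -[leLHS]natrX; apply: (@le_trans _ _ ((\sum_(a <- J2) L a ^ k)%N%:R)); first by rewrite ler_nat.
  rewrite natr_sum big_allpairs /=.
  apply: (@le_trans _ _ (\sum_(z <- Z) N%:R ^+ k * (2 * eps))); last first.
    by rewrite big_const_seq count_predT iter_addr_0 [leRHS]mulr_natl.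
  apply: ler_sum => z _; apply: (@le_trans _ _ (\sum_(j <- J) N%:R ^+ k * (rho j + tau j) ^+ k)).
    rewrite big_seq [leRHS]big_seq; apply: ler_sum => j jJ; rewrite natrX -exprMn.
    by apply: lerXn2r; rewrite ?nnegrE ?LN // mulr_ge0 ?addr_ge0 // ltW.
  by rewrite -mulr_sumr ler_wpM2l // exprn_ge0 // ltW.
have Nk : 0 < N%:R ^+ k :> R by rewrite exprn_gt0.
rewrite mulrCA -[leLHS]mulr1 ler_pM2l //.
rewrite /eps; set m := size Z; move=> h.
have m1 : 0 < m.+1%:R :> R by rewrite ltr0n.
have : m%:R * (2 * (2 * m.+1%:R)^-1) < 1 :> R.
  by rewrite invfM (mulrA 2) divff // mul1r ltr_pdivrMr // mul1r ltr_nat.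
by rewrite ltNge h.
Qed.

End HausdorffCount.

(** * Cubes spanned by an orbit *)

Section OrbitCube.
Variables (R : realType) (Y : metricType R).
Hypothesis proper : forall (a : Y) (s : R), compact (closed_ballm a s).
Hypothesis between : forall (a b : Y) (s : R), 0 <= s <= mdist a b ->
  exists c, mdist a c = s /\ mdist c b = mdist a b - s.
Let dh (a b : Y) := (mdist a b)%:E.
Hypothesis unique : forall (a b : Y) (g h : R -> Y),
  geodesic dh g a b -> geodesic dh h a b -> forall t, I01 t -> g t = h t.
Variables (k : nat) (orb : (nat -> nat) -> Y) (L : R) (a0 : Y).
Hypothesis L_ge0 : 0 <= L.
Hypothesis orb_step : forall n i, (i < k)%N -> mdist (orb n) (orb (inc n i)) <= L.
Hypothesis orb_bounded : forall M : nat, exists r : R,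
  forall n : nat -> nat, (forall i, (i < k)%N -> (n i <= M)%N) -> mdist a0 (orb n) <= r.
Hypothesis orb_far : forall B : R, exists M : nat, forall e (n n' : nat -> nat), (e < k)%N ->
  n e = 0%N -> n' e = M -> B <= mdist (orb n) (orb n').
Implicit Types (v w : nat -> R).

Definition set_coord v (j : nat) (x : R) : nat -> R := fun i => if i == j then x else v i.
Definition truncs v : nat -> nat := fun i => Num.truncn (v i).

(* Piecewise geodesic in the first j coordinates; the other ones are rounded down. *)
Fixpoint cube_map (j : nat) v : Y :=
  if j is j'.+1 then
    broken_geodesic between (fun n => cube_map j' (set_coord v j' n%:R)) (v j')
  else orb (truncs v).

Lemma truncs_set v j : truncs (set_coord v j (Num.truncn (v j))%:R) = truncs v.
Proof.
by apply/funext => i; rewrite /truncs /set_coord; case: eqP => // ->; rewrite natrK.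
Qed.

Lemma truncs_setS v j : truncs (set_coord v j (Num.truncn (v j)).+1%:R) = inc (truncs v) j.
Proof.
apply/funext => i; rewrite /truncs /set_coord /inc; case: eqP => [->|_]; last by rewrite addn0.
by rewrite natrK addn1.
Qed.

(** A point is no further from the lower vertex of its last interpolation than the two vertices are
    from each other, that is [2 * c + L]; reaching the orbit adds one more [c]. *)
Definition cube_radius (j : nat) : R := iter j (fun c => 3 * c + L) 0.

Lemma cube_radius_ge0 j : 0 <= cube_radius j.
Proof. by elim: j => [|j IH] //=; rewrite addr_ge0 // mulr_ge0. Qed.

Lemma cube_map_near j v : (j <= k)%N ->
  mdist (cube_map j v) (orb (truncs v)) <= cube_radius j.
Proof.
elim: j v => [|j IH] v jk; first by rewrite /= mdistxx.
pose u := set_coord v j (Num.truncn (v j))%:R; pose u' := set_coord v j (Num.truncn (v j)).+1%:R.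
have h1 : mdist (cube_map j.+1 v) (cube_map j u) <= mdist (cube_map j u) (cube_map j u').
  exact: broken_geodesic_near.
have h2 := IH u (ltnW jk); have h3 := IH u' (ltnW jk).
have h4 := orb_step (truncs v) jk.
rewrite truncs_set in h2; rewrite truncs_setS in h3.
have h5 := metric_triangle (cube_map j.+1 v) (cube_map j u) (orb (truncs v)).
have h6 := metric_triangle (cube_map j u) (orb (truncs v)) (cube_map j u').
have h7 := metric_triangle (orb (truncs v)) (orb (inc (truncs v) j)) (cube_map j u').
rewrite [cube_radius _]/= -/(cube_radius j).
rewrite (metric_sym (orb (inc _ _))) in h7; lra.
Qed.

Lemma cube_map_bounded (M : nat) : exists r : R, forall j v, (j <= k)%N ->
  (forall i, (i < k)%N -> v i <= M%:R) -> closed_ballm a0 r (cube_map j v).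
Proof.
have [r rP] := orb_bounded M.
have mono : forall i j : nat, (i <= j)%N -> cube_radius i <= cube_radius j.
  move=> i j /subnK <-; elim: (j - i)%N => [//|n IH]; apply: le_trans IH _.
  rewrite addSn /=; have := cube_radius_ge0 (n + i); rewrite -/(cube_radius (n + i)).
  by have := L_ge0; lra.
exists (r + cube_radius k) => j v jk vM; rewrite /closed_ballm /=.
apply: le_trans (metric_triangle _ (orb (truncs v)) _) _; apply: lerD.
  apply: rP => i ik; rewrite /truncs -[leqRHS](@natrK R); apply: le_truncn; exact: vM.
by rewrite metric_sym; apply: le_trans (cube_map_near v jk) (mono _ _ jk).
Qed.

(** Induction on the number of interpolated coordinates. These stay below [M], while the others may
    reach [M + 1], since interpolating evaluates the previous map at integers rounded up. *)
Lemma cube_map_uniformly_continuous (M : nat) j : (j <= k)%N -> forall e : R, 0 < e ->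
  exists2 d : R, 0 < d & forall v w,
    (forall i, (i < k)%N -> 0 <= v i <= M.+1%:R) -> (forall i, (i < k)%N -> 0 <= w i <= M.+1%:R) ->
    (forall i, (i < j)%N -> v i <= M%:R) -> (forall i, (i < j)%N -> w i <= M%:R) ->
    (forall i, (i < j)%N -> `|v i - w i| < d) -> (forall i, (j <= i)%N -> v i = w i) ->
    mdist (cube_map j v) (cube_map j w) < e.
Proof.
have [r rP] := cube_map_bounded M.+1.
elim: j => [|j IH] jk e e0.
  exists 1 => // v w _ _ _ _ _ vw; have -> : v = w by apply/funext => i; exact: vw.
  by rewrite mdistxx.
have [d d0 dP] := broken_geodesic_uniformly_continuous proper between unique M a0 r e0.
have [d' d'0 d'P] := IH (ltnW jk) d d0.
exists (Num.min d d'); first by rewrite lt_min d0.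
move=> v w vb wb vM wM vw vwE /=.
have set_b u (n : nat) : (forall i, (i < k)%N -> 0 <= u i <= M.+1%:R) -> (n <= M.+1)%N ->
    forall i, (i < k)%N -> 0 <= set_coord u j n%:R i <= M.+1%:R.
  by move=> ub nM i ik; rewrite /set_coord; case: eqP => _; [rewrite ler0n ler_nat|exact: ub].
have set_M u (n : nat) : (forall i, (i < j.+1)%N -> u i <= M%:R) ->
    forall i, (i < j)%N -> set_coord u j n%:R i <= M%:R.
  by move=> uM i ij; rewrite /set_coord ltn_eqF // uM // ltnW.
apply: dP.
- move=> n nM; split; apply: rP; try exact: ltnW.
    by move=> i ik; have /andP[] := set_b v n vb nM i ik.
  by move=> i ik; have /andP[] := set_b w n wb nM i ik.
- move=> n nM; apply: d'P.
  + exact: set_b.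
  + exact: set_b.
  + exact: set_M.
  + exact: set_M.
  + move=> i ij; rewrite /set_coord ltn_eqF //.
    by have := vw i (ltnW ij); rewrite lt_min => /andP[].
  + move=> i ji; rewrite /set_coord; case: eqP => // ij; apply: vwE.
    by rewrite ltn_neqAle ji eq_sym andbT; apply/eqP.
- by have /andP[-> _] := vb j jk; rewrite vM.
- by have /andP[-> _] := wb j jk; rewrite wM.
- by have := vw j (ltnSn j); rewrite lt_min => /andP[].
Qed.

Definition face_dist (e : nat) (y : Y) : R := inf [set mdist y (orb n) | n in [set n | n e = 0%N]].

Lemma face_dist_le e y n : n e = 0%N -> face_dist e y <= mdist y (orb n).
Proof.
move=> ne; apply: ge_inf; last by exists n.
by exists 0 => _ [m _ <-]; exact: mdist_ge0.
Qed.

Lemma face_dist_ge e y (B : R) : (forall n, n e = 0%N -> B <= mdist y (orb n)) -> B <= face_dist e y.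
Proof.
move=> H; apply: lb_le_inf; first by exists (mdist y (orb (fun=> 0%N))), (fun=> 0%N).
by move=> _ [n ne <-]; exact: H.
Qed.

Lemma face_dist_lipschitz e (y z : Y) : `|face_dist e y - face_dist e z| <= mdist y z.
Proof.
have key (a b : Y) : face_dist e a - mdist a b <= face_dist e b.
  apply: face_dist_ge => n ne; rewrite lerBlDl.
  exact: le_trans (face_dist_le a ne) (metric_triangle _ _ _).
rewrite ler_norml; have := key y z; have := key z y; rewrite (metric_sym z y).
by move=> h1 h2; apply/andP; split; lra.
Qed.

Lemma orbit_cube_hits : exists (C : R) (K : set Y), compact K /\
  forall (q : nat -> R) (eta : R), 0 < eta -> (forall e, C < q e <= C + 1) ->
    exists y, K y /\ forall e, (e < k)%N -> `|face_dist e y - q e| <= eta.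
Proof.
set C := cube_radius k; have C0 : 0 <= C := cube_radius_ge0 k.
(* The cube stays within [C] of the orbit, so [face_dist e] is at most [C] on its own face and at
   least [C + 1] on the opposite one. *)
have [M MP] := orb_far (2 * C + 1).
have [r rP] := cube_map_bounded M.
exists C, (closed_ballm a0 r); split; first exact: proper.
move=> q eta eta0 qP.
have [d d0 dP] := cube_map_uniformly_continuous M (leqnn k) eta0.
pose N := (Num.truncn d^-1).+1.
have N0 : 0 < N%:R :> R by rewrite ltr0n.
have Nd : N%:R^-1 < d.
  by rewrite -[ltRHS]invrK ltf_pV2 ?posrE ?invr_gt0 //; exact: truncnS_gt.
(* Grid points of mesh [1 / N] below [d]; [minn] keeps the points inside the cube for indices beyond
   the grid. *)
pose pt (m : nat -> nat) : nat -> R := fun i => if (i < k)%N then (minn (m i) (M * N))%:R / N%:R else 0.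
have ptM m i : (i < k)%N -> 0 <= pt m i <= M%:R.
  move=> ik; rewrite /pt ik divr_ge0 //= ler_pdivrMr // -natrM ler_nat.
  exact: geq_minr.
pose y m := cube_map k (pt m).
have yK m : closed_ballm a0 r (y m).
  by apply: rP => // i ik; have /andP[] := ptM m i ik.
pose b (e : nat) (m : nat -> nat) := q e <= face_dist e (y m).
have b0 e m : (e < k)%N -> m e = 0%N -> b e m = false.
  move=> ek me; apply/negbTE; rewrite /b -ltNge; have /andP[qC _] := qP e.
  apply: le_lt_trans qC; apply: le_trans (face_dist_le _ _) (cube_map_near _ (leqnn k)).
  by rewrite /truncs /pt ek me min0n mul0r truncn0.
have b1 e m : (e < k)%N -> m e = (M * N)%N -> b e m = true.
  move=> ek me; rewrite /b; have /andP[_ qC] := qP e; apply: le_trans qC _.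
  apply: face_dist_ge => n ne.
  have tM : truncs (pt m) e = M.
    by rewrite /truncs /pt ek me minnn natrM mulfK ?gt_eqF // natrK.
  have h1 := MP e n (truncs (pt m)) ek ne tM.
  have h2 := cube_map_near (pt m) (leqnn k).
  have h3 := metric_triangle (orb n) (y m) (orb (truncs (pt m))).
  by rewrite (metric_sym (orb n) (y m)) in h3; rewrite -/C in h2; rewrite /y in h3 *; lra.
have [m [mM mP]] := kuhn_lemma b0 b1.
have adj (m' : nat -> nat) : (forall i, (m i <= m' i <= (m i).+1)%N) -> mdist (y m) (y m') < eta.
  move=> mm; apply: dP.
  - move=> i ik; have /andP[-> h] := ptM m i ik; apply: le_trans h _; by rewrite ler_nat.
  - move=> i ik; have /andP[-> h] := ptM m' i ik; apply: le_trans h _; by rewrite ler_nat.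
  - by move=> i ik; have /andP[] := ptM m i ik.
  - by move=> i ik; have /andP[] := ptM m' i ik.
  - move=> i ik; rewrite /pt ik -mulrBl normrM (ger0_norm (x := N%:R^-1)) ?invr_ge0 ?(ltW N0) //.
    apply: le_lt_trans Nd; rewrite ler_piMl ?invr_ge0 ?(ltW N0) //.
    rewrite distrC ler_norml; have := mm i; move: (m i) (m' i) => x x' /andP[xx x'x].
    apply/andP; split.
      by rewrite lerBrDl -lerBrDr opprK natr1 ler_nat; lia.
    by rewrite lerBlDl natr1 ler_nat; lia.
  - by move=> i ki; rewrite /pt ltnNge ki.
(* Within [eta] of [y m] there are vertices on both sides of the level [q e], and [face_dist e] is
   1-Lipschitz. *)
exists (y m); split=> // e ek; have [w [w' [bw bw' mw mw']]] := mP e ek.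
have h1 := adj w mw; have h2 := adj w' mw'.
have h3 := face_dist_lipschitz e (y m) (y w); have h4 := face_dist_lipschitz e (y m) (y w').
move: bw bw'; rewrite /b -ltNge => bw bw'.
move: h3 h4; rewrite !ler_norml => /andP[? ?] /andP[? ?]; apply/andP; split; lra.
Qed.

End OrbitCube.

(** * Abelian groups with a discrete norm *)

Section FreeAbelian.
Variable A : zmodType.
Implicit Types (a b : A) (e : nat -> A) (m : nat -> int) (k : nat).

Definition zcomb k e m : A := \sum_(i < k) e i *~ m i.

Definition zindep k e := forall m, zcomb k e m = 0 -> forall i, (i < k)%N -> m i = 0.

Definition append k e a : nat -> A := fun i => if i == k then a else e i.

Lemma zcomb_append k e a m : zcomb k.+1 (append k e a) m = zcomb k e m + a *~ m k.
Proof.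
rewrite /zcomb big_ord_recr /= /append eqxx; congr (_ + _).
by apply: eq_bigr => i _; rewrite ltn_eqF.
Qed.

Lemma zcombB k e m m' : zcomb k e (fun i => m i - m' i) = zcomb k e m - zcomb k e m'.
Proof. by rewrite /zcomb -sumrB; apply: eq_bigr => i _; rewrite mulrzBr. Qed.

Lemma zcombZ k e m (n : int) : zcomb k e (fun i => m i * n) = zcomb k e m *~ n.
Proof. by rewrite /zcomb mulrz_suml; apply: eq_bigr => i _; rewrite mulrzA. Qed.

Lemma eq_zcomb k e m m' : (forall i, (i < k)%N -> m i = m' i) -> zcomb k e m = zcomb k e m'.
Proof. by move=> mm; apply: eq_bigr => i _; rewrite mm. Qed.

Lemma zcomb_incr k e m i : (i < k)%N ->
  zcomb k e (fun j => m j + (j == i)%:Z) = zcomb k e m + e i.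
Proof.
move=> ik; rewrite /zcomb; under eq_bigr do rewrite mulrzDr.
rewrite big_split /=; congr (_ + _); rewrite (bigD1 (Ordinal ik)) //= eqxx mulr1z.
rewrite big1 ?addr0 // => j ji; case: eqP => [e'|_]; last by rewrite mulr0z.
by move/eqP: ji; case; apply: val_inj.
Qed.

(** The kernel of the last functional has a basis by induction. An element with the least nonzero
    absolute value of that functional completes it, by Euclidean division. *)
Lemma subgroup_basis k (f : nat -> {additive A -> int}) (H : A -> Prop) :
  (forall a b, H a -> H b -> H (a - b)) ->
  (forall a, H a -> (forall i, (i < k)%N -> f i a = 0) -> a = 0) ->
  exists j e, [/\ forall i, (i < j)%N -> H (e i), zindep j e &
    forall a, H a -> exists m, a = zcomb j e m].
Proof.
elim: k H => [|k IH] H HB f0.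
  exists 0%N, (fun=> 0); split=> //.
  move=> a Ha; exists (fun=> 0); rewrite /zcomb big_ord0; exact: f0.
have HZ a (n : int) : H a -> H (a *~ n).
  move=> Ha; have H0 : H 0 by rewrite -(subrr a); exact: HB.
  have HN b : H b -> H (- b) by move=> Hb; rewrite -sub0r; exact: HB.
  have Hnat (q : nat) : H (a *+ q).
    by elim: q => [|q Hq]; rewrite ?mulr0n // mulrS -[a *+ q]opprK; apply: HB => //; exact: HN.
  by case: n => q; rewrite ?NegzE ?mulrNz -pmulrn //; exact: HN.
have [||j [e [eH' ei eg]]] := IH (fun a => H a /\ f k a = 0).
- by move=> a b [Ha fa] [Hb fb]; split; [exact: HB|rewrite raddfB /= fa fb subr0].
- move=> a [Ha fa] fi; apply: f0 => // i; rewrite ltnS leq_eqVlt => /predU1P[->//|]; exact: fi.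
have [[b0 [Hb0 fb0]]|allz] := pselect (exists b, H b /\ f k b != 0); last first.
  exists j, e; split=> // [i /eH'[]//|a Ha]; apply: eg; split=> //.
  by apply/eqP; apply: contrapT => /negP fa; apply: allz; exists a.
have exn : exists n, `[< exists b, H b /\ f k b != 0 /\ `|f k b|%N = n >].
  by exists `|f k b0|%N; apply/asboolP; exists b0.
case: (ex_minnP exn) => n /asboolP[b [Hb [fb bn]]] nmin.
have div a : H a -> (f k a %% f k b)%Z = 0.
  move=> Ha; apply/eqP; apply: contrapT => /negP nz.
  pose c := a - b *~ (f k a %/ f k b)%Z.
  have fc : f k c = (f k a %% f k b)%Z.
    by rewrite /c raddfB raddfMz /= {1}(divz_eq (f k a) (f k b)) -mulrzr intz mulrC addrAC subrr add0r.
  have := nmin `|f k c|%N; rewrite leqNgt => /(_ _)/negP; apply.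
    by apply/asboolP; exists c; split; [apply: HB => //; exact: HZ|rewrite fc].
  rewrite fc -bn; have := ltz_mod (f k a) fb; have := modz_ge0 (f k a) fb; lia.
exists j.+1, (append j e b); split.
- move=> i; rewrite ltnS /append; case: eqP => // ij; rewrite leq_eqVlt => /predU1P[//|/eH'[]//].
- move=> m; rewrite zcomb_append => mz.
  have fe0 : f k (zcomb j e m) = 0.
    rewrite /zcomb raddf_sum big1 // => i _; rewrite raddfMz /=.
    by have [_ ->] := eH' i (ltn_ord i); rewrite mul0rz.
  have mj : m j = 0.
    have := congr1 (f k) mz; rewrite raddfD raddf0 /= fe0 add0r raddfMz /= -mulrzr intz => /eqP.
    by rewrite mulf_eq0 (negbTE fb) /= => /eqP.
  move: mz; rewrite mj mulr0z addr0 => /ei mi i; rewrite ltnS leq_eqVlt => /predU1P[->//|]; exact: mi.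
- move=> a Ha; have [|m am] := eg (a - b *~ (f k a %/ f k b)%Z).
    split; first by apply: HB => //; exact: HZ.
    rewrite raddfB raddfMz /= {1}(divz_eq (f k a) (f k b)) div // addr0 -mulrzr intz mulrC.
    by rewrite subrr.
  exists (fun i => if i == j then (f k a %/ f k b)%Z else m i).
  rewrite zcomb_append eqxx (@eq_zcomb j e _ m); last by move=> i ij; rewrite ltn_eqF.
  by rewrite -am subrK.
Qed.

End FreeAbelian.

Section DiscreteNorm.
Variables (R : archiRealFieldType) (A : zmodType) (N : A -> R) (eps : R) (K : nat).
Hypothesis eps_gt0 : 0 < eps.
Hypothesis N_ge : forall a, a != 0 -> eps <= N a.
Hypothesis N_muln : forall a n, N (a *+ n) = n%:R * N a.
Hypothesis N_opp : forall a, N (- a) = N a.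
Hypothesis N_add : forall a b, N (a + b) <= N a + N b.
Hypothesis rank_le : forall k e, zindep (A := A) k e -> (k <= K)%N.
Implicit Types (a b : A) (e : nat -> A) (m : nat -> int).

Let N0 : N 0 = 0.
Proof. by rewrite -(mulr0n 0) N_muln mul0r. Qed.

Let N_mulz a (n : int) : N (a *~ n) = `|n|%:~R * N a.
Proof.
case: n => n; first by rewrite -pmulrn N_muln ger0_norm // -pmulrn.
by rewrite NegzE mulrNz N_opp -pmulrn N_muln normrN -pmulrn.
Qed.

Let N_ge0 a : 0 <= N a.
Proof.
have [->|/N_ge h] := eqVneq a 0; first by rewrite N0.
by apply: le_trans h; exact: ltW.
Qed.

Let N_lt a : N a < eps -> a = 0.
Proof. by move=> h; apply/eqP; apply: contraLR h => /N_ge; rewrite leNgt. Qed.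

Let N_sum k e m : N (zcomb k e m) <= \sum_(i < k) `|m i|%:~R * N (e i).
Proof.
rewrite /zcomb; elim/big_ind2: _ => [|x s y t sx ty|i _]; first by rewrite N0.
- by apply: le_trans (N_add _ _) _; exact: lerD.
- by rewrite N_mulz.
Qed.

Let torsion_free a n : (0 < n)%N -> a *+ n = 0 -> a = 0.
Proof.
move=> n0 an; apply: N_lt; have := N_muln a n; rewrite an N0 => /esym/eqP.
by rewrite mulf_eq0 pnatr_eq0 (gtn_eqF n0) => /= /eqP ->.
Qed.

Let maximal_family : exists k e, zindep (A := A) k e /\
  forall a, exists n m, (0 < n)%N /\ a *+ n = zcomb k e m.
Proof.
have ex : exists k, `[< exists e, zindep (A := A) k e >].
  by exists 0%N; apply/asboolP; exists (fun=> 0).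
have bd k : `[< exists e, zindep (A := A) k e >] -> (k <= K)%N.
  by move=> /asboolP[e]; exact: rank_le.
case: (ex_maxnP ex bd) => k /asboolP[e ei] kmax.
exists k, e; split=> // a; apply: contrapT => noa.
have : zindep k.+1 (append k e a).
  move=> m; rewrite zcomb_append => mz.
  have mk : m k = 0.
    apply/eqP; apply: contrapT => /negP mk0; apply: noa.
    (* Multiplication by the sign of [m k] makes the coefficient of [a] a positive natural
       number. *)
    exists `|m k|%N, (fun i => - m i * sgz (m k)); split; first by rewrite absz_gt0.
    rewrite zcombZ (_ : zcomb k e (fun i => - m i) = a *~ m k); last first.
      rewrite /zcomb; under eq_bigr do rewrite mulrNz.
      by rewrite sumrN; apply/esym/eqP; rewrite -subr_eq0 opprK addrC; apply/eqP.
    by rewrite -mulrzA mulrC -abszEsg -pmulrn.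
  move: mz; rewrite mk mulr0z addr0 => /ei mi i; rewrite ltnS leq_eqVlt => /predU1P[->//|]; exact: mi.
move=> ind; have := kmax k.+1; rewrite ltnn => /(_ _)/negP; apply=> //.
by apply/asboolP; exists (append k e a).
Qed.

(* Dirichlet's pigeonhole argument: some multiple q a with q <= Q ^ k is within distance
   S / Q < eps of the lattice spanned by e, hence belongs to it. *)
Let uniform_multiple : exists k e P, [/\ zindep (A := A) k e, (0 < P)%N &
  forall a, exists m, a *+ P = zcomb k e m].
Proof.
have [k [e [ei egen]]] := maximal_family.
pose S := \sum_(i < k) N (e i).
have S0 : 0 <= S by apply: sumr_ge0.
pose Q := (Num.truncn (S / eps)).+1.
have QS : S < Q%:R * eps by rewrite -ltr_pdivrMr //; exact: truncnS_gt.
(* The multiplier of each element is at most [Q ^ k], so the factorial is a multiple of all of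
   them. *)
exists k, e, (Q ^ k)`!; split=> //; first exact: fact_gt0.
move=> a; suff [q [w [q0 qQ qa]]] : exists (q : nat) w, [/\ (0 < q)%N, (q <= Q ^ k)%N & a *+ q = zcomb k e w].
  have /dvdnP[c cE] : (q %| (Q ^ k)`!)%N by apply: dvdn_fact; rewrite q0.
  by exists (fun i => w i * c%:Z); rewrite zcombZ -qa cE mulnC mulrnA pmulrn.
have [n [m [n0 am]]] := egen a.
have nz : (n%:Z != 0) by rewrite eqz_nat -lt0n.
(* Numerators over [n] of the fractional parts of the coordinates of [a *+ j]. *)
pose rem (j : nat) (i : nat) : nat := `|((j%:Z * m i) %% n)%Z|%N.
have remE j i : (rem j i)%:Z = ((j%:Z * m i) %% n)%Z by rewrite /rem gez0_abs // modz_ge0.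
have rem_lt j i : (rem j i < n)%N.
  by rewrite -ltz_nat remE; exact: (ltz_mod (j%:Z * m i) nz).
have box_lt j i : (Q * rem j i %/ n < Q)%N by rewrite ltn_divLR // ltn_pmul2l.
pose box (j : 'I_(Q ^ k).+1) : {ffun 'I_k -> 'I_Q} := [ffun i => Ordinal (box_lt j (i : 'I_k))].
have [j [j' [jj' bb]]] : exists j j' : 'I_(Q ^ k).+1, (j < j')%N /\ box j = box j'.
  have /injectivePn[x [y xy exy]] : ~~ injectiveb box.
    apply/negP => /injectiveP inj.
    by have := leq_card _ inj; rewrite card_ffun !card_ord ltnn.
  have : (x < y)%N || (y < x)%N by rewrite -neq_ltn.
  by case/orP => h; [exists x, y|exists y, x].
pose w i := (((j' : nat)%:Z * m i) %/ n)%Z - (((j : nat)%:Z * m i) %/ n)%Z.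
exists (j' - j)%N, w; split; first by rewrite subn_gt0.
  by apply: leq_trans (leq_subr _ _) _; rewrite -ltnS.
pose s (i : nat) : int := (rem j' i)%:Z - (rem j i)%:Z.
have sQ i : (i < k)%N -> `|s i| * Q%:Z < n%:Z.
  move=> ik; have := congr1 (fun g : {ffun 'I_k -> 'I_Q} => (g (Ordinal ik) : nat)) bb.
  rewrite !ffunE /= /s; move: (rem j i) (rem j' i) => x y.
  have := divn_eq (Q * x) n; have := divn_eq (Q * y) n.
  have := ltn_pmod (Q * x) n0; have := ltn_pmod (Q * y) n0.
  move: (Q * x %/ n)%N (Q * y %/ n)%N (Q * x %% n)%N (Q * y %% n)%N => d d' r r' hr hr' e1 e2 dd.
  have : `|(Q * y)%N%:Z - (Q * x)%N%:Z| < n%:Z by rewrite e1 e2 dd; lia.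
  by rewrite !PoszM -mulrBr normrM mulrC.
apply/eqP; rewrite -subr_eq0; apply/eqP; apply: N_lt.
(* [n * b] has coordinates [s i] with [|s i| * Q < n], because both multiples fall in the same box;
   hence [N b] is at most [S / Q]. *)
set b := _ - _.
have nb : b *+ n = zcomb k e s.
  rewrite /b mulrnBl -mulrnA mulnC mulrnA am.
  rewrite [X in X - _]pmulrn [X in _ - X]pmulrn -!zcombZ -zcombB.
  apply: eq_zcomb => i _; rewrite /s !remE /w.
  have e1 := divz_eq ((j : nat)%:Z * m i) n; have e2 := divz_eq ((j' : nat)%:Z * m i) n.
  have -> : (j' - j)%N%:Z = (j' : nat)%:Z - (j : nat)%:Z by rewrite subzn // ltnW.
  lia.
have n0R : 0 < n%:R :> R by rewrite ltr0n.
have Q0R : 0 < Q%:R :> R by rewrite ltr0n.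
have key : Q%:R * (n%:R * N b) <= n%:R * S.
  rewrite -N_muln nb; apply: (@le_trans _ _ (Q%:R * \sum_(i < k) `|s i|%:~R * N (e i))).
    by rewrite ler_pM2l.
  rewrite !mulr_sumr; apply: ler_sum => i _; rewrite mulrA ler_wpM2r //.
  have := ltW (sQ i (ltn_ord i)); rewrite -(ler_int R) intrM mulrC.
  by rewrite -!pmulrn.
rewrite -(ltr_pM2l n0R) -(ltr_pM2l Q0R); apply: le_lt_trans key _.
by rewrite mulrCA ltr_pM2l.
Qed.

(** Sending [a] to the coordinates of [a *+ P] is additive, and injective since there is no torsion.
    So the group embeds in a lattice, and [subgroup_basis] applies. *)
Lemma discrete_norm_free : exists k e, zindep (A := A) k e /\
  forall a, exists m, a = zcomb k e m.
Proof.
have [k [e [P [ei P0 eP]]]] := uniform_multiple.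
have /choice[phi phiP] := eP.
have uniq m m' : zcomb k e m = zcomb k e m' -> forall i, (i < k)%N -> m i = m' i.
  move=> mm i ik; apply/eqP; rewrite -subr_eq0; apply/eqP.
  by apply: (ei (fun i => m i - m' i)) => //; rewrite zcombB mm subrr.
pose f (i : nat) (a : A) : int := if (i < k)%N then phi a i else 0.
have fB i : {morph f i : a b / a - b}.
  move=> a b; rewrite /f; case: ifP => ik; last by rewrite subr0.
  apply: (uniq (phi (a - b)) (fun i => phi a i - phi b i)) => //.
  by rewrite zcombB -!phiP mulrnBl.
pose F (i : nat) : {additive A -> int} := HB.pack (f i) (GRing.isZmodMorphism.Build A int (f i) (fB i)).
have [||j [e' [_ e'i e'g]]] := @subgroup_basis A k F (fun=> True).
- by [].
- move=> a _ Fa; apply: (torsion_free P0); rewrite phiP /zcomb big1 // => i _.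
  by have := Fa i (ltn_ord i); rewrite /F /= /f ltn_ord => ->; rewrite mulr0z.
by exists j, e'; split=> // a; exact: e'g.
Qed.

End DiscreteNorm.

(** * The deck group of an Abelian subgroup *)

(** Elements are maps of the cover rather than loops, so that homotopic loops are identified and the
    group laws are equalities. *)
Definition deck_group (R : realType) (X : metricType R) (x0 : X) (Y : length_cover x0)
  (S : set (R -> X)) := {f : Y -> Y | exists g, S g /\ f = @lc_act _ _ _ Y g}.
HB.instance Definition _ R X x0 Y S := gen_eqMixin (@deck_group R X x0 Y S).
HB.instance Definition _ R X x0 Y S := gen_choiceMixin (@deck_group R X x0 Y S).

Section AbelianDeckGroup.
Variables (R : realType) (X : metricType R) (x0 : X) (Y : length_cover x0).
Variable S : set (R -> X).
Hypothesis cX : compact [set: X].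
Hypothesis nX : no_conjugate_points X.
Hypothesis SA : abelian_loop_subgroup x0 S.
Local Notation G := (deck_group Y S).
Local Notation T := (@lc_act _ _ _ Y).

Let S_loop g : S g -> is_path g x0 x0. Proof. by move=> Sg; have [[H _] _] := SA; exact: H. Qed.
Let S_cst : S (fun=> x0). Proof. by have [[_ [_ [H _]]] _] := SA. Qed.
Let S_concat g h : S g -> S h -> S (concat g h). Proof. by move=> Sg Sh; have [[_ [_ [_ [H _]]]] _] := SA; exact: H. Qed.
Let S_rev g : S g -> S (revp g). Proof. by move=> Sg; have [[_ [_ [_ [_ H]]]] _] := SA; exact: H. Qed.
Let S_comm g h : S g -> S h -> homotopic (concat g h) (concat h g). Proof. by move=> Sg Sh; have [_ H] := SA; exact: H. Qed.

Lemma deck_inj (f h : G) : (forall y, sval f y = sval h y) -> f = h.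
Proof.
by case: f h => [f pf] [h ph] /= fh; apply: eq_exist; apply/funext.
Qed.

Definition deck_of g (Sg : S g) : G := exist _ (T g) (ex_intro _ g (conj Sg erefl)).
Definition deck_rep (f : G) : R -> X := projT1 (cid (proj2_sig f)).
Lemma deck_repS f : S (deck_rep f).
Proof. by rewrite /deck_rep; case: cid => g []. Qed.
Lemma deck_repE f : sval f = T (deck_rep f).
Proof. by rewrite /deck_rep; case: cid => g []. Qed.

Definition deck0 : G := deck_of S_cst.
Definition deckN (f : G) : G := deck_of (S_rev (deck_repS f)).
Definition deckD (f h : G) : G := deck_of (S_concat (deck_repS f) (deck_repS h)).

Lemma deckDE f h y : sval (deckD f h) y = sval f (sval h y).
Proof.
by rewrite /= !deck_repE lc_act_concat //; apply: S_loop; exact: deck_repS.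
Qed.

Lemma deck0E y : sval deck0 y = y.
Proof. exact: lc_act_cst. Qed.

Lemma deckDA : associative deckD.
Proof. by move=> f g h; apply: deck_inj => y; rewrite !deckDE. Qed.

Lemma deckDC : commutative deckD.
Proof.
move=> f g; apply: deck_inj => y /=; have Sf := deck_repS f; have Sg := deck_repS g.
by apply: lc_act_hom; [apply/S_loop/S_concat|apply/S_loop/S_concat|exact: S_comm].
Qed.

Lemma deck0D : left_id deck0 deckD.
Proof. by move=> f; apply: deck_inj => y; rewrite deckDE deck0E. Qed.

Lemma deckND : left_inverse deck0 deckN deckD.
Proof.
move=> f; apply: deck_inj => y; rewrite deckDE deck0E.
by rewrite [sval f]deck_repE /= lc_act_rev //; apply: S_loop; exact: deck_repS.
Qed.

Definition deck_zmod : zmodType := HB.pack G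
  (GRing.isZmodule.Build G deckDA deckDC deck0D deckND).
Local Notation A := deck_zmod.
Implicit Types (f h : A) (e : nat -> A) (m : nat -> int).

Let fun_of (f : A) : Y -> Y := sval (f : G).

Lemma fun_ofD f h y : fun_of (f + h) y = fun_of f (fun_of h y).
Proof. exact: deckDE. Qed.

Lemma fun_of0 y : fun_of 0 y = y.
Proof. exact: deck0E. Qed.

Lemma fun_of_inj f h : (forall y, fun_of f y = fun_of h y) -> f = h.
Proof. exact: deck_inj. Qed.

Lemma fun_ofK f y : fun_of (- f) (fun_of f y) = y.
Proof. by rewrite -fun_ofD addNr fun_of0. Qed.

Lemma fun_ofMn f n y : fun_of (f *+ n) y = iter n (fun_of f) y.
Proof. by elim: n => [|n IH]; [rewrite mulr0n fun_of0|rewrite mulrS fun_ofD IH]. Qed.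

Lemma fun_of_isometry f : dist_preserving (fun_of f).
Proof. by rewrite /fun_of deck_repE; apply: act_isometry; apply: S_loop; exact: deck_repS. Qed.

Lemma fun_of_axial f : axial (fun_of f).
Proof. by rewrite /fun_of deck_repE; apply: act_axial => //; apply: S_loop; exact: deck_repS. Qed.

Lemma fun_of_map f y : lc_map (fun_of f y) = lc_map y.
Proof. by rewrite /fun_of deck_repE lc_act_map //; apply: S_loop; exact: deck_repS. Qed.

Lemma fun_of_free f h y : fun_of f y = fun_of h y -> f = h.
Proof.
move=> e; apply: fun_of_inj => z; rewrite /fun_of !deck_repE in e *.
have lf := S_loop (deck_repS f); have lh := S_loop (deck_repS h).
by apply: lc_act_hom => //; exact: lc_act_inj e.
Qed.

Let y0 : Y := projT1 (cid (lc_surj Y x0)).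
Let N f : R := translation_length (fun_of f).

Lemma norm_ge f : f != 0 -> lc_rad Y <= N f.
Proof.
move=> f0; have nf : fun_of f y0 != y0.
  apply: contra f0 => /eqP e; apply/eqP; apply: (@fun_of_free _ _ y0).
  by rewrite fun_of0.
rewrite /N; move: nf; rewrite /fun_of deck_repE => nf.
by apply: translation_length_discrete nf; apply: S_loop; exact: deck_repS.
Qed.

Lemma norm_muln f n : N (f *+ n) = n%:R * N f.
Proof.
rewrite /N -translation_length_iter; [|exact: fun_of_isometry|exact: fun_of_axial].
by congr translation_length; apply/funext => y; rewrite fun_ofMn.
Qed.

Lemma norm_opp f : N (- f) = N f.
Proof.
have le h : N (- h) <= N h.
  apply: (translation_length_ge y0) => y.
  have := translation_length_le (fun_of (- h)) (fun_of h y).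
  by rewrite fun_ofK metric_sym.
by apply/eqP; rewrite eq_le le -{1}[f]opprK le.
Qed.

Lemma norm_add f h : N (f + h) <= N f + N h.
Proof.
have e : fun_of (f + h) = fun_of f \o fun_of h by apply/funext => y; rewrite fun_ofD.
rewrite /N e; apply: translation_length_comp; try exact: fun_of_isometry; try exact: fun_of_axial.
  by rewrite -e; exact: fun_of_axial.
by move=> y; rewrite -!fun_ofD addrC.
Qed.

Let disp f : R := mdist y0 (fun_of f y0).

Lemma disp_add f h : disp (f + h) <= disp f + disp h.
Proof.
rewrite /disp fun_ofD; apply: le_trans (metric_triangle _ (fun_of f y0) _) _.
by rewrite fun_of_isometry.
Qed.

Lemma disp_muln f n : disp (f *+ n) <= n%:R * disp f.
Proof.
elim: n => [|n IH]; first by rewrite mulr0n mul0r /disp fun_of0 mdistxx.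
rewrite mulrS; apply: le_trans (disp_add _ _) _.
by rewrite -natr1 mulrDl mul1r addrC lerD2r.
Qed.

Lemma disp_sub f h : disp (h - f) = mdist (fun_of f y0) (fun_of h y0).
Proof.
by rewrite /disp -(fun_of_isometry f) -fun_ofD addrC subrK.
Qed.

(** The action is free, so elements correspond to points of the orbit of [y0], and a fibre meets
    each ball in a finite set. *)
Lemma finite_disp_le (B : R) : finite_set [set f : A | disp f <= B].
Proof.
have fin := fibre_ball_finite cX (lc_map y0) y0 B.
apply: (@sub_finite_set _ _ ((fun f : A => fun_of f y0) @^-1` [set w : Y | lc_map w = lc_map y0 /\ mdist y0 w <= B])).
  by move=> f /= fB; split=> //; exact: fun_of_map.
apply: finite_preimage => //.
by move=> f h _ _; exact: fun_of_free.
Qed.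

Variable d : R.
Hypothesis dX : hausdorff_dim X = d%:E.

(** If [d < k], some exponent below [k] has measure 0. The orbit of the positive combinations of the
    family then spans cubes whose face distances contradict [no_small_cover]. *)
Lemma rank_le_dim k e : zindep k e -> k%:R <= d.
Proof.
move=> ei; rewrite leNgt; apply/negP => dk.
have : (hausdorff_dim X < k%:R%:E)%E by rewrite dX lte_fin.
move=> /ereal_inf_lt[_ [s [s0 Hs] <-]]; rewrite lte_fin => sk.
pose comb (n : nat -> nat) : A := zcomb k e (fun i => (n i)%:Z).
pose orb (n : nat -> nat) : Y := fun_of (comb n) y0.
pose L := \sum_(i < k) disp (e i).
have disp_ge0 f : 0 <= disp f := mdist_ge0 _ _.
have L0 : 0 <= L by apply: sumr_ge0.
have dL i : (i < k)%N -> disp (e i) <= L.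
  move=> ik; rewrite /L (bigD1 (Ordinal ik)) //= lerDl.
  by apply: sumr_ge0.
have comb_inc n i : (i < k)%N -> comb (inc n i) = comb n + e i.
  by move=> ik; rewrite /comb -zcomb_incr //; exact: eq_zcomb.
have step n i : (i < k)%N -> mdist (orb n) (orb (inc n i)) <= L.
  move=> ik; rewrite /orb comb_inc // -disp_sub addrC addKr; exact: dL.
have bounded (M : nat) : exists r : R, forall n : nat -> nat,
    (forall i, (i < k)%N -> (n i <= M)%N) -> mdist y0 (orb n) <= r.
  exists (M%:R * L) => n nM; rewrite -/(disp (comb n)) /comb /zcomb /L mulr_sumr.
  apply: (@le_trans _ _ (\sum_(i < k) disp (e i *~ (n i)%:Z))).
    elim/big_ind2: _ => [|f x h z fx hz|//]; first by rewrite /disp fun_of0 mdistxx.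
    by apply: le_trans (disp_add _ _) _; exact: lerD.
  apply: ler_sum => i _; rewrite -pmulrn; apply: le_trans (disp_muln _ _) _.
  by rewrite ler_wpM2r // ler_nat nM.
(* Finitely many elements have displacement at most [B], and independence makes their coefficients
   unique. [M] exceeds all of these coefficients, so a difference with coefficient [M] is not among
   them. *)
have far (B : R) : exists M : nat, forall i (n n' : nat -> nat), (i < k)%N ->
    n i = 0%N -> n' i = M -> B <= mdist (orb n) (orb n').
  have /choice[bd bdP] f : exists M : nat, forall m, f = zcomb k e m -> forall i, (i < k)%N -> (`|m i| < M)%N.
    have [[m fm]|nm] := pselect (exists m, f = zcomb k e m); last first.
      by exists 0%N => m fm; exfalso; apply: nm; exists m.
    exists (\max_(i < k) `|m i|%N).+1 => m' fm' i ik.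
    have -> : m' i = m i.
      apply/eqP; rewrite -subr_eq0; apply/eqP; apply: (ei (fun i => m' i - m i)) => //.
      by rewrite zcombB -fm -fm' subrr.
    by rewrite ltnS; apply: (leq_bigmax (F := fun i : 'I_k => `|m i|%N) (Ordinal ik)).
  have /finite_seqP[fs fsE] := finite_disp_le B.
  exists (\max_(f <- fs) bd f)%N => i n n' ik ni n'i; rewrite leNgt; apply/negP => lt.
  have ffs : comb n' - comb n \in fs.
    have : [set f : A | disp f <= B] (comb n' - comb n) by rewrite /= disp_sub ltW.
    by rewrite fsE.
  have E : comb n' - comb n = zcomb k e (fun i => (n' i)%:Z - (n i)%:Z) by rewrite zcombB.
  have := bdP _ _ E i ik; rewrite ni subr0 absz_nat n'i ltnNge => /negP; apply.
  exact: (leq_bigmax_seq (F := bd)).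
have [C [K [cK hits]]] := orbit_cube_hits (cover_proper cX) (cover_between_exact cX)
  (cover_geodesically_unique nX) L0 step bounded far.
apply: (no_small_cover cX (lc_rad_gt0 Y) (@lc_local_iso _ _ _ Y) s0 sk Hs cK _ hits).
by move=> i a b; exact: face_dist_lipschitz.
Qed.

Lemma abelian_loop_subgroup_free : exists k : nat, k%:R <= d /\ isomorphic_to_Zk S k.
Proof.
have d0 : 0 <= d.
  rewrite -lee_fin -dX; apply/ereal_infP => _ [s [s0 _] <-].
  by rewrite lee_fin.
have [|k [e [ei eg]]] := @discrete_norm_free R A N (lc_rad Y) (Num.truncn d)
  (lc_rad_gt0 Y) norm_ge norm_muln norm_opp norm_add.
  by move=> k e /rank_le_dim; rewrite truncn_ge_nat.
exists k; split; first exact: rank_le_dim ei.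
(* Row vectors become coefficient sequences, extended by 0. *)
pose co (a : 'rV[int]_k) (i : nat) : int := if insub i is Some j then a ord0 j else 0.
have coE a (j : 'I_k) : co a j = a ord0 j by rewrite /co valK.
pose phi a := deck_rep (zcomb k e (co a)).
have phiE a y : T (phi a) y = fun_of (zcomb k e (co a)) y by rewrite /fun_of deck_repE.
have phiS a : S (phi a) by exact: deck_repS.
exists phi; split=> //; split; [|split].
- move=> a b; apply: (@lc_act_inj _ _ _ Y _ _ y0); [exact: S_loop|exact/S_loop/S_concat|].
  rewrite lc_act_concat; [|exact: S_loop|exact: S_loop].
  rewrite !phiE -fun_ofD; congr (fun_of _ _); rewrite /zcomb -big_split /=.
  by apply: eq_bigr => i _; rewrite !coE mxE mulrzDr.
- move=> a b ab; have E : zcomb k e (co a) = zcomb k e (co b).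
    apply: (@fun_of_free _ _ y0); rewrite -!phiE.
    by apply: lc_act_hom => //; exact: S_loop.
  apply/rowP => j; rewrite -!coE; apply/eqP; rewrite -subr_eq0; apply/eqP.
  by apply: (ei (fun i => co a i - co b i)) => //; rewrite zcombB E subrr.
- move=> g Sg; have [m gm] := eg (deck_of Sg : A).
  exists (\row_j m j); apply: (@lc_act_inj _ _ _ Y _ _ y0); [exact: S_loop|exact: S_loop|].
  rewrite phiE (_ : zcomb k e _ = deck_of Sg :> A) // gm.
  by apply: eq_zcomb => i ik; rewrite (coE _ (Ordinal ik)) mxE.
Qed.

End AbelianDeckGroup.

Theorem theorem1 (R : realType) (X : metricType R) (d : R) :
  compact [set: X] ->
  length_space (R:=R) X ->
  locally_simply_connected R X ->
  no_conjugate_points (R:=R) X ->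
  hausdorff_dim (R:=R) X = d%:E ->
  forall (x0 : X) (S : set (R -> X)),
    abelian_loop_subgroup (R:=R) x0 S ->
    exists k : nat, (k%:R <= d) /\ isomorphic_to_Zk (R:=R) S k.
Proof.
move=> cX lX sX nX dX x0 S SA.
have [Y _] := length_cover_exists x0 cX lX sX.
exact: (abelian_loop_subgroup_free Y cX nX SA dX).
Qed.
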